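(* Let $\beta\in(0,1]$, and assume the following. (A1) $\mathbb{A}_x$ and $\mathbb{B}_x$ are compact for every $x\in\mathbb{E}$. (A2) The correspondences $x\mapsto\mathbb{A}_x$ and $x\mapsto\mathbb{B}_x$ are continuous. (A3) $(x,a,b)\mapsto r(x,a,b)$ is continuous. (A4) For all bounded continuous $v:\mathbb{E}\to\mathbb{R}$, $(x,a,b)\mapsto\int v(x')Q(dx'|x,a,b)$ is continuous. a) For all $n=1,\ldots,N$ we have $V_n\in\mathcal{C}$ and, for all $(x,\gamma)\in\mathbb{E}\times(0,\bar\gamma]$, $$V_n(x,\gamma)=(TV_{n-1})(x,\gamma)=\sup_\mu\inf_\nu\int V_{n-1}(x',\beta\gamma)\,\tilde Q(dx'|x,\gamma,\mu,\nu),$$ where $\mu$ ranges over $\mathbb{P}(\mathbb{A}_x)$ and $\nu$ over $\mathbb{P}(\mathbb{B}_x)$. b) For $n=1,\ldots,N$ there exist measurable functions $(\mu_n^*,\nu_n^* ):\mathbb{E}\times(0,\bar\gamma]\to\mathbb{P}(\mathbb{A})\times\mathbb{P}(\mathbb{B})$ which are admissible, i.e. $\mu_n^*(x,\gamma)\in\mathbb{P}(\mathbb{A}_x)$ and $\nu_n^*(x,\gamma)\in\mathbb{P}(\mathbb{B}_x)$, such that for all $(x,\gamma)$ the pair $(\mu_n^*(x,\gamma),\nu_n^*(x,\gamma))$ is a saddle point of $$(\mu,\nu)\mapsto (LV_{n-1})(x,\gamma,\mu,\nu),\qquad(\mu,\nu)\in\mathbb{P}(\mathbb{A}_x)\times\mathbb{P}(\mathbb{B}_x).$$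 Then $V_N$ is the value of the $N$-stage stochastic game, and the policies $\pi^*=(f_n^* )_{n=0,\ldots,N-1}$, $\sigma^*=(g_n^* )_{n=0,\ldots,N-1}$ with $f_n^*(x):=\mu_{N-n}^*(x,\gamma\beta^n)$ and $g_n^*(x):=\nu_{N-n}^*(x,\gamma\beta^n)$ are optimal for player 1 and player 2, respectively (for the game with risk-sensitivity parameter $\gamma$).
   Context: Game model. $\mathbb{E}$ (state space), $\mathbb{A}$ and $\mathbb{B}$ (action spaces of players 1 and 2) are Borel spaces. There is a measurable set $D_{\mathbb A}\subset\mathbb{E}\times\mathbb{A}$ containing the graph of a measurable map $\mathbb{E}\to\mathbb{A}$, and $\mathbb{A}_x=\{a:(x,a)\in D_{\mathbb A}\}$ is the (non-empty) set of admissible actions of player 1 in state $x$; analogously $D_{\mathbb B}$ and $\mathbb{B}_x$ for player 2. $Q$ is a transition (probability) kernel from $\mathbb{E}\times\mathbb{A}\times\mathbb{B}$ to $\mathbb{E}$, and $r:\mathbb{E}\times\mathbb{A}\times\mathbb{B}\to\mathbb{R}$ is a measurable reward function with $0\le r\le\bar r$ for a constant $\bar r$. A correspondence $x\mapsto\mathbb{A}_x$ is continuous if it is upper-semicontinuous ($\{x\in\mathbb{E}:\mathbb{A}_x\cap C\ne\emptyset\}$ is closed for every closed $C\subset\mathbb{A}$) and lower-semicontinuous ($\{x\in\mathbb{E}:\mathbb{A}_x\cap D\neq\emptyset\}$ is open for every open $D\subset\mathbb{A}$). For a Borel space $S$, $\mathbb{P}(S)$ is the set of probability measures on $S$ with the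 weak topology. $\mathbb{F}$ is the set of measurable maps $f:\mathbb{E}\to\mathbb{P}(\mathbb{A})$ with $f(x)\in\mathbb{P}(\mathbb{A}_x)$ for all $x$; $\mathbb{G}$ is the set of measurable maps $g:\mathbb{E}\to\mathbb{P}(\mathbb{B})$ with $g(x)\in\mathbb{P}(\mathbb{B}_x)$ for all $x$. A (randomized Markovian) policy of player 1 (player 2) is a sequence $(f_n)_{n\ge0}$ in $\mathbb{F}$ ($(g_n)_{n\ge0}$ in $\mathbb{G}$); for the $n$-stage game only the first $n$ decision rules matter. Policies $\pi=(f_n),\sigma=(g_n)$ and an initial state $x$ define (Ionescu Tulcea) the law $\mathrm{P}_x^{\pi\sigma}$ of the process $(X_0,A_0,B_0,X_1,A_1,B_1,\ldots)$ with $X_0=x$, where given $X_n$ the actions $A_n,B_n$ are chosen independently according to $f_n(X_n)$ and $g_n(X_n)$ and $X_{n+1}\sim Q(\cdot|X_n,A_n,B_n)$; $\mathbb{E}_x^{\pi\sigma}$ is the corresponding expectation. Fix $\bar\gamma>0$ and a horizon $N\in\mathbb{N}$. For $(x,\gamma)\in\mathbb{E}\times(0,\bar\gamma]$, $$V_{n\pi\sigma}(x,\gamma):=\mathbb{E}_x^{\pi\sigma}\Big[\exp\Big(\gamma\sum_{k=0}^{n-1}\beta^k r(X_k,A_k,B_k)\Big)\Big],\qquad V_n(x,\gamma):=\inf_\sigma\sup_\pi V_{n\pi\sigma}(x,\gamma),\qquad V_0:=1.$$ $V_N$ is called the value of the $N$-stage game if $\inf_\sigma\sup_\pi V_{N\pi\sigma}=\sup_\pi\inf_\sigma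 V_{N\pi\sigma}$. A policy $\pi^*$ is optimal for player 1 if $V_{N\pi^*\sigma}(x,\gamma)\ge\sup_\pi\inf_{\sigma'}V_{N\pi\sigma'}(x,\gamma)$ for all $\sigma$ (and all $x$); $\sigma^*$ is optimal for player 2 if $V_{N\pi\sigma^*}(x,\gamma)\le\inf_\sigma\sup_{\pi'}V_{N\pi'\sigma}(x,\gamma)$ for all $\pi$ (and all $x$). A pair $(\mu^*,\nu^* )$ is a saddle point of a function $h(\mu,\nu)$ if $h(\mu,\nu^* )\le h(\mu^*,\nu^* )\le h(\mu^*,\nu)$ for all $\mu,\nu$. $\mathcal{C}$ is the set of bounded continuous functions on $\mathbb{E}\times(0,\bar\gamma]$. Define $\tilde Q(dx'|x,\gamma,a,b):=e^{\gamma r(x,a,b)}Q(dx'|x,a,b)$, and for $\mu\in\mathbb{P}(\mathbb{A}_x)$, $\nu\in\mathbb{P}(\mathbb{B}_x)$, $\tilde Q(dx'|x,\gamma,\mu,\nu):=\int\int\tilde Q(dx'|x,\gamma,a,b)\mu(da)\nu(db)$. For bounded measurable $v:\mathbb{E}\times(0,\bar\gamma]\to\mathbb{R}$, $$(Lv)(x,\gamma,\mu,\nu):=\int v(x',\beta\gamma)\,\tilde Q(dx'|x,\gamma,\mu,\nu),\qquad (Tv)(x,\gamma):=\inf_{\nu\in\mathbb{P}(\mathbb{B}_x)}\sup_{\mu\in\mathbb{P}(\mathbb{A}_x)}(Lv)(x,\gamma,\mu,\nu).$$ *)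

(* Defs.v *)
From HB Require Import structures.
From mathcomp Require Import all_boot all_order all_algebra.
From mathcomp Require Import all_classical all_reals all_analysis.
From mathcomp Require Import measurable_realfun.

Set Implicit Arguments.
Unset Strict Implicit.
Unset Printing Implicit Defensive.
Import Order.TTheory GRing.Theory Num.Theory.
Import numFieldNormedType.Exports.

Local Open Scope classical_set_scope.
Local Open Scope ring_scope.

Definition separable (T : topologicalType) :=
  exists2 D : set T, countable D & dense D.

(* A Borel space is a (nonempty, as measurable types are pointed) topological
   space homeomorphic to a Borel subset of a Polish space, with its Borel
   sigma-algebra; a Hausdorff pseudometric space is a metric space. *)
HB.mixin Record isBorelSpace (R : realType) (d : measure_display) T
    of Measurable d T & Topological T := {
  measurable_openE : @measurable d T = <<s @open T >> ;
  borel_embedding : exists (P : completePseudoMetricType R) (j : T -> P),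
    [/\ hausdorff_space P, separable P, injective j,
        (forall U : set T, open U <-> exists2 V : set P, open V & U = j @^-1` V)
      & <<s @open P >> (range j)] }.

#[short(type="borelSpaceType")]
HB.structure Definition BorelSpace (R : realType) (d : measure_display) :=
  {T of Measurable d T & Topological T & isBorelSpace R d T}.

(* Bounded continuous functions: the test functions of weak convergence. *)
Record bcfun (R : realType) (T : topologicalType) := BCFun {
  bcfun_fun :> T -> R ;
  bcfun_continuous : continuous bcfun_fun ;
  bcfun_bounded : bounded_fun bcfun_fun }.

HB.instance Definition _ R T := gen_eqMixin (bcfun R T).

Section weak_topology.
Context (R : realType) d (S : borelSpaceType R d).

Definition bc_integral (mu : probability S R) : {ptws bcfun R S -> R} :=
  fun phi => \int[mu]_x phi x.

(* The coarsest topology making mu |-> \int[mu]_x phi x continuous for every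
   bounded continuous phi. *)
Definition weak_prob := initial_topology bc_integral.

Definition borel_prob := g_sigma_algebraType (@open weak_prob).

Lemma bc_integral_continuous (phi : bcfun R S) :
  continuous (fun mu : weak_prob => \int[(mu : probability S R)]_x phi x).
Proof.
move=> mu.
apply: (@continuous_comp _ _ _ (bc_integral : weak_prob -> _)
  (fun g : {ptws bcfun R S -> R} => g phi)).
  exact: initial_continuous.
exact: (@proj_continuous (bcfun R S) (fun=> R) phi (bc_integral mu)).
Qed.

Lemma measurable_bc_integral (phi : bcfun R S) :
  measurable_fun [set: borel_prob]
    (fun mu : borel_prob => \int[(mu : probability S R)]_x phi x).
Proof.
apply: (measurability _ (measurable_realfun.RGenOInfty.measurableE R)).
move=> _ [_ [a ->] <-]; rewrite setTI.
apply: sub_sigma_algebra.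
by apply: open_comp; [move=> ? _; exact: bc_integral_continuous|exact: interval_open].
Qed.

Lemma measurable_fun_continuous_borel (f : S -> R) :
  continuous f -> measurable_fun [set: S] f.
Proof.
move=> cf; apply: (measurability _ (measurable_realfun.RGenOInfty.measurableE R)).
move=> _ [_ [a ->] <-]; rewrite setTI measurable_openE.
apply: sub_sigma_algebra.
by apply: open_comp; [move=> ? _; exact: cf|exact: interval_open].
Qed.

Lemma borel_closed_indic (C : set S) : closed C -> exists h : S -> R,
  [/\ continuous h, (forall x, 0 <= h x <= 1) & forall x, (h x == 1) = (x \in C)].
Proof.
move=> cC.
have [P [j [_ _ _ jopen _]]] := @borel_embedding R d S.
have [V oV CV] := (jopen (~` C)).1 (closed_openC cC).
pose h (z : P) : \bar R := edist_inf (~` V) z.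
pose f (z : P) : R := fine (mine (h z) 1%E).
have fE z : (f z)%:E = mine (h z) 1%E.
  rewrite /f fineK// ge0_fin_numE ?le_min ?edist_inf_ge0 ?lee01//.
  by rewrite gt_min ltry orbT.
have f_le y z e : 0 < e -> ball y e z -> f y <= e + f z.
  move=> e0 yez; rewrite -lee_fin EFinD !fE.
  have := edist_inf_triangle (~` V) y z.
  rewrite -/(h y) -/(h z) => hyz.
  have [hz1|hz1] := leP (h z) 1%E.
    rewrite ge_min; apply/orP; left; apply: (le_trans hyz).
    by rewrite leeD2r//; exact: edist_fin.
  rewrite ge_min; apply/orP; right.
  by rewrite -EFinD lee_fin lerDr ltW.
have fc : continuous f.
  move=> z; apply/cvgrPdist_le => e e0.
  near=> y.
  have zy : ball z e y by near: y; exact: nbhsx_ballx.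
  rewrite ler_norml; apply/andP; split.
    by rewrite lerBrDl lerBlDr addrC; apply: f_le => //; exact: ball_sym.
  by rewrite lerBlDr; exact: f_le.
have f0 z : (0 <= f z <= 1).
  rewrite -!lee_fin !fE le_min edist_inf_ge0 lee01/=.
  by rewrite ge_min lexx orbT.
have cj : continuous j.
  by apply/continuousP => U oU; apply/jopen; exists U.
exists (fun x => 1 - f (j x)); split.
- move=> x; apply: cvgB; first exact: cvg_cst.
  by apply: continuous_comp; [exact: cj|exact: fc].
- move=> x; have /andP[f0x f1x] := f0 (j x).
  by rewrite subr_ge0 f1x/= gerBl.
- move=> x; rewrite -subr_eq0 addrAC subrr sub0r oppr_eq0.
  have -> : (x \in C) = (j x \in ~` V).
    rewrite -[C]setCK CV; apply/idP/idP; rewrite !inE //.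
  apply/eqP/idP => [fx0|]; last first.
    rewrite inE => Vx; apply: EFin_inj; rewrite fE /h edist_inf0//.
    by rewrite min_l// lee01.
  rewrite inE /= => Vx.
  have /nbhs_ballP[e /= e0 eV] : nbhs (j x) V by exact: open_nbhs_nbhs.
  have : (h (j x) < (Num.min e 1)%:E)%E.
    have := fE (j x); rewrite fx0 => /esym/eqP.
    rewrite minElt; case: ifPn => [_ /eqP->|_]; last by rewrite onee_eq0.
    by rewrite lte_fin lt_min e0 ltr01.
  move=> /ereal_inf_lt[_ [z Vz <-]] /edist_lt_ball/= zb.
  apply: Vz; apply: eV; apply: le_ball zb.
  by rewrite ge_min lexx.
Unshelve. all: by end_near. Qed.

Definition prob_ev (U : set S) (mu : borel_prob) : \bar R :=
  (mu : probability S R) U.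

Lemma measurable_borel_prob_closed (C : set S) : closed C ->
  measurable_fun [set: borel_prob] (prob_ev C).
Proof.
move=> cC; have [h [hc h01 hC]] := borel_closed_indic cC.
have mC : measurable C.
  rewrite -[C]setCK; apply: measurableC; rewrite measurable_openE.
  by apply: sub_sigma_algebra; exact: closed_openC.
have hnc n : continuous (fun x => h x ^+ n).
  by move=> x; apply: (@continuous_comp _ _ _ h (fun y : R => y ^+ n));
    [exact: hc|exact: exprn_continuous].
have hn01 n x : 0 <= h x ^+ n <= 1.
  by have /andP[? ?] := h01 x; rewrite exprn_ge0//= exprn_ile1.
have hnb n : bounded_fun (fun x => h x ^+ n).
  exists 1; split => // M M1 x _ /=; have /andP[h0 h1] := hn01 n x.
  by rewrite ger0_norm// (le_trans h1)// ltW.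
pose phi n := BCFun (hnc n) (hnb n).
apply: (emeasurable_fun_cvg
  (fun n (mu : borel_prob) => (\int[(mu : probability S R)]_x phi n x)%:E)).
  by move=> n; apply/measurable_EFinP; exact: measurable_bc_integral.
move=> mu _; set P := (mu : probability S R).
have mphi n : measurable_fun [set: S] (EFin \o phi n).
  by apply/measurable_EFinP/measurable_fun_continuous_borel/hnc.
have iphi n : P.-integrable [set: S] (EFin \o phi n).
  apply: (@le_integrable _ _ _ P _ measurableT _ (EFin \o cst 1)) => //.
    by move=> x _ /=; have /andP[? ?] := hn01 n x; rewrite lee_fin !ger0_norm.
  by apply: finite_measure_integrable_cst.
have phiE n : (\int[P]_x phi n x)%:E = (\int[P]_x (phi n x)%:E)%E.
  by rewrite /Rintegral fineK//; apply: (integrable_fin_num _ (iphi n)).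
under eq_fun do rewrite phiE.
have -> : prob_ev C mu = (\int[P]_x (\1_C x)%:E)%E by rewrite integral_indic// setIT.
apply: (@dominated_cvg _ _ _ P _ measurableT _ _ (EFin \o cst 1)) => //.
- move=> x _; apply: cvg_EFin; first exact: nearW.
  rewrite indicE -hC /comp /=; have /andP[h0 h1] := h01 x.
  have [hx1|hx1] := eqVneq (h x) 1.
    by rewrite hx1; under eq_fun do rewrite expr1n; exact: cvg_cst.
  by apply: cvg_expr; rewrite ger0_norm// lt_neqAle hx1.
- exact: finite_measure_integrable_cst.
- by move=> n x _ /=; have /andP[? ?] := hn01 n x; rewrite lee_fin ger0_norm.
Qed.

(* Evaluations are Borel for the weak topology, so that a decision rule is a
   probability kernel. *)
Lemma measurable_borel_prob_ev (U : set S) : measurable U ->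
  measurable_fun [set: borel_prob] (prob_ev U).
Proof.
pose D := [set U | measurable U /\ measurable_fun [set: borel_prob] (prob_ev U)].
suff : measurable `<=` D by move=> + mU => /(_ _ mU)[].
have -> : @measurable d S = <<s [set C : set S | closed C] >>.
  rewrite measurable_openE; apply/seteqP; split; apply: smallest_sub;
    do ?exact: smallest_sigma_algebra.
  - move=> V oV; rewrite -[V]setCK -setTD.
    apply: (sigma_algebraCD (G := _)).
    by apply: sub_sigma_algebra; exact: open_closedC.
  - move=> V cV; rewrite -[V]setCK -setTD.
    apply: (sigma_algebraCD (G := _)).
    by apply: sub_sigma_algebra; exact: closed_openC.
have mcl (C : set S) : closed C -> measurable C.
  move=> cC; rewrite -[C]setCK; apply: measurableC; rewrite measurable_openE.
  by apply: sub_sigma_algebra; exact: closed_openC.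
apply: lambda_system_subset => //.
- by move=> A B cA cB; exact: closedI.
- split => //.
  + split => //; rewrite (_ : prob_ev _ = cst 1%E); last first.
      by apply/funext => mu; rewrite /prob_ev probability_setT.
    exact: measurable_cst.
  + move=> B A AB [mB mfB] [mA mfA]; split; first exact: measurableD.
    rewrite (_ : prob_ev _ = (fun mu => (prob_ev B mu - prob_ev A mu)%E)).
      exact: emeasurable_funB.
    apply/funext => mu; rewrite /prob_ev measureD//; first by rewrite setIidr.
    by rewrite ltey_eq fin_num_measure.
  + move=> F ndF FD; split; first by apply: bigcupT_measurable => n; case: (FD n).
    apply: (emeasurable_fun_cvg
      (fun n => prob_ev (F n))).
      by move=> n; case: (FD n).
    move=> mu _; apply: (nondecreasing_cvg_mu (mu := (mu : probability S R))) => //.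
      by move=> n; case: (FD n).
    by apply: bigcupT_measurable => n; case: (FD n).
- by move=> C cC; split; [exact: mcl|exact: measurable_borel_prob_closed].
Qed.

End weak_topology.

Section decision_rules.
Context (R : realType) dE dS (E : borelSpaceType R dE) (S : borelSpaceType R dS).

Definition actions (D : set (E * S)) (x : E) : set S := [set a | D (x, a)].

Definition prob_on (K : set S) : set (probability S R) :=
  [set mu | mu K = 1%E].

Definition upper_semicontinuous (K : E -> set S) :=
  forall C : set S, closed C -> closed [set x | K x `&` C !=set0].

Definition lower_semicontinuous (K : E -> set S) :=
  forall O : set S, open O -> open [set x | K x `&` O !=set0].

Definition continuous_correspondence (K : E -> set S) :=
  upper_semicontinuous K /\ lower_semicontinuous K.

Record decision_rule (D : set (E * S)) := DecisionRule {
  rule :> E -> probability S R ;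
  rule_measurable : measurable_fun [set: E] (rule : E -> borel_prob S) ;
  rule_admissible : forall x, prob_on (actions D x) (rule x) }.

Definition policy (D : set (E * S)) := nat -> decision_rule D.

Section rule_kernel.
Variables (D : set (E * S)) (f : decision_rule D).

Definition rule_kernel (x : E) : {measure set S -> \bar R} := f x.

Let measurable_rule_kernel U : measurable U ->
  measurable_fun [set: E] (rule_kernel ^~ U).
Proof.
move=> mU; rewrite (_ : rule_kernel ^~ U = prob_ev U \o (f : E -> borel_prob S))//.
apply: measurableT_comp; last exact: rule_measurable.
exact: measurable_borel_prob_ev.
Qed.

HB.instance Definition _ :=
  isKernel.Build _ _ _ _ _ rule_kernel measurable_rule_kernel.

Let rule_kernelT x : rule_kernel x [set: S] = 1%E.
Proof. exact: probability_setT. Qed.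

HB.instance Definition _ :=
  Kernel_isProbability.Build _ _ _ _ _ rule_kernel rule_kernelT.

End rule_kernel.

End decision_rules.

Section joint_actions.
Context (R : realType) dE dA dB (E : borelSpaceType R dE)
  (A : borelSpaceType R dA) (B : borelSpaceType R dB).
Variables (DA : set (E * A)) (DB : set (E * B)).
Variables (f : decision_rule DA) (g : decision_rule DB).

Definition joint_actions (x : E) : {measure set (A * B) -> \bar R} :=
  (f x \x g x)%E.

Let g1 (xa : E * A) : {measure set B -> \bar R} := rule_kernel g xa.1.

Let measurable_g1 U : measurable U -> measurable_fun [set: E * A] (g1 ^~ U).
Proof.
move=> mU; rewrite (_ : g1 ^~ U = (rule_kernel g ^~ U) \o fst)//.
by apply: measurableT_comp => //; exact: measurable_kernel.
Qed.

HB.instance Definition _ := isKernel.Build _ _ _ _ _ g1 measurable_g1.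

Let g1T xa : g1 xa [set: B] = 1%E.
Proof. exact: probability_setT. Qed.

HB.instance Definition _ := Kernel_isProbability.Build _ _ _ _ _ g1 g1T.

Let measurable_joint_actions U : measurable U ->
  measurable_fun [set: E] (joint_actions ^~ U).
Proof.
move=> mU; rewrite (_ : joint_actions ^~ U = kproduct (rule_kernel f) g1 ^~ U).
  exact: measurable_kproduct.
apply/funext => x; rewrite /kproduct /joint_actions/= /product_measure1.
by apply: eq_integral => a _; rewrite kernel.intker_indicE.
Qed.

HB.instance Definition _ :=
  isKernel.Build _ _ _ _ _ joint_actions measurable_joint_actions.

Let joint_actionsT x : joint_actions x [set: A * B] = 1%E.
Proof. exact: probability_setT. Qed.

HB.instance Definition _ :=
  Kernel_isProbability.Build _ _ _ _ _ joint_actions joint_actionsT.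

End joint_actions.

Record game (R : realType) dE dA dB (E : borelSpaceType R dE)
    (A : borelSpaceType R dA) (B : borelSpaceType R dB) := Game {
  DA : set (E * A) ;
  DB : set (E * B) ;
  measurable_DA : measurable DA ;
  measurable_DB : measurable DB ;
  graph_DA : exists2 h : E -> A, measurable_fun setT h & forall x, DA (x, h x) ;
  graph_DB : exists2 h : E -> B, measurable_fun setT h & forall x, DB (x, h x) ;
  transition : R.-pker (E * (A * B))%type ~> E ;
  reward : E * (A * B) -> R ;
  reward_sup : R ;
  measurable_reward : measurable_fun setT reward ;
  reward_bounds : forall z, 0 <= reward z <= reward_sup }.

Section law.
Context (R : realType) dE dA dB (E : borelSpaceType R dE)
  (A : borelSpaceType R dA) (B : borelSpaceType R dB) (G : game E A B).

Notation stage := (E * (A * B))%type.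
Notation path n := (n.-tuple stage * E)%type.

Section stage_step.
Variables (f : decision_rule (DA G)) (g : decision_rule (DB G)).

(* The law of ((A_n, B_n), X_(n+1)) given X_n = x. *)
Definition stage_law (x : E) : {measure set ((A * B) * E) -> \bar R} :=
  mkproduct (joint_actions f g) (transition G) x.

HB.instance Definition _ := Kernel.copy stage_law
  (mkproduct (joint_actions f g) (transition G)).

Let stage_lawT x : stage_law x [set: (A * B) * E] = 1%E.
Proof.
rewrite /stage_law/= /kproduct.
under eq_integral => ab _.
  rewrite kernel.intker_indicE// xsectionE preimage_setT prob_kernel; over.
by rewrite integral_cst// mul1e prob_kernel.
Qed.

HB.instance Definition _ :=
  Kernel_isProbability.Build _ _ _ _ _ stage_law stage_lawT.

Variable n : nat.

Definition extend_path (p : path n) (w : (A * B) * E) : path n.+1 :=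
  ([tuple of rcons p.1 (p.2, w.1)], w.2).

Lemma measurable_extend_path :
  measurable_fun [set: path n * ((A * B) * E)]
    (fun pw => extend_path pw.1 pw.2).
Proof.
apply/measurable_fun_pairP; split; last first.
  exact: (measurableT_comp measurable_snd measurable_snd).
apply/measurable_fun_tnthP => i.
have [i_n|n_i] := ltnP i n.
  rewrite (_ : _ \o _ = (fun t => tnth t (Ordinal i_n)) \o fst \o fst).
    apply: (measurableT_comp (measurable_tnth _)).
    exact: (measurableT_comp measurable_fst measurable_fst).
  apply/funext => -[[h y] w] /=.
  by rewrite !(tnth_nth (y, w.1))/= nth_rcons size_tuple i_n.
rewrite (_ : _ \o _ = fun pw : path n * ((A * B) * E) => (pw.1.2, pw.2.1)).
  apply/measurable_fun_pairP; split.
    exact: (measurableT_comp measurable_snd measurable_fst).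
  exact: (measurableT_comp measurable_fst measurable_snd).
apply/funext => -[[h y] w] /=.
have -> : i = ord_max by apply/val_inj/eqP; rewrite eqn_leq -ltnS ltn_ord n_i.
by rewrite (tnth_nth (y, w.1))/= nth_rcons size_tuple ltnn eqxx.
Qed.

Definition step_law (p : path n) : set (path n.+1) -> \bar R :=
  pushforward (stage_law p.2) (extend_path p).

Let mextend p : measurable_fun [set: (A * B) * E] (extend_path p).
Proof. exact: measurableT_comp measurable_extend_path (measurable_pair1 p). Qed.

Let step_law0 p : step_law p set0 = 0%E.
Proof. exact: measure0. Qed.

Let step_law_ge0 p U : (0 <= step_law p U)%E.
Proof. exact: measure_ge0. Qed.

Let step_law_sigma_additive p : semi_sigma_additive (step_law p).
Proof. exact: measure_semi_sigma_additive. Qed.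

HB.instance Definition _ p := isMeasure.Build _ _ _ (step_law p)
  (step_law0 p) (step_law_ge0 p) (@step_law_sigma_additive p).

Definition step (p : path n) : {measure set (path n.+1) -> \bar R} :=
  step_law p.

Let measurable_step U : measurable U ->
  measurable_fun [set: path n] (step ^~ U).
Proof.
move=> mU.
pose V := (fun pw : path n * ((A * B) * E) => extend_path pw.1 pw.2) @^-1` U.
have mV : measurable V.
  by rewrite /V -[X in measurable X]setTI; exact: measurable_extend_path.
rewrite (_ : step ^~ U = fun p =>
    @kernel.kernel_snd _ _ _ (n.-tuple stage) E _ R stage_law p (xsection V p)).
  by apply: measurable_fun_xsection_finite_kernel; rewrite inE.
by apply/funext => p; rewrite xsectionE.
Qed.

HB.instance Definition _ := isKernel.Build _ _ _ _ _ step measurable_step.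

Let stepT p : step p [set: path n.+1] = 1%E.
Proof. by rewrite /step/= /step_law /pushforward preimage_setT prob_kernel. Qed.

HB.instance Definition _ := Kernel_isProbability.Build _ _ _ _ _ step stepT.

End stage_step.

Definition initial_path (x : E) : path 0 := ([tuple], x).

Lemma measurable_initial_path : measurable_fun [set: E] initial_path.
Proof. exact: measurable_pair1. Qed.

Section compose.
Context d0 d1 d2 (T0 : measurableType d0) (T1 : measurableType d1)
  (T2 : measurableType d2).
Variables (k1 : R.-pker T0 ~> T1) (k2 : R.-pker T1 ~> T2).

Definition compose : T0 -> {measure set T2 -> \bar R} := mkcomp_noparam k1 k2.

HB.instance Definition _ := Kernel.copy compose (mkcomp_noparam k1 k2).

Let composeT x : compose x [set: T2] = 1%E.
Proof.
rewrite /compose/= /kcomp_noparam.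
under eq_integral do rewrite prob_kernel.
by rewrite integral_cst// mul1e prob_kernel.
Qed.

HB.instance Definition _ :=
  Kernel_isProbability.Build _ _ _ _ _ compose composeT.

End compose.

(* The law of ((X_0, (A_0, B_0)), ..., (X_(n-1), (A_(n-1), B_(n-1)))), X_n
   started at x: the n-stage marginal of the Ionescu-Tulcea measure. *)
Fixpoint path_law (pi : policy (DA G)) (sigma : policy (DB G)) (n : nat) :
    R.-pker E ~> path n :=
  match n with
  | 0 => kdirac measurable_initial_path
  | n.+1 => compose (path_law pi sigma n) (@step (pi n) (sigma n) n)
  end.

End law.

Section tilted_kernel.
Context (R : realType) dE dA dB (E : borelSpaceType R dE)
  (A : borelSpaceType R dA) (B : borelSpaceType R dB) (G : game E A B).

Definition tilted (x : E) (gamma : R) (ab : A * B) :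
    {measure set E -> \bar R} :=
  mscale (NngNum (expR_ge0 (gamma * reward G (x, ab)))) (transition G (x, ab)).

Variables (x : E) (gamma : R) (mu : probability A R) (nu : probability B R).

Definition mixed_tilted (U : set E) : \bar R :=
  (\int[nu]_b \int[mu]_a tilted x gamma (a, b) U)%E.

Let measurable_tilted U : measurable U ->
  measurable_fun [set: A * B] (tilted x gamma ^~ U).
Proof.
move=> mU; apply: emeasurable_funM.
  apply/measurable_EFinP => /=; apply: measurableT_comp => //.
  apply: measurable_funM => //.
  by apply: measurableT_comp; [exact: measurable_reward|exact: measurable_pair1].
apply: (measurableT_comp (measurable_kernel (transition G) U mU)).
exact: measurable_pair1.
Qed.

Let mixed_tilted0 : mixed_tilted set0 = 0%E.
Proof.
rewrite /mixed_tilted; apply: integral0_eq => b _.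
by apply: integral0_eq => a _; rewrite measure0.
Qed.

Let mixed_tilted_ge0 U : (0 <= mixed_tilted U)%E.
Proof. by apply: integral_ge0 => b _; exact: integral_ge0. Qed.

Let mixed_tilted_sigma_additive : semi_sigma_additive mixed_tilted.
Proof.
move=> F mF tF mUF.
have mtilt n b : measurable_fun [set: A] (fun a => tilted x gamma (a, b) (F n)).
  by apply: (measurableT_comp (measurable_tilted (mF n))); exact: measurable_pair2.
have mint n :
    measurable_fun [set: B] (fun b => \int[mu]_a tilted x gamma (a, b) (F n))%E.
  by apply: (@measurable_fun_fubini_tonelli_G _ _ _ _ _ mu
    (tilted x gamma ^~ (F n))) => //; exact: measurable_tilted.
rewrite [X in _ --> X](_ : _ = (\sum_(n <oo) mixed_tilted (F n))%E).
  by apply: is_cvg_nneseries => n _ _; exact: mixed_tilted_ge0.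
rewrite /mixed_tilted -integral_nneseries//; last first.
  by move=> n b _; exact: integral_ge0.
apply: eq_integral => b _; rewrite -integral_nneseries//.
apply: eq_integral => a _.
by apply/esym/cvg_lim => //; exact: measure_semi_sigma_additive.
Qed.

HB.instance Definition _ := isMeasure.Build _ _ _ mixed_tilted
  mixed_tilted0 mixed_tilted_ge0 mixed_tilted_sigma_additive.

End tilted_kernel.

Section criterion.
Context (R : realType) dE dA dB (E : borelSpaceType R dE)
  (A : borelSpaceType R dA) (B : borelSpaceType R dB) (G : game E A B).
Variable beta : R.

Definition policy_value (n : nat) (pi : policy (DA G)) (sigma : policy (DB G))
    (x : E) (gamma : R) : \bar R :=
  (\int[path_law pi sigma n x]_p
    (expR (gamma * \sum_(k < n) beta ^+ k * reward G (tnth p.1 k)))%:E)%E.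

Definition upper_value (n : nat) (x : E) (gamma : R) : \bar R :=
  ereal_inf (range (fun sigma : policy (DB G) =>
    ereal_sup (range (fun pi : policy (DA G) =>
      policy_value n pi sigma x gamma)))).

Definition lower_value (n : nat) (x : E) (gamma : R) : \bar R :=
  ereal_sup (range (fun pi : policy (DA G) =>
    ereal_inf (range (fun sigma : policy (DB G) =>
      policy_value n pi sigma x gamma)))).

Definition game_value (n : nat) (x : E) (gamma : R) : \bar R :=
  if n is 0 then 1%E else upper_value n x gamma.

Definition Lop (v : E -> R -> \bar R) (x : E) (gamma : R)
    (mu : probability A R) (nu : probability B R) : \bar R :=
  (\int[mixed_tilted G x gamma mu nu]_y v y (beta * gamma)%R)%E.

Definition Top (v : E -> R -> \bar R) (x : E) (gamma : R) : \bar R :=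
  ereal_inf [set ereal_sup [set Lop v x gamma mu nu |
    mu in prob_on (actions (DA G) x)] | nu in prob_on (actions (DB G) x)].

Variable gbar : R.

Definition risk_domain : set (E * R) := [set z | 0 < z.2 <= gbar].

(* Extended-real valued v that are finite, bounded and continuous on
   risk_domain. *)
Definition bounded_continuous (v : E -> R -> \bar R) :=
  exists u : E * R -> R,
    [/\ {within risk_domain, continuous u},
        [bounded u z | z in risk_domain] &
        forall z, risk_domain z -> v z.1 z.2 = (u z)%:E].

Definition saddle_point (X Y : Type) (M : set X) (N : set Y)
    (h : X -> Y -> \bar R) (m : X) (n : Y) :=
  [/\ M m, N n & forall m' n', M m' -> N n' ->
    (h m' n <= h m n)%E /\ (h m n <= h m n')%E].

(* A selection on E * (0, gbar] only: the values of mu and nu outside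
   risk_domain are irrelevant. *)
Definition saddle_selection (v : E -> R -> \bar R)
    (mu : E * R -> probability A R) (nu : E * R -> probability B R) :=
  [/\ measurable_fun risk_domain (mu : E * R -> borel_prob A),
      measurable_fun risk_domain (nu : E * R -> borel_prob B) &
      forall z, risk_domain z ->
        saddle_point (prob_on (actions (DA G) z.1))
          (prob_on (actions (DB G) z.1)) (Lop v z.1 z.2) (mu z) (nu z)].

Definition has_value (N : nat) := forall z, risk_domain z ->
  upper_value N z.1 z.2 = lower_value N z.1 z.2.

Definition optimal1 (N : nat) (gamma : R) (pi : policy (DA G)) :=
  forall (sigma : policy (DB G)) x,
    (lower_value N x gamma <= policy_value N pi sigma x gamma)%E.

Definition optimal2 (N : nat) (gamma : R) (sigma : policy (DB G)) :=
  forall (pi : policy (DA G)) x,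
    (policy_value N pi sigma x gamma <= upper_value N x gamma)%E.

End criterion.

(* f_n^*(x) = mu_(N - n)^*(x, gamma beta^n) for n < N; the decision rules after
   stage N - 1 are unconstrained, as policy_value N does not depend on them. *)
Definition reads_off (R : realType) dE dS (E : borelSpaceType R dE)
    (S : borelSpaceType R dS) (D : set (E * S)) (beta : R) (N : nat)
    (gamma : R) (mu : nat -> E * R -> probability S R) (pi : policy D) :=
  forall n, (n < N)%N -> forall x, pi n x = mu (N - n)%N (x, gamma * beta ^+ n).

(* Main.v *)
From HB Require Import structures.
Require Import Defs.
From mathcomp Require Import all_boot all_order all_algebra.
From mathcomp Require Import all_classical all_reals all_analysis.
From mathcomp Require Import measurable_realfun.
From mathcomp Require finmap.
From mathcomp Require Import ring lra.
Import Order.TTheory GRing.Theory Num.Theory.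
Import numFieldNormedType.Exports.
Local Open Scope classical_set_scope.
Local Open Scope ring_scope.
Set Implicit Arguments.
Unset Strict Implicit.
Unset Printing Implicit Defensive.

(* Dynamic programming reduces the game to one-stage games whose payoff
   e^(gamma r(x,a,b)) int v(y, beta gamma) Q(dy|x,a,b) is bounded and
   continuous. The value of such a game is first defined with finitely supported
   mixed actions: Blackwell's approachability theorem and compactness give the
   minimax theorem for them, and a Berge-type argument the continuity of the
   value in (x, gamma). Compactness of the probabilities on a compact set of
   actions (Riesz representation of an ultrafilter limit) then provides an
   optimal mixed action.

   Measurable selection is by lexicographic optimization along a countable
   family (g_j) of test functions generating the Borel sets of the weak
   topology: among the optimal mu keep those maximizing int g_0 dmu, among these
   those maximizing int g_1 dmu, and so on. Adding psi(a)/k to the payoff is again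
   a game with continuous value, whence, as k tends to infinity, the
   measurability in (x, gamma) of each of these successive maxima, and so of
   mu.

   The values u_n so obtained are compared with the n-stage payoffs by replacing
   one stage at a time: a pair of policies of which one uses optimal mixed
   actions makes E[exp(gamma sum_(k<m) beta^k r_k) u_(N-m)(X_m, gamma beta^m)]
   monotone in m. *)

(** The maximizing sets of the lexicographic procedure are never shown to be measurable; only the
    successive maxima are. They have to be treated for all test functions [psi] at once, since the
    next level is a limit of maxima for [psi + k g_j] minus k times the maximum for [g_j]. In the
    end each integral of [g_j] against the selected probability is determined, so that the selection
    itself is made by plain choice. Finite supports keep the Berge argument elementary: only
    finitely many atoms have to be moved into the action set of a neighbouring state. The risk
    parameter is part of the state because exp(gamma sum beta^k r_k) factors: after m stages the
    rest is the same kind of game with parameter gamma beta^m. Value functions are defined for every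
    real gamma; the interval (0, gbar], stable under multiplication by beta, only enters with the
    saddle selections of the statement. The optimality claim is about every measurable saddle
    selection, not only the constructed one. All saddle points of a stage have the same payoff,
    hence any selection guarantees the value. *)

Definition bcont (R : realType) (T : topologicalType) (f : T -> R) :=
  continuous f /\ exists M : R, forall x, `|f x| <= M.

(** * Integration of bounded functions against probabilities *)

Section prob_integral.
Context d (T : measurableType d) (R : realType).
Implicit Types (P : probability T R) (f g : T -> R).

Definition bmeas f := measurable_fun setT f /\ exists M : R, forall x, `|f x| <= M.

Lemma bmeas_integrable P f : bmeas f -> P.-integrable setT (EFin \o f).
Proof.
move=> [mf [M fM]]; apply: measurable_bounded_integrable => //.
  by rewrite [X in (X < _)%E](@probability_setT _ _ _ P) ltry.
exists M; split; rewrite ?num_real // => r Mr x _ /=.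
by rewrite (le_trans (fM x))// ltW.
Qed.

Lemma bmeas_cst (c : R) : bmeas (cst c).
Proof. by split; [exact: measurable_cst|exists `|c| => x]. Qed.

Lemma bmeasD f g : bmeas f -> bmeas g -> bmeas (fun x => f x + g x).
Proof.
move=> [mf [M fM]] [mg [M' gM']]; split; first exact: measurable_funD.
by exists (M + M') => x; rewrite (le_trans (ler_normD _ _))// lerD.
Qed.

Lemma bmeasZ (c : R) f : bmeas f -> bmeas (fun x => c * f x).
Proof.
move=> [mf [M fM]]; split; first exact: measurable_funM.
by exists (`|c| * M) => x; rewrite normrM ler_wpM2l.
Qed.

Lemma prob_intD P f g : bmeas f -> bmeas g ->
  \int[P]_x (f x + g x) = \int[P]_x f x + \int[P]_x g x.
Proof. by move=> bf bg; rewrite RintegralD//; exact: bmeas_integrable. Qed.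

Lemma prob_intZ P c f : bmeas f -> \int[P]_x (c * f x) = c * \int[P]_x f x.
Proof. by move=> bf; rewrite RintegralZl//; exact: bmeas_integrable. Qed.

Lemma prob_int_cst P c : \int[P]_x (cst c x) = c.
Proof. by rewrite Rintegral_cst// [X in fine X](@probability_setT _ _ _ P) mulr1. Qed.

Lemma prob_int_EFin P f : bmeas f ->
  (\int[P]_x f x)%:E = (\int[P]_x (f x)%:E)%E.
Proof.
move=> bf; rewrite /Rintegral fineK//.
exact: (integrable_fin_num _ (bmeas_integrable P bf)).
Qed.

(** The complement of [K] is null. Payoff bounds are available on admissible actions only, hence the
    carrier [K]. *)
Lemma prob_int_le_on P (K : set T) f g : measurable K -> P K = 1%E ->
  bmeas f -> bmeas g -> (forall x, K x -> f x <= g x) ->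
  \int[P]_x f x <= \int[P]_x g x.
Proof.
move=> mK PK bf bg fg.
have PK0 : P (~` K) = 0%E by rewrite probability_setC// PK subee.
have E h : bmeas h -> (\int[P]_x h x)%:E = (\int[P]_(x in K) (h x)%:E)%E.
  move=> bh; rewrite prob_int_EFin// -(setUv K).
  rewrite integral_setU_EFin//=; last 2 first.
  - by rewrite setUv; case: bh.
  - exact/disj_setPCl.
  rewrite [X in (_ + X)%E](_ : _ = 0%E) ?adde0//.
  apply: null_set_integral => //; first exact: measurableC.
  by apply/measurable_EFinP; apply: measurable_funS bh.1 => //; exact: measurableT.
  exact: measurableC.
rewrite -lee_fin !E//; apply: le_integral => //.
- by apply: integrableS (bmeas_integrable P bf).
- by apply: integrableS (bmeas_integrable P bg).
- by move=> x; rewrite inE => Kx; rewrite lee_fin fg.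
Qed.

Lemma prob_int_ge_on P (K : set T) c f : measurable K -> P K = 1%E ->
  bmeas f -> (forall x, K x -> c <= f x) -> c <= \int[P]_x f x.
Proof.
move=> mK PK bf cf; rewrite -[leLHS](prob_int_cst P).
by apply: (prob_int_le_on mK) => //; exact: bmeas_cst.
Qed.

Lemma prob_int_le_cst_on P (K : set T) c f : measurable K -> P K = 1%E ->
  bmeas f -> (forall x, K x -> f x <= c) -> \int[P]_x f x <= c.
Proof.
move=> mK PK bf cf; rewrite -[leRHS](prob_int_cst P).
by apply: (prob_int_le_on mK) => //; exact: bmeas_cst.
Qed.

Lemma prob_int_norm P f M : bmeas f -> (forall x, `|f x| <= M) ->
  `|\int[P]_x f x| <= M.
Proof.
move=> bf fM; rewrite ler_norml; apply/andP; split.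
  apply: (prob_int_ge_on measurableT) => //; first exact: probability_setT.
  by move=> x _; have := fM x; rewrite ler_norml => /andP[].
apply: (prob_int_le_cst_on measurableT) => //; first exact: probability_setT.
by move=> x _; have := fM x; rewrite ler_norml => /andP[].
Qed.

End prob_integral.

Section bcont.
Context (R : realType).

Lemma bcont_cst (T : topologicalType) (c : R) : bcont (cst c : T -> R).
Proof. by split; [move=> x; exact: cvg_cst|exists `|c| => x]. Qed.

Lemma bcontD (T : topologicalType) (f g : T -> R) :
  bcont f -> bcont g -> bcont (fun x => f x + g x).
Proof.
move=> [cf [M fM]] [cg [M' gM']]; split; first by move=> x; apply: cvgD; [exact: cf|exact: cg].
by exists (M + M') => x; rewrite (le_trans (ler_normD _ _))// lerD.
Qed.

Lemma bcontZ (T : topologicalType) (c : R) (f : T -> R) :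
  bcont f -> bcont (fun x => c * f x).
Proof.
move=> [cf [M fM]]; split; first by move=> x; apply: cvgM; [exact: cvg_cst|exact: cf].
by exists (`|c| * M) => x; rewrite normrM ler_wpM2l.
Qed.

Lemma bcontN (T : topologicalType) (f : T -> R) :
  bcont f -> bcont (fun x => - f x).
Proof.
move=> /(bcontZ (-1)); rewrite (_ : (fun x => -1 * f x) = (fun x => - f x))//.
by apply/funext => x; rewrite mulN1r.
Qed.

Lemma bcontB (T : topologicalType) (f g : T -> R) :
  bcont f -> bcont g -> bcont (fun x => f x - g x).
Proof. by move=> bf bg; apply: bcontD => //; exact: bcontN. Qed.

Lemma bcont_sum (T : topologicalType) (f : nat -> T -> R) n :
  (forall i, bcont (f i)) -> bcont (fun x => \sum_(i < n) f i x).
Proof.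
move=> bf; elim: n => [|n ih].
  by under eq_fun do rewrite big_ord0; exact: bcont_cst.
by under eq_fun do rewrite big_ord_recr /=; exact: bcontD.
Qed.

Lemma bcont_max (T : topologicalType) (f g : T -> R) :
  bcont f -> bcont g -> bcont (fun x => Num.max (f x) (g x)).
Proof.
move=> [cf [M fM]] [cg [M' gM']]; split.
  by move=> x; apply: (@continuous_max _ _ f g x); [exact: cf|exact: cg].
exists (Num.max M M') => x; rewrite le_max.
by have [_|_] := leP (f x) (g x); rewrite ?fM ?gM' ?orbT.
Qed.

Lemma bcont_min (T : topologicalType) (f g : T -> R) :
  bcont f -> bcont g -> bcont (fun x => Num.min (f x) (g x)).
Proof.
move=> bf bg; have := bcontN (bcont_max (bcontN bf) (bcontN bg)).
congr bcont; apply/funext => x.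
by rewrite -oppr_min opprK.
Qed.

Lemma bcont_unit (T : topologicalType) (f : T -> R) : continuous f ->
  (forall x, 0 <= f x <= 1) -> bcont f.
Proof.
by move=> cf f01; split => //; exists 1 => x; have /andP[? ?] := f01 x; rewrite ger0_norm.
Qed.

Lemma bcont_bmeas d (S : borelSpaceType R d) (f : S -> R) : bcont f -> bmeas f.
Proof. by move=> [cf bf]; split => //; exact: measurable_fun_continuous_borel. Qed.

Definition bcfun_of (T : topologicalType) (f : T -> R) (bf : bcont f) : bcfun R T.
Proof.
exists f; first by case: bf.
case: bf => _ [M fM]; exists M; split; rewrite ?num_real // => r Mr x _ /=.
by rewrite (le_trans (fM x))// ltW.
Defined.

Lemma bcfun_bcont (T : topologicalType) (f : bcfun R T) : bcont f.
Proof.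
case: f => f cf bf; split => //=; case: bf => M [_ Mf]; exists (M + 1) => x.
by apply: Mf => //; rewrite ltrDl.
Qed.

End bcont.

(** The form [h x < 1 <-> U x] is chosen because [1 - h x ^+ m] then increases to the indicator of
    [U] as [m] grows: open sets are approximated from below by continuous functions. *)
Lemma borel_open_indic (R : realType) d (S : borelSpaceType R d) (U : set S) : open U -> exists h : S -> R,
  [/\ continuous h, (forall x, 0 <= h x <= 1) & forall x, h x < 1 <-> U x].
Proof.
move=> oU; have [h [ch h01 hU]] := borel_closed_indic (open_closedC oU).
exists h; split => // x; have /andP[_ h1] := h01 x.
rewrite lt_neqAle h1 andbT hU; split.
  by move=> /negP xU; apply: contrapT => Ux; apply: xU; rewrite inE.
by move=> Ux; apply/negP; rewrite inE; exact.
Qed.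

(** * Riesz representation of functionals dominated by the supremum over a compact set *)

Section riesz.
Context (R : realType) d (S : borelSpaceType R d).
Variables (K : set S) (L : (S -> R) -> R).
Hypothesis cK : compact K.
Hypothesis LD : forall f g, bcont f -> bcont g ->
  L (fun x => f x + g x) = L f + L g.
Hypothesis LZ : forall c f, bcont f -> L (fun x => c * f x) = c * L f.
Hypothesis L_le : forall c f, bcont f -> (forall x, K x -> f x <= c) -> L f <= c.

(** [L_le] is the only order hypothesis. On a constant and its opposite it gives the normalization,
    on [f - g] the monotonicity, and since it sees only [K] the measure will be carried by [K]. *)
Let L_cst c : L (cst c) = c.
Proof.
apply/eqP; rewrite eq_le L_le//=; last exact: bcont_cst.
rewrite -lerN2 -[leLHS]mulN1r -LZ; last exact: bcont_cst.
apply: L_le => [|x _]; last by rewrite mulN1r.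
by apply: bcontZ; exact: bcont_cst.
Qed.

Let LB f g : bcont f -> bcont g -> L (fun x => f x - g x) = L f - L g.
Proof.
move=> bf bg; rewrite LD//; last exact: bcontN.
congr (_ + _); rewrite -[RHS]mulN1r -LZ//; congr L.
by apply/funext => x; rewrite mulN1r.
Qed.

Let L_mono f g : bcont f -> bcont g -> (forall x, K x -> f x <= g x) -> L f <= L g.
Proof.
move=> bf bg fg; rewrite -subr_le0 -LB//; apply: L_le; first exact: bcontB.
by move=> x Kx; rewrite subr_le0 fg.
Qed.

Let L_sum (f : nat -> S -> R) n : (forall i, bcont (f i)) ->
  L (fun x => \sum_(i < n) f i x) = \sum_(i < n) L (f i).
Proof.
move=> bf; elim: n => [|n ih].
  by rewrite big_ord0 -[RHS](L_cst 0); congr L; apply/funext => x; rewrite big_ord0.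
rewrite big_ord_recr/= -ih -LD//; last exact: bcont_sum.
by congr L; apply/funext => x; rewrite big_ord_recr.
Qed.

Let test (U : set S) (f : S -> R) :=
  [/\ continuous f, (forall x, 0 <= f x <= 1) & forall x, ~ U x -> f x = 0].

Let test_bcont U f : test U f -> bcont f.
Proof. by case=> cf f01 _; exact: bcont_unit. Qed.

(* lam U is meant for open U only. *)
Let lam (U : set S) : \bar R := ereal_sup [set (L f)%:E | f in test U].

Let test0 U : test U (cst 0).
Proof. by split=> //; [move=> x; exact: cvg_cst|move=> x; rewrite lexx ler01]. Qed.

Let lam_ge0 U : (0 <= lam U)%E.
Proof.
by apply: ereal_sup_ubound; exists (cst 0); [exact: test0|rewrite L_cst].
Qed.

Let lam_le1 U : (lam U <= 1)%E.
Proof.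
apply: ge_ereal_sup => _ [f tf <-]; rewrite lee_fin; apply: L_le.
  exact: test_bcont tf.
by case: tf => _ f01 _ x _; have /andP[] := f01 x.
Qed.

Let le_lam U V : U `<=` V -> (lam U <= lam V)%E.
Proof.
move=> UV; apply: ereal_sup_le => _ [f [cf f01 fU] <-]; exists f => //.
by split => // x Vx; apply: fU => /UV.
Qed.

Let test_pow U (h : S -> R) m : continuous h -> (forall x, 0 <= h x <= 1) ->
  (forall x, h x < 1 <-> U x) -> test U (fun x => 1 - h x ^+ m).
Proof.
move=> ch h01 hU; split.
- move=> x; apply: cvgB; first exact: cvg_cst.
  apply: (@continuous_comp _ _ _ h (fun y : R => y ^+ m)); first exact: ch.
  exact: exprn_continuous.
- move=> x; have /andP[h0 h1] := h01 x.
  by rewrite subr_ge0 exprn_ile1//= gerBl exprn_ge0.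
- move=> x Ux; have /andP[h0 h1] := h01 x.
  suff -> : h x = 1 by rewrite expr1n subrr.
  by apply/eqP; rewrite eq_le h1 leNgt; apply/negP => /hU.
Qed.

(** Compactness of [K] replaces a partition of unity. Near a point of [K] either [f] is at most [e],
    or some [h n] stays away from 1 and [1 - h n ^+ M] exceeds [1 - e] for large [M]; so one [M]
    serves on all of [K], and [L] sees nothing else. *)
Let lam_bigcup (U : nat -> set S) : (forall n, open (U n)) ->
  (lam (\bigcup_n U n) <= \sum_(n <oo) lam (U n))%E.
Proof.
move=> oU; apply: ge_ereal_sup => _ [f [cf f01 fU] <-].
apply/lee_addgt0Pr => e e0.
have /choice[h hP] n := borel_open_indic (oU n).
pose g m n x := 1 - h n x ^+ m.
have tg m n : test (U n) (g m n).
  by case: (hP n) => ch h01 hU; exact: test_pow.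
have bg m n : bcont (g m n) by exact: test_bcont (tg m n).
have [M fM] : exists M, forall x, K x -> f x <= e + \sum_(n < M) g M n x.
  have /compact_near_coveringP cK' := cK.
  have [] : \forall M \near \oo, K `<=` (fun x => f x <= e + \sum_(n < M) g M n x).
    apply: cK' => x Kx; have g0 m n y : 0 <= g m n y by case: (tg m n) => _ /(_ y)/andP[].
    have [fe|fe] := ltP (f x) e.
      near=> y M; rewrite /= (@le_trans _ _ e)//.
        near: y; have : f y @[y --> x] --> f x by exact: cf.
        by move=> /cvgr_le; apply.
      by rewrite lerDl sumr_ge0.
    have [n _ Unx] : (\bigcup_n U n) x.
      apply: contrapT => /fU fx0; move: fe; rewrite fx0 leNgt e0//.
    have [ch h01 hU] := hP n.
    have /hU hx1 := Unx.
    (* With [t] strictly between [h n x] and 1, [h n <= t] near [x], so the powers decay uniformly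
       there. *)
    have [t /andP[hxt t1]] : exists t, h n x < t < 1.
      by exists ((h n x + 1) / 2); rewrite midf_lt//= midf_lt.
    have t0 : 0 <= t by rewrite (le_trans _ (ltW hxt))//; have /andP[] := h01 x.
    have tM : \forall M \near \oo, t ^+ M < e.
      have : t ^+ M @[M --> \oo] --> (0 : R) by apply: cvg_expr; rewrite ger0_norm.
      by move=> /cvgr_lt; apply.
    near=> y M => /=.
    have fy1 : f y <= 1 by have /andP[] := f01 y.
    have nM : (n < M)%N by near: M; exists n.+1.
    rewrite (le_trans fy1)// -lerBlDl (bigD1 (Ordinal nM))//=.
    rewrite -[leLHS]addr0 lerD ?sumr_ge0// /g lerD2l lerN2.
    rewrite (@le_trans _ _ (t ^+ M))//; last by apply: ltW; near: M.
    apply: lerXn2r; rewrite ?nnegrE//; first by have /andP[] := h01 y.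
    near: y; have : h n y @[y --> x] --> h n x by exact: ch.
    by move=> /cvgr_le; apply.
  by move=> M _ /(_ M (leqnn M)); exists M.
have : L f <= e + \sum_(n < M) L (g M n).
  rewrite -[in leRHS](L_cst e) -L_sum// -LD//; last 2 first.
    exact: bcont_cst.
    exact: bcont_sum.
  apply: L_mono => //; first exact: bcont_unit.
  by apply: bcontD; [exact: bcont_cst|exact: bcont_sum].
rewrite -lee_fin => /le_trans; apply.
rewrite EFinD addeC leeD2r// -sumEFin.
apply: (@le_trans _ _ (\sum_(n < M) lam (U n))%E).
  by apply: lee_sum => n _; apply: ereal_sup_ubound; exists (g M n).
rewrite -(big_mkord xpredT (fun n => lam (U n))).
exact: nneseries_lim_ge.
Unshelve. all: by end_near. Qed.

Definition riesz_outer (X : set S) : \bar R :=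
  ereal_inf [set lam U | U in [set U | open U /\ X `<=` U]].

Let riesz_outer_open U : open U -> riesz_outer U = lam U.
Proof.
move=> oU; apply/eqP; rewrite eq_le; apply/andP; split.
  by apply: ereal_inf_lbound; exists U => //; split.
by apply: le_ereal_inf_tmp => _ [V [_ UV] <-]; exact: le_lam.
Qed.

Let riesz_outer0 : riesz_outer set0 = 0%E.
Proof.
rewrite riesz_outer_open//; last exact: open0.
apply/eqP; rewrite eq_le lam_ge0 andbT; apply: ge_ereal_sup => _ [f [cf _ f0] <-].
rewrite lee_fin L_le//; last by move=> x _; rewrite f0.
by split=> //; exists 0 => x; rewrite f0// normr0.
Qed.

Let riesz_outer_ge0 X : (0 <= riesz_outer X)%E.
Proof. by apply: le_ereal_inf_tmp => _ [U _ <-]. Qed.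

Let le_riesz_outer : {homo riesz_outer : A B / A `<=` B >-> (A <= B)%E}.
Proof.
move=> A B AB; apply: ereal_inf_le_tmp => _ [U [oU BU] <-]; exists U => //.
by split => //; exact: subset_trans BU.
Qed.

Let riesz_outer_fin X : riesz_outer X \is a fin_num.
Proof.
rewrite ge0_fin_numE//; apply: (@le_lt_trans _ _ (lam setT)).
  by apply: ereal_inf_lbound; exists setT => //; split; [exact: openT|].
by rewrite (le_lt_trans (lam_le1 _))// ltry.
Qed.

Let riesz_outer_adherent X e : 0 < e -> exists U,
  [/\ open U, X `<=` U & (lam U <= riesz_outer X + e%:E)%E].
Proof.
move=> e0; have [_ [U [oU XU] <-] /ltW Ue] := lb_ereal_inf_adherent e0 (riesz_outer_fin X).
by exists U.
Qed.

Let riesz_outer_sigma_subadditive : sigma_subadditive riesz_outer.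
Proof.
move=> F; apply/lee_addgt0Pr => e e0.
apply: le_trans (epsilon_trick _ _ _) => //; last exact: ltW.
have /choice[U UP] n : exists U, [/\ open U, F n `<=` U &
    (lam U <= riesz_outer (F n) + (e / (2 ^ n.+1)%:R)%:E)%E].
  by apply: riesz_outer_adherent; rewrite divr_gt0// ltr0n expn_gt0.
have oU n : open (U n) by case: (UP n).
apply: (@le_trans _ _ (lam (\bigcup_n U n))).
  apply: ereal_inf_lbound; exists (\bigcup_n U n) => //; split.
    exact: bigcup_open.
  by apply: subset_bigcup => n _; case: (UP n).
apply: le_trans (lam_bigcup oU) _.
by apply: lee_nneseries => n _ //; case: (UP n).
Qed.

HB.instance Definition _ := isOuterMeasure.Build R S riesz_outer
  riesz_outer0 riesz_outer_ge0 le_riesz_outer riesz_outer_sigma_subadditive.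

(** A test function [f] for [V] inside [U] and a test function [g] for [V] away from [f >= e]
    combine, up to [e], into one test function for [V]. The set [V \ F] is open and contains the
    part of [V] outside [U]. *)
Let open_riesz_caratheodory U : open U -> riesz_outer.-caratheodory U.
Proof.
move=> oU; apply: le_caratheodory_measurable => X /=.
apply: le_ereal_inf_tmp => _ [V [oV XV] <-].
apply: (@le_trans _ _ (lam (V `&` U) + riesz_outer (V `&` ~` U))%E).
  rewrite -riesz_outer_open; last exact: openI.
  by apply: leeD; apply: le_riesz_outer; exact: setSI.
rewrite -leeBrDr//.
apply: ge_ereal_sup => _ [f [cf f01 fU] <-].
rewrite leeBrDr//; apply/lee_addgt0Pr => e e0.
pose F := f @^-1` [set t | e <= t].
have cF : closed F by apply: closed_comp => [x _|]; [exact: cf|exact: closed_ge].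
have oVF : open (V `\` F) by rewrite setDE; apply: openI => //; exact: closed_openC.
apply: (@le_trans _ _ ((L f)%:E + lam (V `\` F))%E).
  rewrite leeD2l// -riesz_outer_open//; apply: le_riesz_outer.
  move=> x [Vx Ux]; split => //; rewrite /F/=; apply/negP; rewrite -ltNge.
  by rewrite fU// => -[].
rewrite -leeBrDl//; apply: ge_ereal_sup => _ [g [cg g01 gVF] <-].
rewrite leeBrDl// -EFinD.
have bf : bcont f by exact: bcont_unit.
have bg : bcont g by exact: bcont_unit.
(* Where [f] exceeds [e] the point is in [F] and [g] vanishes, so the two terms are never positive
   together and [k] stays below 1. *)
pose k x := Num.max (f x - e) 0 + g x.
have bk : bcont k.
  apply: bcontD => //; apply: bcont_max; last exact: bcont_cst.
  by apply: bcontB => //; exact: bcont_cst.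
have tk : test V k.
  split; first by case: bk.
  - move=> x; have /andP[f0 f1] := f01 x; have /andP[g0 g1] := g01 x.
    rewrite /k; have [fe|fe] := leP (f x - e) 0; first by rewrite add0r g0.
    rewrite gVF; last by move=> [_]; apply; rewrite /F/= -subr_ge0 ltW.
    by rewrite addr0 ltW//= lerBlDr (le_trans f1)// lerDl ltW.
  - move=> x Vx; rewrite /k fU; last by case.
    rewrite gVF; last by case.
    by rewrite sub0r max_r ?addr0// oppr_le0 ltW.
have : L f + L g <= L k + e.
  rewrite -LD// -[in leRHS](L_cst e) -LD//; last exact: bcont_cst.
  apply: L_mono; first exact: bcontD.
    by apply: bcontD => //; exact: bcont_cst.
  move=> x _; rewrite /k /= addrAC lerD2r.
  by rewrite -lerBlDr le_max lexx.
rewrite -lee_fin => /le_trans; apply; rewrite EFinD leeD2r//.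
by apply: ereal_sup_ubound; exists k.
Qed.

Let measurable_riesz_caratheodory (U : set S) :
  measurable U -> riesz_outer.-caratheodory U.
Proof.
have -> : @measurable d S = <<s @open S >> by exact: measurable_openE.
move: U; apply: smallest_sub.
  split.
  - exact: caratheodory_measurable_set0.
  - move=> X mX; rewrite setTD; exact: caratheodory_measurable_setC.
  - exact: caratheodory_measurable_bigcup.
by move=> U; exact: open_riesz_caratheodory.
Qed.

Definition riesz_measure : set S -> \bar R := riesz_outer.

Let riesz_measure_sigma_additive : semi_sigma_additive riesz_measure.
Proof.
move=> F mF tF mUF.
by apply: (@caratheodory_measure_sigma_additive R S riesz_outer) => // [n|];
  exact: measurable_riesz_caratheodory.
Qed.

HB.instance Definition _ := isMeasure.Build _ _ _ riesz_measure
  riesz_outer0 riesz_outer_ge0 riesz_measure_sigma_additive.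

Let riesz_measureT : riesz_measure setT = 1%E.
Proof.
rewrite /riesz_measure riesz_outer_open//; last exact: openT.
apply/eqP; rewrite eq_le lam_le1/=; apply: ereal_sup_ubound.
exists (cst 1); last by rewrite L_cst.
by split=> //; [move=> x; exact: cvg_cst|move=> x; rewrite lexx ler01|move=> x []].
Qed.

HB.instance Definition _ := Measure_isProbability.Build _ _ _ riesz_measure
  riesz_measureT.

Let closed_measurable (C : set S) : closed C -> measurable C.
Proof.
move=> cC; rewrite -[C]setCK; apply: measurableC; rewrite measurable_openE.
by apply: sub_sigma_algebra; exact: closed_openC.
Qed.

Let riesz_measure_on : closed K -> riesz_measure K = 1%E.
Proof.
move=> clK.
have mK := closed_measurable clK.
suff: riesz_measure (~` K) = 0%E.
  move=> muK; rewrite -[K in LHS]setCK.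
  transitivity (1 - riesz_measure (~` K))%E.
    exact: (probability_setC riesz_measure (measurableC mK)).
  by rewrite muK sube0.
rewrite /riesz_measure riesz_outer_open; last exact: closed_openC.
apply/eqP; rewrite eq_le lam_ge0 andbT; apply: ge_ereal_sup => _ [f [cf f01 fK] <-].
rewrite lee_fin; apply: L_le; first exact: bcont_unit.
by move=> x Kx; rewrite fK//; exact.
Qed.

(* Layer cake: n f is the sum of the n slices of f of height 1/n, and the
   i-th slice is a test function for {f > i/n}. *)
Let riesz_unit_le (f : S -> R) : continuous f -> (forall x, 0 <= f x <= 1) ->
  L f <= \int[riesz_measure]_x f x.
Proof.
move=> cf f01; apply/ler_addgt0Pr => e e0.
have [n ne] : exists n : nat, n.+1%:R^-1 < e.
  have [n _ /(_ n (leqnn n)) ne] := near_infty_natSinv_lt (PosNum e0).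
  by exists n.
pose N : R := n.+1%:R.
have N0 : 0 < N by rewrite ltr0n.
have bf : bcont f by exact: bcont_unit.
pose s (i : nat) x := Num.max 0 (Num.min 1 (N * f x - i%:R)).
pose O (i : nat) := [set x | i%:R < N * f x].
have oO i : open (O i).
  rewrite /O (_ : mkset _ = (fun x => N * f x) @^-1` [set t | i%:R < t])//.
  apply: open_comp => [x _|]; last exact: open_gt.
  by apply: cvgM; [exact: cvg_cst|exact: cf].
have mO i : measurable (O i).
  by rewrite measurable_openE; apply: sub_sigma_algebra; exact: oO.
have bs i : bcont (s i).
  apply: bcont_max; first exact: bcont_cst.
  apply: bcont_min; first exact: bcont_cst.
  by apply: bcontB; [exact: bcontZ|exact: bcont_cst].
have ts i : test (O i) (s i).
  split; first by case: (bs i).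
  - by move=> x; rewrite /s le_max lexx/= ge_max ler01/= ge_min lexx.
  - move=> x /negP; rewrite -leNgt -subr_le0 => fx.
    by rewrite /s max_l// ge_min fx orbT.
have sE m x : \sum_(i < m) s i x = Num.min m%:R (N * f x).
  have Nf0 : 0 <= N * f x by apply: mulr_ge0; [exact: ltW|have /andP[] := f01 x].
  elim: m => [|m ih]; first by rewrite big_ord0 min_l.
  rewrite big_ord_recr/= ih /s -natr1.
  have [h1|h1] := leP m%:R (N * f x); last first.
    rewrite max_l ?addr0 ?min_r//; first by rewrite (le_trans (ltW h1))// lerDl.
      by rewrite subr_le0 ltW.
    by rewrite lerBlDl (le_trans (ltW h1))// lerDl.
  have [h2|h2] := leP 1 (N * f x - m%:R).
    by rewrite max_r// min_l// addrC -lerBrDr.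
  by rewrite max_r ?subr_ge0// addrC subrK min_r// -lerBlDl ltW.
have indicO i : bmeas (\1_(O i) : S -> R).
  split; first exact: measurable_indic.
  by exists 1 => x; rewrite indicE; case: (_ \in _); rewrite ?normr1 ?normr0.
have NLf : N * L f <= \sum_(i < n.+1) \int[riesz_measure]_x \1_(O i) x.
  rewrite -LZ// (_ : (fun x => N * f x) = fun x => \sum_(i < n.+1) s i x).
    rewrite L_sum//; apply: ler_sum => i _.
    rewrite -lee_fin prob_int_EFin// integral_indic// setIT.
    rewrite [leRHS]riesz_outer_open//; apply: ereal_sup_ubound.
    by exists (s i).
  apply/funext => x; rewrite sE min_r// ler_piMr ?(ltW N0)//.
  by have /andP[] := f01 x.
(* At most [N * f x + 1] indices [i] satisfy [i < N * f x]. After division by [N] the surplus 1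
   becomes the error [1 / N < e]. The minimum with [m] is what the induction on [m] carries. *)
have indic_sum m x : \sum_(i < m) (\1_(O i) x : R) <= N * f x + 1.
  have Nf0 : 0 <= N * f x by apply: mulr_ge0; [exact: ltW|have /andP[] := f01 x].
  suff : \sum_(i < m) (\1_(O i) x : R) <= Num.min m%:R (N * f x + 1).
    by move=> /le_trans; apply; rewrite ge_min lexx orbT.
  elim: m => [|m ih].
    by rewrite big_ord0 le_min lexx/= addr_ge0.
  rewrite big_ord_recr/= -natr1 indicE.
  have [xO|xO] := boolP (x \in O m).
    rewrite le_min; apply/andP; split.
      by rewrite lerD2r (le_trans ih)// ge_min lexx.
    rewrite lerD2r (le_trans ih)// ge_min.
    by move: xO; rewrite inE /O/= => /ltW ->.
  rewrite addr0 (le_trans ih)// le_min; apply/andP; split.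
    by rewrite ge_min lerDl ler01.
  by rewrite ge_min lexx orbT.
have int_sum m : \sum_(i < m) \int[riesz_measure]_x \1_(O i) x =
    \int[riesz_measure]_x (\sum_(i < m) \1_(O i) x) /\
    bmeas (fun x => \sum_(i < m) \1_(O i) x : R).
  elim: m => [|m [ih1 ih2]].
    split.
      rewrite big_ord0 -[LHS](prob_int_cst riesz_measure 0).
      by apply: eq_Rintegral => x _; rewrite big_ord0.
    by under eq_fun do rewrite big_ord0; exact: bmeas_cst.
  split; last by under eq_fun do rewrite big_ord_recr/=; exact: bmeasD.
  rewrite big_ord_recr/= ih1 -prob_intD//.
  by apply: eq_Rintegral => x _; rewrite big_ord_recr.
have : N * L f <= N * \int[riesz_measure]_x f x + 1.
  rewrite (le_trans NLf)// (int_sum n.+1).1.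
  have bmf : bmeas f by exact: bcont_bmeas.
  rewrite -prob_intZ// -[in leRHS](prob_int_cst riesz_measure 1).
  rewrite -prob_intD//; [|exact: bmeasZ|exact: bmeas_cst].
  apply: (prob_int_le_on measurableT); first exact: probability_setT.
  - exact: (int_sum n.+1).2.
  - by apply: bmeasD; [exact: bmeasZ|exact: bmeas_cst].
  - by move=> x _; exact: indic_sum.
rewrite -ler_pdivlMl// mulrDr mulKf ?gt_eqF// mulr1 => /le_trans; apply.
by rewrite lerD2l ltW.
Qed.

(** The reverse inequality is [riesz_unit_le] for [1 - f]. *)
Let riesz_unit (f : S -> R) : continuous f -> (forall x, 0 <= f x <= 1) ->
  L f = \int[riesz_measure]_x f x.
Proof.
move=> cf f01; apply/eqP; rewrite eq_le riesz_unit_le//=.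
have bf : bcont f by exact: bcont_unit.
have b1 : bcont (cst 1 : S -> R) by exact: bcont_cst.
have bB : bcont (fun x => 1 - f x) by exact: (bcontB b1 bf).
have := @riesz_unit_le (fun x => 1 - f x) bB.1.
rewrite (LB b1 bf) L_cst RintegralB//; last 2 first.
- exact: (bmeas_integrable _ (bmeas_cst _ 1)).
- exact: (bmeas_integrable _ (bcont_bmeas bf)).
rewrite [X in _ <= X - _](prob_int_cst riesz_measure 1) lerD2l lerN2; apply.
by move=> x; have /andP[? ?] := f01 x; rewrite subr_ge0 gerBl; apply/andP.
Qed.

Lemma riesz_representation : closed K -> exists P : probability S R,
  P K = 1%E /\ forall f, bcont f -> \int[P]_x f x = L f.
Proof.
move=> clK; exists riesz_measure; split; first exact: riesz_measure_on.
move=> f bf; have [cf [M fM]] := bf.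
have M0 : 0 < `|M| + 1 by rewrite ltr_wpDl.
(* This scaling makes [c * f] at most 1/2 in absolute value, so that [g] below takes values in
   [0, 1]. *)
pose c := (2 * (`|M| + 1))^-1.
have c0 : 0 < c by rewrite invr_gt0 mulr_gt0.
pose g x := 2^-1 + c * f x.
have bh : bcont (cst 2^-1 : S -> R) by exact: bcont_cst.
have bg : bcont g by apply: bcontD; [exact: bh|exact: bcontZ].
have := @riesz_unit g bg.1.
rewrite /g (LD bh (bcontZ c bf)) L_cst LZ//.
rewrite (@prob_intD _ _ _ _ (cst 2^-1)); last 2 first.
  exact: bmeas_cst.
  exact/bcont_bmeas/bcontZ.
rewrite prob_int_cst prob_intZ; last exact: bcont_bmeas.
move=> H; apply/esym/(mulfI (lt0r_neq0 c0))/(addrI 2^-1)/H => x.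
have : `|c * f x| <= 2^-1.
  rewrite normrM (gtr0_norm c0) /c invfM -mulrA ler_piMr ?invr_ge0//.
  rewrite mulrC ler_pdivrMr// mul1r (le_trans (fM x))//.
  by rewrite (le_trans (ler_norm M))// lerDl.
by rewrite ler_norml => /andP[? ?]; apply/andP; split; lra.
Qed.

End riesz.

(** * Borel spaces: separation, countable bases, continuous functions on products *)

Section borel_space.
Context (R : realType) d (S : borelSpaceType R d).

Lemma borel_open_measurable (U : set S) : open U -> measurable U.
Proof. by rewrite measurable_openE; exact: sub_sigma_algebra. Qed.

Lemma borel_closed_measurable (C : set S) : closed C -> measurable C.
Proof.
move=> cC; rewrite -[C]setCK; apply: measurableC; apply: borel_open_measurable.
exact: closed_openC.
Qed.

Lemma borel_hausdorff : hausdorff_space S.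
Proof.
have [P [j [hP _ ij jopen _]]] := @borel_embedding R d S.
rewrite open_hausdorff => x y xy.
move: hP; rewrite open_hausdorff => /(_ (j x) (j y)).
have jxy : j x != j y by apply: contra_neq xy => /ij.
move=> /(_ jxy)[[U V] /= [xU yV] [oU oV UV]].
exists (j @^-1` U, j @^-1` V) => /=.
  by rewrite !inE /= in xU yV *.
split; [by apply/jopen; exists U|by apply/jopen; exists V|].
apply/eqP/seteqP; split => // z [/= zU zV].
have /eqP UV0 := UV; have : (U `&` V) (j z) by split.
by rewrite UV0.
Qed.

Lemma borel_compact_closed (K : set S) : compact K -> closed K.
Proof. exact: (compact_closed borel_hausdorff). Qed.

Lemma borel_compact_measurable (K : set S) : compact K -> measurable K.
Proof. by move=> /borel_compact_closed; exact: borel_closed_measurable. Qed.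

Lemma borel_countable_base : exists O : nat -> set S,
  (forall i, open (O i)) /\
  forall x U, nbhs x U -> exists i, O i x /\ O i `<=` U.
Proof.
have [P [j [hP [D cD dD] ij jopen _]]] := @borel_embedding R d S.
have [D0|[f]] := pfcard_geP cD.
  have : [set: P] !=set0 by exists (j point).
  by move=> /dD /(_ openT)[p]; rewrite D0 setI0.
(* Interiors are taken because the axioms of a pseudometric type do not make [ball] open. *)
pose B (p : nat * nat) : set P := (ball (f p.1) p.2.+1%:R^-1)°.
pose O n := if unpickle n is Some p then j @^-1` B p else set0.
exists O; split => [i|x U].
  rewrite /O; case: (unpickle i) => [p|]; last exact: open0.
  by apply/jopen; exists (B p) => //; exact: open_interior.
rewrite nbhsE => -[U' [oU' U'x] U'U].
have [V oV UV] := (jopen U').1 oU'.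
have : nbhs (j x) V.
  by apply: open_nbhs_nbhs; split => //; move: U'x; rewrite UV.
move=> /nbhs_ballP[e /= e0 eV].
have e20 : 0 < e / 2 by rewrite divr_gt0.
have [m me] : exists m : nat, m.+1%:R^-1 < e / 2.
  have [m _ /(_ m (leqnn m)) me] := near_infty_natSinv_lt (PosNum e20).
  by exists m.
pose r : R := m.+1%:R^-1.
have r0 : 0 < r by rewrite invr_gt0 ltr0n.
have [p [/interior_subset xp Dp]] : (ball (j x) (r / 2))° `&` D !=set0.
  apply: dD; last exact: open_interior.
  exists (j x); apply: nbhs_singleton; apply: nbhs_interior.
  by apply: nbhsx_ballx; rewrite divr_gt0.
have [i _ fip] := @surj _ _ _ _ f p Dp.
rewrite -fip in xp => {p Dp fip}.
exists (pickle (i, m)); rewrite /O pickleK /B/=; split.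
  apply/nbhs_ballP; exists (r / 2) => /=; first by rewrite divr_gt0.
  by move=> y xy; rewrite -/r [r]splitr; apply: ball_triangle xy; exact: ball_sym.
move=> y /interior_subset fy; apply: U'U; rewrite UV /=; apply: eV.
have : ball (j x) (r / 2 + r) (j y) by apply: ball_triangle fy.
apply: le_ball; rewrite [e in leRHS]splitr lerD// ltW//.
by apply: lt_trans me; rewrite ltr_pdivrMr// ltr_pMr// ltr1n.
Qed.

End borel_space.

(** There are only countably many pairs of basic sets. This puts the open sets of a product into the
    product sigma-algebra, so that continuous functions of two variables are jointly measurable. *)
Lemma measurable_rectangle_cover d1 d2 (T1 : measurableType d1)
    (T2 : measurableType d2) (B1 : nat -> set T1) (B2 : nat -> set T2)
    (U : set (T1 * T2)) :
  (forall i, measurable (B1 i)) -> (forall i, measurable (B2 i)) ->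
  (forall z, U z -> exists i k,
     [/\ B1 i z.1, B2 k z.2 & B1 i `*` B2 k `<=` U]) ->
  measurable U.
Proof.
move=> mB1 mB2 UO.
pose F n := if unpickle n is Some (i, k) then
  (if pselect (B1 i `*` B2 k `<=` U) then B1 i `*` B2 k else set0) else set0.
rewrite (_ : U = \bigcup_n F n).
  apply: bigcupT_measurable => n; rewrite /F; case: (unpickle n) => [[i k]|] //.
  by case: pselect => /= _ //; exact: measurableX.
apply/seteqP; split => [z Uz|z [n _]].
  have [i [k [iz kz ikU]]] := UO _ Uz.
  by exists (pickle (i, k)) => //; rewrite /F pickleK; case: pselect.
by rewrite /F; case: (unpickle n) => [[i k]|] //; case: pselect => //= ikU /ikU.
Qed.

Lemma real_countable_base (R : realType) : exists O : nat -> set R,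
  (forall i, measurable (O i)) /\
  forall x U, nbhs x U -> exists i, O i x /\ O i `<=` U.
Proof.
pose O n : set R :=
  if unpickle n is Some (p, q) then `]ratr p, ratr q[%classic else set0.
exists O; split => [i|x U].
  by rewrite /O; case: (unpickle i) => [[p q]|] //; exact: measurable_itv.
move=> /nbhs_ballP[e /= e0 eU].
have xe : x - e < x by rewrite gtrBl.
have ex : x < x + e by rewrite ltrDl.
have [p] := rat_in_itvoo xe; rewrite in_itv/= => /andP[p1 p2].
have [q] := rat_in_itvoo ex; rewrite in_itv/= => /andP[q1 q2].
exists (pickle (p, q)); rewrite /O pickleK; split => [|y] /=.
  by rewrite in_itv/= p2 q1.
rewrite in_itv/= => /andP[py yq]; apply: eU.
by rewrite /ball/= ltr_distlC (lt_trans p1)//= (lt_trans yq).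
Qed.

Lemma measurable_continuous_prod_real (R : realType) d (S : borelSpaceType R d)
  (f : S * R -> R) : continuous f -> measurable_fun setT f.
Proof.
move=> cf; apply: (measurability _ (measurable_realfun.RGenOInfty.measurableE R)).
move=> _ [_ [a ->] <-]; rewrite setTI.
have [B1 [oB1 B1P]] := borel_countable_base S.
have [B2 [mB2 B2P]] := real_countable_base R.
apply: (measurable_rectangle_cover (B1 := B1) (B2 := B2)) => //.
  by move=> i; exact: borel_open_measurable.
move=> z /= fz.
have : nbhs z (f @^-1` `]a, +oo[%classic).
  apply: open_nbhs_nbhs; split => //.
  by apply: open_comp => [? _|]; [exact: cf|exact: interval_open].
move=> [[U V] /= [/B1P[i [iz iU]] /B2P[k [kz kV]]] UV].
by exists i, k; split => //; apply: subset_trans UV; exact: setSX.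
Qed.

Lemma measurable_continuous_prod (R : realType) d1 d2 (S : borelSpaceType R d1)
  (T : borelSpaceType R d2) (f : S * T -> R) : continuous f -> measurable_fun setT f.
Proof.
move=> cf; apply: (measurability _ (measurable_realfun.RGenOInfty.measurableE R)).
move=> _ [_ [a ->] <-]; rewrite setTI.
have [B1 [oB1 B1P]] := borel_countable_base S.
have [B2 [oB2 B2P]] := borel_countable_base T.
apply: (measurable_rectangle_cover (B1 := B1) (B2 := B2)) => //.
  by move=> i; exact: borel_open_measurable.
  by move=> i; exact: borel_open_measurable.
move=> z /= fz.
have : nbhs z (f @^-1` `]a, +oo[%classic).
  apply: open_nbhs_nbhs; split => //.
  by apply: open_comp => [? _|]; [exact: cf|exact: interval_open].
move=> [[U V] /= [/B1P[i [iz iU]] /B2P[k [kz kV]]] UV].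
by exists i, k; split => //; apply: subset_trans UV; exact: setSX.
Qed.

(** * Weak compactness of the probabilities on a compact set *)

Section weak_compactness.
Context (R : realType) d (S : borelSpaceType R d).

(* An ultrafilter limit of the integration functionals is again a functional
   dominated by the supremum over K, hence a probability on K by Riesz. *)
Lemma prob_cluster (K : set S) (mu : nat -> probability S R) :
  compact K -> (forall n, mu n K = 1%E) ->
  exists P : probability S R, P K = 1%E /\
    forall f c, bcont f -> (\forall n \near \oo, c <= \int[mu n]_x f x) ->
      c <= \int[P]_x f x.
Proof.
move=> cK muK; have mK := borel_compact_measurable cK.
have [G [GU sG]] := @ultraFilterLemma _ (\oo : set_system nat) _.
have GP : ProperFilter G by exact: ultra_proper.
pose a f n := \int[mu n]_x f x.
(* The integrals stay in a compact interval, and a cluster point of an ultrafilter is its limit. *)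
have acvg f : bcont f -> cvg (a f n @[n --> G]).
  move=> bf; have [_ [M fM]] := bf.
  have GM : G (a f @^-1` `[- M, M]%classic).
    apply: filterS filterT => n _ /=; rewrite in_itv/= -ler_norml.
    by apply: prob_int_norm => //; exact: bcont_bmeas.
  have [l [_ cl]] := @segment_compact R (- M) M (a f @ G) _ GM.
  suff h : a f n @[n --> G] --> (l : R) by apply: cvgP h.
  move=> B lB.
  have [//|GB] := in_ultra_setVsetC (a f @^-1` B) GU.
  by have [y []] := cl (~` B) B GB lB.
pose L f := lim (a f n @[n --> G]).
have LD f g : bcont f -> bcont g -> L (fun x => f x + g x) = L f + L g.
  move=> bf bg; rewrite /L (_ : a _ = a f \+ a g); last first.
    by apply/funext => n; apply: prob_intD; exact: bcont_bmeas.
  by apply/cvg_lim => //; apply: cvgD; exact: acvg.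
have LZ c f : bcont f -> L (fun x => c * f x) = c * L f.
  move=> bf; rewrite /L (_ : a _ = fun n => c * a f n); last first.
    by apply/funext => n; apply: prob_intZ; exact: bcont_bmeas.
  by apply/cvg_lim => //; apply: cvgM; [exact: cvg_cst|exact: acvg].
have Lle c f : bcont f -> (forall x, K x -> f x <= c) -> L f <= c.
  move=> bf fc; apply: limr_le; first exact: acvg.
  apply: filterS filterT => n _; apply: (prob_int_le_cst_on mK) => //.
  exact: bcont_bmeas.
have [P [PK PL]] := riesz_representation cK LD LZ Lle (borel_compact_closed cK).
exists P; split => // f c bf cf; rewrite PL//.
by apply: limr_ge; [exact: acvg|exact: sG].
Qed.

End weak_compactness.

(** * Measurability with respect to the weak topology *)

Section weak_measurability.
Context (R : realType) d (S : borelSpaceType R d).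

(** A nonnegative continuous [phi] is the supremum of the members of a countable family lying below
    it: a rational height [q] slightly under [phi x], times [1 - h i ^+ m] for a basic open set
    around [x] where [phi > q]. Closing the family under finite maxima turns the supremum into a
    limit, to which dominated convergence applies. *)
Lemma weak_countable_family : exists g : nat -> S -> R,
  (forall n, bcont (g n)) /\
  forall (phi : S -> R) (P : probability S R) c, bcont phi ->
    (forall x, 0 <= phi x) -> c < \int[P]_x phi x ->
    exists n, (forall x, g n x <= phi x) /\ c < \int[P]_x g n x.
Proof.
have [B [oB BP]] := borel_countable_base S.
have /choice[h hP] i := borel_open_indic (oB i).
pose b (p : nat * nat * rat) x : R := ratr p.2 * (1 - h p.1.1 x ^+ p.1.2).
have bb p : bcont (b p).
  apply: bcontZ; apply: bcontB; first exact: bcont_cst.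
  have [ch h01 _] := hP p.1.1; apply: bcont_unit.
    move=> x; apply: (@continuous_comp _ _ _ (h p.1.1) (fun y : R => y ^+ p.1.2)).
      exact: ch.
    exact: exprn_continuous.
  by move=> x; have /andP[h0 h1] := h01 x; rewrite exprn_ge0//= exprn_ile1.
pose gl (l : seq (nat * nat * rat)) x := foldr (fun p t => Num.max (b p x) t) 0 l.
have bgl l : bcont (gl l).
  by elim: l => [|p l ih]; [exact: bcont_cst|exact: bcont_max].
have gl0 l x : 0 <= gl l x.
  by elim: l => [//|p l ih] /=; rewrite le_max ih orbT.
have gl_ge l p x : p \in l -> b p x <= gl l x.
  elim: l => [//|p' l ih]; rewrite inE => /orP[/eqP->|/ih pl] /=.
    by rewrite le_max lexx.
  by rewrite le_max pl orbT.
have gl_le l x t : 0 <= t -> (forall p, p \in l -> b p x <= t) -> gl l x <= t.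
  move=> t0; elim: l => [//|p l ih] lt /=.
  rewrite ge_max lt ?mem_head//= ih// => q ql.
  by apply: lt; rewrite inE ql orbT.
exists (fun n => if unpickle n is Some l then gl l else cst 0).
split => [n|phi P c bphi phi0 cphi].
  by case: (unpickle n) => [l|]; [exact: bgl|exact: bcont_cst].
pose good p := forall x, b p x <= phi x.
(* The triples with code below [n] whose function lies under [phi]; their maximum tends to [phi]
   pointwise. *)
pose l n := [seq p <- pmap unpickle (iota 0 n) | `[< good p >]].
have lphi n x : gl (l n) x <= phi x.
  by apply: gl_le => // p; rewrite mem_filter => /andP[/asboolP + _]; apply.
have lcvg x : gl (l n) x @[n --> \oo] --> phi x.
  apply/cvgrPdist_le => e e0.
  have [phie|phie] := leP (phi x) e.
    apply: nearW => n; rewrite ger0_norm ?subr_ge0//.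
    by rewrite lerBlDr (le_trans phie)// lerDl.
  have e20 : 0 < e / 2 by rewrite divr_gt0.
  have [q] : exists q : rat, ratr q \in `](phi x - e / 2), (phi x)[.
    by apply: rat_in_itvoo; rewrite gtrBl.
  rewrite in_itv/= => /andP[q1 q2].
  have q0 : 0 < ratr q :> R by apply: le_lt_trans q1; lra.
  have : nbhs x (phi @^-1` [set t | ratr q < t]).
    apply: open_nbhs_nbhs; split => //; apply: open_comp; last exact: open_gt.
    by move=> y _; exact: bphi.1.
  move=> /BP[i [Bix iphi]].
  have [ch h01 hB] := hP i; have /hB hx1 := Bix.
  have /andP[hx0 _] := h01 x.
  have [m hm] : exists m, h i x ^+ m < e / 2 / ratr q.
    have : h i x ^+ m @[m --> \oo] --> (0 : R) by apply: cvg_expr; rewrite ger0_norm.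
    move=> /cvgr_lt /(_ (e / 2 / ratr q)); rewrite divr_gt0// => /(_ isT)[m _ hm].
    by exists m; exact: hm m (leqnn m).
  have gp : good (i, m, q).
    move=> y; rewrite /b/=; have /andP[h0 h1] := h01 y.
    have [/iphi/= qy|By] := pselect (B i y).
      by rewrite (le_trans _ (ltW qy))// ler_piMr ?(ltW q0)// gerBl exprn_ge0.
    suff -> : h i y = 1 by rewrite expr1n subrr mulr0.
    by apply/eqP; rewrite eq_le h1 leNgt; apply/negP => /hB.
  near=> n.
  have pl : (i, m, q) \in l n.
    rewrite mem_filter; apply/andP; split; first exact/asboolP.
    rewrite mem_pmap; apply/mapP; exists (pickle (i, m, q)).
      by rewrite mem_iota/= add0n; near: n; exists (pickle (i, m, q)).+1.
    by rewrite pickleK.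
  rewrite ger0_norm ?subr_ge0// lerBlDr -lerBlDl.
  apply: le_trans (gl_ge _ _ x pl); rewrite /b/= mulrBr mulr1.
  move: hm; rewrite ltr_pdivlMr// mulrC => hm.
  lra.
have [n cn] : exists n, c < \int[P]_x gl (l n) x.
  have : (\int[P]_x gl (l n) x)%:E @[n --> \oo] --> (\int[P]_x phi x)%:E.
    rewrite prob_int_EFin; last exact: bcont_bmeas.
    rewrite (_ : (fun n => (\int[P]_x gl (l n) x)%:E) =
        fun n => (\int[P]_x (gl (l n) x)%:E)%E); last first.
      by apply/funext => n; rewrite prob_int_EFin//; exact: bcont_bmeas.
    apply: (@dominated_cvg _ _ _ P _ measurableT _ _ (EFin \o phi)) => //.
    - move=> n; apply/measurable_EFinP; apply: measurable_fun_continuous_borel.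
      by case: (bgl (l n)).
    - by move=> x _; apply: cvg_EFin; [exact: nearW|exact: lcvg].
    - exact: (bmeas_integrable _ (bcont_bmeas bphi)).
    - by move=> n x _; rewrite /= lee_fin ger0_norm.
  move=> /fine_cvgP[_] /cvgr_gt /(_ c cphi)[n _ cn].
  by exists n; exact: cn n (leqnn n).
by exists (pickle (l n)); rewrite pickleK.
Unshelve. all: by end_near. Qed.

(** Finitely many constraints [q < \int g n] with rational [q] form a countable base of the weak
    topology. Every weakly open set is thus a countable union of sets described by the integrals of
    the [g n]. *)
Lemma measurable_borel_prob_family : exists g : nat -> S -> R,
  (forall n, bcont (g n)) /\
  forall d' (Z : measurableType d') (D : set Z) (mu : Z -> probability S R),
    measurable D ->
    (forall n, measurable_fun D (fun z => \int[mu z]_x g n x)) ->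
    measurable_fun D (mu : Z -> borel_prob S).
Proof.
have [g [bg gP]] := weak_countable_family.
exists g; split => // d' Z D mu mD mg.
pose holds (l : seq (nat * rat)) (P : probability S R) :=
  forall p, p \in l -> ratr p.2 < \int[P]_x g p.1 x.
have base (W : set (weak_prob S)) (P : probability S R) :
    open W -> W P -> exists l, holds l P /\ forall P', holds l P' -> W P'.
  move=> oW WP.
  (* The sets containing a basic neighbourhood of [P] form a filter; that it converges weakly to [P]
     is what makes the constraints a base. *)
  pose F : set_system (probability S R) := [set V | exists l, holds l P /\
    forall P', holds l P' -> V P'].
  have FF : Filter F.
    split.
    - by exists [::]; split.
    - move=> V V' [l [lP lV]] [l' [lP' lV']]; exists (l ++ l'); split.
        by move=> p; rewrite mem_cat => /orP[/lP|/lP'].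
      move=> P' h; split.
        by apply: lV => p pl; apply: h; rewrite mem_cat pl.
      by apply: lV' => p pl; apply: h; rewrite mem_cat pl orbT.
    - move=> V V' VV' [l [lP lV]]; exists l; split => // P' /lV.
      exact: VV'.
  have lower (f : S -> R) c : bcont f -> c < \int[P]_x f x ->
      F [set P' | c < \int[P']_x f x].
    move=> bf cf; have [_ [M fM]] := bf.
    (* The countable family approximates nonnegative functions only; adding the bound [M] reaches
       every bounded continuous [f]. Upper bounds will come from [- phi]. *)
    have bfM : bcont (fun x => f x + M).
      by apply: bcontD => //; exact: bcont_cst.
    have intM (P' : probability S R) : \int[P']_x (f x + M) = \int[P']_x f x + M.
      rewrite -[in RHS](prob_int_cst P' M) -prob_intD//.
        exact: bcont_bmeas.
      exact: bmeas_cst.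
    have fM0 x : 0 <= f x + M.
      by have := fM x; rewrite ler_norml -subr_ge0 opprK addrC => /andP[].
    have [|n [gn gc]] := @gP (fun x => f x + M) P (c + M) bfM fM0.
      by rewrite intM ltrD2r.
    have [q] := rat_in_itvoo gc; rewrite in_itv/= => /andP[cq qg].
    exists [:: (n, q)]; split => [p|P' /(_ (n, q))]; first by rewrite inE => /eqP->.
    rewrite mem_head => /(_ isT)/= qP'.
    rewrite /= -(ltrD2r M) -intM (lt_trans cq)// (lt_le_trans qP')//.
    apply: (prob_int_le_on measurableT); first exact: probability_setT.
    - exact: bcont_bmeas.
    - exact: bcont_bmeas.
    - by move=> x _.
  have [U [oU UW]] : exists U, open U /\ W = @bc_integral R d S @^-1` U.
    by case: oW => U oU <-; exists U.
  have : (@bc_integral R d S @ F) U.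
    suff : @bc_integral R d S @ F --> @bc_integral R d S P.
      by apply; apply: open_nbhs_nbhs; split => //; rewrite UW in WP.
    apply/cvg_sup => phi A [_ [[V oV <-] VP VA]].
    apply: filterS VA _ => /=.
    have bphi := bcfun_bcont phi.
    have /nbhs_ballP[e /= e0 eV] : nbhs (\int[P]_x phi x) V by exact: open_nbhs_nbhs.
    have F1 : F [set P' | \int[P]_x phi x - e < \int[P']_x phi x].
      by apply: lower => //; rewrite gtrBl.
    have intN (P' : probability S R) : \int[P']_x (- phi x) = - \int[P']_x phi x.
      rewrite -[RHS]mulN1r -prob_intZ; last exact: bcont_bmeas.
      by apply: eq_Rintegral => x _; rewrite mulN1r.
    have F2 : F [set P' | (- \int[P]_x phi x) - e < \int[P']_x (- phi x)].
      by apply: lower; [exact: bcontN|rewrite intN gtrBl].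
    apply: filterS2 F1 F2 => P' /=; rewrite intN => h1 h2; apply: eV.
    change (`|\int[P]_x phi x - \int[P']_x phi x| < e).
    by rewrite ltr_distlC h1/= -subr_gt0; move: h2; rewrite -subr_gt0; lra.
  by move=> [l [lP lU]]; exists l; split => // P' /lU; rewrite UW.
apply: (@measurability _ _ _ (borel_prob S) D (mu : Z -> borel_prob S)
  (@open (weak_prob S))) => //.
move=> _ [W oW <-].
pose V (l : seq (nat * rat)) : set Z := [set z | holds l (mu z)].
have mV l : measurable (D `&` V l).
  elim: l => [|p l ih].
    by rewrite (_ : V [::] = setT) ?setIT//; apply/seteqP; split.
  rewrite (_ : D `&` V _ = (D `&` (fun z => \int[mu z]_x g p.1 x) @^-1`
      `]ratr p.2, +oo[%classic) `&` (D `&` V l)).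
    apply: measurableI => //; apply: mg => //; exact: measurable_itv.
  apply/seteqP; split => z [].
    move=> Dz h; split; split => //=.
      by rewrite in_itv/= andbT; apply: h; rewrite mem_head.
    by move=> q ql; apply: h; rewrite inE ql orbT.
  move=> [Dz] /=; rewrite in_itv/= andbT => hp [_ hl]; split => // q.
  by rewrite inE => /orP[/eqP->//|/hl].
pose F n : set Z := if unpickle n is Some l then
  (if pselect (forall P', holds l P' -> W P') then D `&` V l else set0) else set0.
rewrite (_ : D `&` _ = \bigcup_n F n).
  apply: bigcupT_measurable => n; rewrite /F; case: (unpickle n) => [l|] //.
  by case: pselect => /= _ //.
apply/seteqP; split => [z [Dz Wz]|z [n _]].
  have [l [lz lW]] := base _ _ oW Wz.
  by exists (pickle l) => //; rewrite /F pickleK; case: pselect.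
rewrite /F; case: (unpickle n) => [l|] //; case: pselect => //= lW [Dz /lW Wz].
by split.
Qed.

End weak_measurability.

(** * The minimax theorem with finitely supported mixed actions *)

Section finite_mixtures.
Context (R : realType).

(* Blackwell approachability: the player answers the positive part of the
   vector of accumulated deficits, so the sum of the squared positive parts
   grows at most linearly. *)
Lemma approachability (T : Type) (K : set T) (m : nat) (F : T -> 'I_m -> R) (M : R) :
  (forall a j, K a -> `|F a j| <= M) ->
  (forall p : 'I_m -> R, (forall j, 0 <= p j) ->
    exists a, K a /\ 0 <= \sum_j p j * F a j) ->
  forall e, 0 < e -> exists n (a : nat -> T), (forall t, K (a t)) /\
    forall j, - e * n.+1%:R <= \sum_(t < n.+1) F (a t) j.
Proof.
move=> FM resp e e0.
(* The reply is made total: it lies in [K] for every [p], while its payoff is controlled for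
   nonnegative [p] only. *)
have /choice[r rP] : forall p, exists a, K a /\
    ((forall j, 0 <= p j) -> 0 <= \sum_j p j * F a j).
  move=> p.
  have [//|a [Ka _]] := resp (fun _ => 0).
  have [p0|p0] := pselect (forall j, 0 <= p j).
    by have [a' [Ka' Fa']] := resp p p0; exists a'.
  by exists a.
pose pos (s : 'I_m -> R) j := Num.max (s j) 0.
pose s := fix s n := if n is n'.+1 then
  fun j => s n' j - F (r (pos (s n'))) j else (fun _ : 'I_m => 0 : R).
pose a n := r (pos (s n)).
have sE n j : s n j = - \sum_(t < n) F (a t) j.
  elim: n => [|n ih]; first by rewrite big_ord0 oppr0.
  by rewrite big_ord_recr/= ih opprD.
pose Phi n := \sum_j (pos (s n) j) ^+ 2.
have Phi_le n : Phi n <= n%:R * (m%:R * M ^+ 2).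
  elim: n => [|n ih].
    rewrite mul0r /Phi big1// => j _.
    by rewrite /pos /= maxxx expr0n.
  (* In each of the four sign cases of [s] and [s - y], the square of the positive part of [s - y]
     is at most that of [s], minus twice [pos s * y], plus [M ^+ 2]. The cross terms sum to a
     nonnegative number by the choice of the reply. *)
  have h : Phi n.+1 <= Phi n - 2 * \sum_j pos (s n) j * F (a n) j
      + \sum_(j < m) M ^+ 2.
    rewrite /Phi mulr_sumr -sumrN -!big_split/=; apply: ler_sum => j _.
    have Ka := (rP (pos (s n))).1.
    have FM2 : F (a n) j ^+ 2 <= M ^+ 2.
      have FMj := FM _ j Ka; rewrite -[leLHS]real_normK ?num_real//.
      by rewrite lerXn2r ?nnegrE// (le_trans _ FMj).
    set y := F (a n) j in FM2 *.
    have -> : pos (s n.+1) j = Num.max (s n j - y) 0 by [].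
    rewrite /pos; have [s1|s1] := leP (s n j - y) 0.
      rewrite expr0n/=; have [s2|s2] := leP (s n j) 0.
        by rewrite expr0n/= mul0r mulr0 oppr0 !add0r (le_trans _ FM2)// sqr_ge0.
      rewrite (@le_trans _ _ ((s n j - y) ^+ 2))// ?sqr_ge0//.
      have -> : (s n j - y) ^+ 2 = s n j ^+ 2 - 2 * (s n j * y) + y ^+ 2 by ring.
      by rewrite lerD2l.
    have [s2|s2] := leP (s n j) 0.
      rewrite expr0n/= mul0r mulr0 oppr0 !add0r (le_trans _ FM2)//.
      rewrite -(sqrrN y) lerXn2r ?nnegrE ?(ltW s1)//; last by lra.
      by rewrite (le_trans (ltW s1))//; lra.
    have -> : (s n j - y) ^+ 2 = s n j ^+ 2 - 2 * (s n j * y) + y ^+ 2 by ring.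
      by rewrite lerD2l.
  have -> : n.+1%:R * (m%:R * M ^+ 2) = n%:R * (m%:R * M ^+ 2) + m%:R * M ^+ 2.
    by rewrite -natr1 mulrDl mul1r.
  rewrite (le_trans h)// lerD//; last first.
    by rewrite sumr_const card_ord mulr_natl.
  rewrite (le_trans _ ih)// gerBl mulr_ge0//.
  apply: (rP (pos (s n))).2 => j; by rewrite /pos le_max lexx orbT.
(* A deficit above [e * n.+1] in one coordinate would force [Phi n.+1] to be at least its square,
   against the linear bound; this [n] makes the two incompatible. *)
have [n nP] : exists n : nat, m%:R * M ^+ 2 < e ^+ 2 * n.+1%:R.
  exists (Num.truncn (m%:R * M ^+ 2 / e ^+ 2)).
  rewrite -ltr_pdivrMl ?exprn_gt0// mulrC.
  exact: truncnS_gt.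
exists n, a; split => [t|j]; first exact: (rP _).1.
rewrite -[leRHS]opprK -sE mulNr lerN2 leNgt; apply/negP => sn.
have en0 : 0 < e * n.+1%:R by rewrite mulr_gt0 ?ltr0n.
have : (e * n.+1%:R) ^+ 2 <= Phi n.+1.
  rewrite /Phi (bigD1 j)//= -[leLHS]addr0 lerD ?sumr_ge0//; last first.
    by move=> i _; exact: sqr_ge0.
  rewrite lerXn2r ?nnegrE ?(ltW en0)// /pos ?le_max ?lexx ?orbT//.
  by rewrite ltW.
move=> /le_trans/(_ (Phi_le _)).
have -> : (e * n.+1%:R) ^+ 2 = n.+1%:R * (e ^+ 2 * n.+1%:R) by ring.
by rewrite ler_pM2l ?ltr0n// leNgt nP.
Qed.

(** The inequality is strict so that it is an open condition in [b], stable when the game is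
    perturbed. *)
Definition lower_mix (T U : Type) (K : set T) (L : set U) (H : T -> U -> R) c :=
  exists n (w : 'I_n -> R) (a : 'I_n -> T),
    [/\ forall i, 0 <= w i, \sum_i w i = 1, forall i, K (a i) &
        forall b, L b -> c < \sum_i w i * H (a i) b].

Definition swap_payoff (T U : Type) (H : T -> U -> R) b a := - H a b.

(** Player 2 is treated as the maximizer of [- H] with the roles exchanged, so that one theory
    serves both players. *)
Definition upper_mix (T U : Type) (K : set T) (L : set U) (H : T -> U -> R) c :=
  lower_mix L K (swap_payoff H) (- c).

Lemma convex_sum_lt n (w f : 'I_n -> R) c : (forall i, 0 <= w i) ->
  \sum_i w i = 1 -> (forall i, c < f i) -> c < \sum_i w i * f i.
Proof.
move=> w0 w1 cf.
have [i wi] : exists i, 0 < w i.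
  apply: contrapT => /forallNP h; have : \sum_i w i = 0.
    apply: big1 => i _; apply/eqP; rewrite eq_le w0 andbT leNgt.
    by apply/negP; exact: h.
  by rewrite w1 => /eqP; rewrite oner_eq0.
rewrite -subr_gt0 -[X in _ - X]mul1r -w1 mulr_suml -sumrB (bigD1 i)//=.
rewrite ltr_pwDl//; first by rewrite -mulrBr mulr_gt0// subr_gt0.
by apply: sumr_ge0 => k _; rewrite -mulrBr mulr_ge0// subr_ge0 ltW.
Qed.

Lemma lower_upper_mix (T U : Type) (K : set T) (L : set U) (H : T -> U -> R) c :
  lower_mix K L H c -> upper_mix K L H c -> False.
Proof.
move=> [n [w [a [w0 w1 Ka Hc]]]] [m [u [b [u0 u1 Lb Hb]]]].
have h1 : c < \sum_j u j * (\sum_i w i * H (a i) (b j)).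
  by apply: convex_sum_lt => // j; exact: Hc.
have h2 : - c < \sum_i w i * (\sum_j u j * swap_payoff H (b j) (a i)).
  by apply: convex_sum_lt => // i; exact: Hb.
have E : \sum_i w i * (\sum_j u j * swap_payoff H (b j) (a i)) =
    - \sum_j u j * (\sum_i w i * H (a i) (b j)).
  rewrite -sumrN; under [RHS]eq_bigr do rewrite mulr_sumr -sumrN.
  rewrite exchange_big/=; apply: eq_bigr => i _.
  rewrite mulr_sumr; apply: eq_bigr => j _.
  by rewrite /swap_payoff !mulrN mulrCA.
by move: h2; rewrite E ltrN2 => /(lt_trans h1); rewrite ltxx.
Qed.

Lemma compact_uniform_near (S T : topologicalType) (K : set S) (H : S -> T -> R)
    b e : compact K -> continuous (fun z : S * T => H z.1 z.2) -> 0 < e ->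
  \forall b' \near b, forall a, K a -> `|H a b' - H a b| <= e.
Proof.
move=> /compact_near_coveringP cK cH e0.
have := cK T (nbhs b) (fun b' a => `|H a b' - H a b| <= e) _.
apply => a Ka.
have e20 : 0 < e / 2 by rewrite divr_gt0.
have h1 : \forall a' \near a & b' \near b, `|H a b - H a' b'| <= e / 2.
  have : H z.1 z.2 @[z --> (a, b)] --> H a b by exact: (cH (a, b)).
  by move=> /cvgrPdist_le /(_ _ e20) [[U V] UV h]; exists (U, V).
case: h1 => -[U V] /= [Ua Vb] UV; exists (U, V) => //= -[a' b'] /= [Ua' Vb'].
have h1 : `|H a b - H a' b'| <= e / 2 := UV (a', b') (conj Ua' Vb').
have h2 : `|H a b - H a' b| <= e / 2 := UV (a', b) (conj Ua' (nbhs_singleton Vb)).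
have -> : H a' b' - H a' b = (H a b - H a' b) - (H a b - H a' b') by lra.
by rewrite (le_trans (ler_normB _ _))// [e]splitr lerD.
Qed.

(** By compactness [L] is replaced by a finite net, uniformly over [K]. If some weights on the net
    had no reply worth [d], their normalization would be an [upper_mix] at level [d]. Otherwise all
    weights have a reply, and approachability yields moves whose average is nearly [d] against the
    whole net. *)
Lemma finite_minimax (S T : ptopologicalType) (K : set S) (L : set T)
    (H : S -> T -> R) M c d :
  compact K -> compact L -> K !=set0 -> L !=set0 ->
  continuous (fun z : S * T => H z.1 z.2) ->
  (forall a b, `|H a b| <= M) -> c < d ->
  lower_mix K L H c \/ upper_mix K L H d.
Proof.
move=> cK cL [a0 Ka0] [b0 Lb0] cH HM cd.
have [?|nup] := pselect (upper_mix K L H d); [by right|left].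
(* One third is lost on the net, one in approachability, and the last keeps the conclusion
   strict. *)
pose e := (d - c) / 3.
have e0 : 0 < e by rewrite divr_gt0// subr_gt0.
pose N b := (fun b' => forall a, K a -> `|H a b' - H a b| <= e).
have Nb b : nbhs b (N b) by exact: compact_uniform_near.
have cov : cover_compact L by move: cL; rewrite compact_cover.
have [|D DL LD] := cov _ L (fun b => (N b)°) (fun _ _ => @open_interior _ _).
  by move=> b Lb; exists b => //; exact: Nb.
pose s := finmap.enum_fset D.
pose m := size s.
pose b (j : 'I_m) := nth b0 s j.
have sL x : x \in s -> L x by move=> xs; have := DL x xs; rewrite inE.
have Lb j : L (b j) by apply: sL; exact: mem_nth.
have mnet x : L x -> exists j, forall a, K a -> `|H a x - H a (b j)| <= e.
  move=> /LD[y /= yD /interior_subset Ny].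
  have ys : (index y s < m)%N by rewrite index_mem.
  by exists (Ordinal ys) => a Ka; rewrite /b/= nth_index//; exact: Ny.
pose F a j := H a (b j) - d.
have FM a j : K a -> `|F a j| <= M + `|d|.
  by move=> _; rewrite (le_trans (ler_normB _ _))// lerD2r.
have resp (p : 'I_m -> R) : (forall j, 0 <= p j) ->
    exists a, K a /\ 0 <= \sum_j p j * F a j.
  move=> p0; have [p1|p1] := eqVneq (\sum_j p j) 0.
    exists a0; split => //; rewrite big1// => j _.
    suff -> : p j = 0 by rewrite mul0r.
    by move/eqP: p1; rewrite psumr_eq0// => /allP/(_ j); rewrite mem_index_enum => /(_ isT)/eqP.
  have p2 : 0 < \sum_j p j by rewrite lt_neqAle eq_sym p1 sumr_ge0.
  apply: contrapT => /forallNP na; apply: nup.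
  exists m, (fun j => p j / \sum_j p j), b; split => //.
  - by move=> j; rewrite divr_ge0// ltW.
  - by rewrite -mulr_suml divff.
  - move=> a Ka; have /not_andP[//|/negP] := na a; rewrite -ltNge => Fa.
    have -> : \sum_i p i / (\sum_j p j) * swap_payoff H (b i) a =
        - ((\sum_i p i * H a (b i)) / \sum_j p j).
      rewrite mulr_suml -sumrN; apply: eq_bigr => i _.
      by rewrite /swap_payoff mulrN mulrAC.
    rewrite ltrN2 ltr_pdivrMr//.
    move: Fa; rewrite /F; under eq_bigr do rewrite mulrBr.
    by rewrite sumrB -mulr_suml subr_lt0 mulrC.
have [n [a [Ka an]]] := approachability FM resp e0.
(* The mixture is the empirical distribution of the [n.+1] moves, repetitions included. *)
exists n.+1, (fun _ => n.+1%:R^-1), (fun i => a i); split => //.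
- by rewrite sumr_const card_ord -[LHS]mulr_natr mulVf// pnatr_eq0.
- move=> x /mnet[j jx]; rewrite -mulr_sumr mulrC ltr_pdivlMr ?ltr0n//.
  have := an j; rewrite /F sumrB sumr_const card_ord => h.
  have h2 : \sum_(t < n.+1) H (a t) (b j) - e * n.+1%:R <= \sum_(i < n.+1) H (a i) x.
    rewrite lerBlDr mulr_natr -[X in e *+ X]card_ord -sumr_const -big_split/=.
    apply: ler_sum => i _; have := jx (a i) (Ka i).
    by rewrite ler_norml => /andP[h1 _]; move: h1; lra.
  rewrite (lt_le_trans _ h2)// ltrBrDr.
  move: h; rewrite lerBrDr => /(lt_le_trans _); apply.
  rewrite -[d *+ _]mulr_natr -!mulrDl ltr_pM2r ?ltr0n//.
  by rewrite /e; move: cd; lra.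
Qed.

End finite_mixtures.

Lemma continuous_pair_fun (X Y Z : topologicalType) (f : X -> Y) (g : X -> Z) x :
  {for x, continuous f} -> {for x, continuous g} ->
  {for x, continuous (fun t => (f t, g t))}.
Proof. by move=> cf cg; apply: cvg_pair. Qed.

Lemma continuous_pairr (X Y : topologicalType) (x : X) :
  continuous (fun y : Y => (x, y)).
Proof.
by move=> y; apply: continuous_pair_fun; [exact: cvg_cst|exact: cvg_id].
Qed.

Lemma continuous_pairl (X Y : topologicalType) (y : Y) :
  continuous (fun x : X => (x, y)).
Proof.
by move=> x; apply: continuous_pair_fun; [exact: cvg_id|exact: cvg_cst].
Qed.

Lemma continuous_sum (R : realType) (X : topologicalType) n (f : 'I_n -> X -> R) x :
  (forall i, {for x, continuous (f i)}) ->
  {for x, continuous (fun t => \sum_i f i t)}.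
Proof.
move=> cf; elim: (index_enum _) => [|i s ih].
  have -> : (fun t => \sum_(i <- [::]) f i t) = cst 0.
    by apply/funext => t; rewrite big_nil.
  exact: cvg_cst.
have -> : (fun t => \sum_(i <- i :: s) f i t) =
    (fun t => f i t + \sum_(i <- s) f i t).
  by apply/funext => t; rewrite big_cons.
by apply: cvgD; [exact: cf|exact: ih].
Qed.

(** * The value of a one-stage game *)

Section game_value.
Context (R : realType).

(* lower_mix only involves finitely supported mixtures, which keeps measures out
   of the minimax and continuity theorems; le_Val_prob extends the bound to all
   probabilities. *)
Definition val (S T : Type) (K : set S) (L : set T) (H : S -> T -> R) : R :=
  sup [set c | lower_mix K L H c].

Lemma lower_mix_le (S T : Type) (K : set S) (L : set T) (H : S -> T -> R) c d :
  c <= d -> lower_mix K L H d -> lower_mix K L H c.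
Proof.
move=> cd [n [w [a [w0 w1 Ka Hd]]]]; exists n, w, a; split => // b Lb.
by rewrite (le_lt_trans cd)// Hd.
Qed.

Section val_theory.
Variables (S T : ptopologicalType) (K : set S) (L : set T) (H : S -> T -> R).
Variable (M : R).
Hypotheses (cK : compact K) (cL : compact L) (K0 : K !=set0) (L0 : L !=set0).
Hypothesis cH : continuous (fun z : S * T => H z.1 z.2).
Hypothesis HM : forall a b, `|H a b| <= M.

Let has_sup_lower : has_sup [set c | lower_mix K L H c].
Proof.
case: K0 => a Ka; case: L0 => b Lb; split.
  (* One unit below the bound [- M], as [lower_mix] is strict. *)
  exists (- M - 1), 1, (fun=> 1), (fun=> a); split => //.
    by rewrite big_ord1.
  move=> b' Lb'; rewrite big_ord1 mul1r.
  by have := HM a b'; rewrite ler_norml => /andP[? _]; lra.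
exists M => c [n [w [a' [w0 w1 Ka' Hc]]]].
rewrite (le_trans (ltW (Hc b Lb)))// -[M]mul1r -w1 mulr_suml ler_sum// => i _.
by rewrite ler_wpM2l// (le_trans (ler_norm _)).
Qed.

Lemma le_val c : lower_mix K L H c -> c <= val K L H.
Proof. by move=> lc; apply: ub_le_sup => //; case: has_sup_lower. Qed.

Lemma lower_mix_val c : c < val K L H -> lower_mix K L H c.
Proof.
rewrite /val => /(sup_gt _)[|d ld cd]; first by case: has_sup_lower.
by apply: lower_mix_le ld; exact: ltW.
Qed.

(** This is where the minimax theorem enters: for [c] strictly between the value and [d], a
    [lower_mix] at level [c] would contradict the supremum. *)
Lemma upper_mix_val d : val K L H < d -> upper_mix K L H d.
Proof.
move=> vd; pose c := (val K L H + d) / 2.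
have [vc cd] : val K L H < c /\ c < d by rewrite /c; split; lra.
have [lc|//] := finite_minimax cK cL K0 L0 cH HM cd.
by move: (le_val lc); rewrite leNgt vc.
Qed.

Lemma val_le d : upper_mix K L H d -> val K L H <= d.
Proof.
move=> ud; rewrite leNgt; apply/negP => /lower_mix_val ld.
exact: lower_upper_mix ld ud.
Qed.

End val_theory.

Section val_swap.
Variables (S T : ptopologicalType) (K : set S) (L : set T) (H : S -> T -> R).
Variable (M : R).
Hypotheses (cK : compact K) (cL : compact L) (K0 : K !=set0) (L0 : L !=set0).
Hypothesis cH : continuous (fun z : S * T => H z.1 z.2).
Hypothesis HM : forall a b, `|H a b| <= M.

Lemma swap_payoff_le b a : `|swap_payoff H b a| <= M.
Proof. by rewrite normrN. Qed.

(** The equality of the two values. Through it, statements on player 2 and upper semicontinuity are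
    read off from the exchanged game. *)
Lemma val_swap : val L K (swap_payoff H) = - val K L H.
Proof.
have S0 := le_val L0 K0 swap_payoff_le; have S1 := lower_mix_val L0 K0 swap_payoff_le.
have [h|h|//] := ltgtP (val L K (swap_payoff H)) (- val K L H).
  pose c := (val L K (swap_payoff H) - val K L H) / 2.
  have [h1 h2] : val L K (swap_payoff H) < c /\ val K L H < - c.
    by rewrite /c; split; lra.
  have := upper_mix_val cK cL K0 L0 cH HM h2.
  by rewrite /upper_mix opprK => /S0; rewrite leNgt h1.
pose c := (val L K (swap_payoff H) - val K L H) / 2.
have [h1 h2] : c < val L K (swap_payoff H) /\ - c < val K L H.
  by rewrite /c; split; lra.
have /S1 := h1; rewrite -[c]opprK => /(val_le K0 L0 HM).
by rewrite leNgt h2.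
Qed.

End val_swap.

(** The same mixture serves for both payoffs, with loss at most [e]. It yields continuity in the
    risk parameter, uniformly in the state. *)
Lemma val_le_val (S T : ptopologicalType) (K : set S) (L : set T)
    (H H' : S -> T -> R) (M M' : R) e :
  K !=set0 -> L !=set0 ->
  (forall a b, `|H a b| <= M) -> (forall a b, `|H' a b| <= M') ->
  (forall a b, K a -> L b -> H a b <= H' a b + e) ->
  val K L H <= val K L H' + e.
Proof.
move=> K0 L0 HM HM' HH'; rewrite leNgt; apply/negP => h.
pose c := (val K L H + (val K L H' + e)) / 2.
have [h1 h2] : val K L H' + e < c /\ c < val K L H by rewrite /c; split; lra.
have [n [w [a [w0 w1 Ka Hc]]]] := lower_mix_val K0 L0 HM h2.
have : c - e <= val K L H'.
  apply: (le_val K0 L0 HM'); exists n, w, a; split => // b Lb.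
  rewrite ltrBlDr (lt_le_trans (Hc b Lb))//.
  rewrite -[e]mul1r -w1 mulr_suml -big_split/= ler_sum// => i _.
  by rewrite -mulrDr ler_wpM2l// HH'.
lra.
Qed.

End game_value.

(** * Optimal mixed actions *)

Section saddle.
Context (R : realType) d1 d2 (S : borelSpaceType R d1) (T : borelSpaceType R d2).

(** A convex combination of evaluations at points of [K] is dominated by the supremum over [K], so
    Riesz turns it into a probability. *)
Lemma mix_prob (K : set S) n (w : 'I_n -> R) (a : 'I_n -> S) : compact K ->
  (forall i, 0 <= w i) -> \sum_i w i = 1 -> (forall i, K (a i)) ->
  exists P : probability S R, P K = 1%E /\
    forall f, bcont f -> \int[P]_x f x = \sum_i w i * f (a i).
Proof.
move=> cK w0 w1 Ka.
apply: (@riesz_representation _ _ _ K (fun f => \sum_i w i * f (a i)) cK).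
- by move=> f g _ _; rewrite -big_split/=; apply: eq_bigr => i _; rewrite mulrDr.
- by move=> c f _; rewrite mulr_sumr; apply: eq_bigr => i _; rewrite mulrCA.
- move=> c f _ fc; rewrite -[c]mul1r -w1 mulr_suml ler_sum// => i _.
  by rewrite ler_wpM2l// fc.
- exact: borel_compact_closed.
Qed.

(** Mixtures within [1 / n.+1] of the value have a weak cluster point, and for each fixed [b] the
    lower bound passes to it. *)
Lemma prob_optimal (K : set S) (L : set T) (H : S -> T -> R) (M : R) :
  compact K -> K !=set0 -> L !=set0 ->
  continuous (fun z : S * T => H z.1 z.2) -> (forall a b, `|H a b| <= M) ->
  exists P : probability S R, P K = 1%E /\
    forall b, L b -> val K L H <= \int[P]_a H a b.
Proof.
move=> cK K0 L0 cH HM.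
have bH b : bcont (H ^~ b).
  split; last by exists M.
  move=> a; apply: (@continuous_comp _ _ _ (fun a => (a, b))
    (fun z : S * T => H z.1 z.2)); last exact: @cH.
  by apply: cvg_pair => /=; [exact: cvg_id|exact: cvg_cst].
have /choice[mu muP] n : exists P : probability S R, P K = 1%E /\
    forall b, L b -> val K L H - n.+1%:R^-1 <= \int[P]_a H a b.
  have : val K L H - n.+1%:R^-1 < val K L H by rewrite gtrBl invr_gt0 ltr0n.
  move=> /(lower_mix_val K0 L0 HM)[m [w [a [w0 w1 Ka Hc]]]].
  have [P [PK PE]] := mix_prob cK w0 w1 Ka.
  by exists P; split => // b Lb; rewrite PE// ltW// Hc.
have [P [PK PP]] := prob_cluster cK (fun n => (muP n).1).
exists P; split => // b Lb; apply/ler_addgt0Pr => e e0.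
rewrite -lerBlDr; apply: PP => //.
have := near_infty_natSinv_lt (PosNum e0) => -[n _ nP]; exists n => // k nk /=.
apply: le_trans ((muP k).2 b Lb); rewrite lerD2l lerN2 ltW//.
exact: (nP k nk).
Qed.

End saddle.

(** * Continuity of the value in the state *)

Section berge.
Context (R : realType) (E S T : ptopologicalType).
Variables (K : E -> set S) (L : E -> set T).

(** [usc] and [lsc] are neighbourhood forms of the two halves of (A2), derived from them in
    [correspondence_usc] and [correspondence_lsc]. *)
Definition usc (V : ptopologicalType) (C : E -> set V) :=
  forall x (U : set V), open U -> C x `<=` U -> \forall y \near x, C y `<=` U.

Definition lsc (V : ptopologicalType) (C : E -> set V) :=
  forall x (U : set V), open U -> C x `&` U !=set0 ->
  \forall y \near x, C y `&` U !=set0.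

(** A tube lemma for a moving fibre: compactness gives one neighbourhood of [z] and an open set
    around [L (p z)] on which [P] holds, and upper semicontinuity keeps [L (p z')] inside that open
    set. The parameter space [Z] is general so that it may contain an action next to the state. *)
Lemma usc_tube (Z : topologicalType) (p : Z -> E) (z : Z) (P : Z -> T -> Prop) :
  usc L -> compact (L (p z)) -> {for z, continuous p} ->
  (forall b, L (p z) b -> \forall b' \near b & z' \near z, P z' b') ->
  \forall z' \near z, forall b, L (p z') b -> P z' b.
Proof.
move=> uL cL cp hP.
pose good (V : set Z) b := exists U, [/\ open U, U b &
  forall z' b', V z' -> U b' -> P z' b'].
(* The covering argument runs over small neighbourhoods [V] as parameters, so that a single [V]
   suits all of [L (p z)]. *)
have hV : \forall V \near powerset_filter_from (nbhs z), L (p z) `<=` good V.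
  have /compact_near_coveringP := cL.
  move=> /(_ _ (powerset_filter_from (nbhs z)) good); apply => b Lb.
  have [[U V] /= [Ub Vz] UV] := hP b Lb.
  have smallV := small_set_sub Vz.
  near=> b' W => /=.
  exists U°; split; first exact: open_interior.
    by near: b'; exact: nbhs_interior.
  move=> z' b'' Wz' /interior_subset Ub''; apply: (UV (b'', z')); split => //=.
  have WV : W `<=` V by near: W; exact: smallV.
  exact: WV.
have [V [Vz LV]] : exists V, nbhs z V /\ L (p z) `<=` good V.
  near (powerset_filter_from (nbhs z)) => V; exists V; split.
    by near: V; exact: near_small_set.
  by near: V.
pose O := \bigcup_(U in [set U | open U /\ forall z' b', V z' -> U b' -> P z' b']) U.
have oO : open O by apply: bigcup_open => U [].
have LO : L (p z) `<=` O.
  by move=> b /LV[U [oU Ub UP]]; exists U.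
have := cp _ (uL _ _ oO LO) => /= near_p.
near=> z' => b Lb.
have Vz' : V z' by near: z'.
have LO' : L (p z') `<=` O by near: z'.
by have [U [oU UP] Ub] := LO' _ Lb; exact: UP.
Unshelve. all: by end_near. Qed.

Variables (H : E -> S -> T -> R) (M : R).
Hypotheses (cK : forall x, compact (K x)) (cL : forall x, compact (L x)).
Hypotheses (K0 : forall x, K x !=set0) (L0 : forall x, L x !=set0).
Hypothesis cH : continuous (fun z : E * (S * T) => H z.1 z.2.1 z.2.2).
Hypothesis HM : forall x a b, `|H x a b| <= M.

(** A nearly optimal mixture at [x] is transported to [y] atom by atom: [lsc K] provides an
    admissible action close to each atom, and [usc L] prevents player 2 from gaining distant
    actions. The weights do not change. *)
Lemma val_lsc x c : lsc K -> usc L ->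
  c < val (K x) (L x) (H x) -> \forall y \near x, c <= val (K y) (L y) (H y).
Proof.
move=> lK uL cv; pose c' := (c + val (K x) (L x) (H x)) / 2.
have [cc' c'v] : c < c' /\ c' < val (K x) (L x) (H x) by rewrite /c'; split; lra.
have [n [w [a [w0 w1 Ka Hc]]]] := lower_mix_val (K0 x) (L0 x) (HM x) c'v.
have Hcvg y a' b : H z.1 z.2.1 z.2.2 @[z --> (y, (a', b))] --> H y a' b.
  exact: (@cH (y, (a', b))).
have step1 : \forall y \near x, forall b, L y b -> c' < \sum_i w i * H x (a i) b.
  apply: (@usc_tube E id x (fun _ b => c' < \sum_i w i * H x (a i) b)) => //.
  move=> b Lb.
  have cb : (fun b => \sum_i w i * H x (a i) b) b' @[b' --> b] -->
      \sum_i w i * H x (a i) b.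
    apply: (@continuous_sum _ _ _ (fun i b => w i * H x (a i) b)) => i.
    apply: cvgM; first exact: cvg_cst.
    apply: (@continuous_comp _ _ _ (fun b => (x, (a i, b)))
      (fun z : E * (S * T) => H z.1 z.2.1 z.2.2)); last exact: @cH.
    apply: continuous_pair_fun; first exact: cvg_cst.
    exact: continuous_pairr.
  have := cvgr_gt _ cb _ (Hc b Lb) => nb.
  by near=> b' y => /=; near: b'; exact: nb.
pose e := c' - c; have e0 : 0 < e by rewrite subr_gt0.
(* The tube is taken over pairs [(y, a')] near [(x, a i)]; lower semicontinuity of [K] then supplies
   such an [a'] in [K y]. *)
have step2 i : \forall y \near x, exists a', K y a' /\
    forall b, L y b -> H x (a i) b - e <= H y a' b.
  suff near_b b : L x b -> \forall b' \near b & z' \near (x, a i),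
      H x (a i) b' - e <= H z'.1 z'.2 b'.
    have := @usc_tube (E * S)%type fst (x, a i)
      (fun z b => H x (a i) b - e <= H z.1 z.2 b) uL (@cL x) (@cvg_fst _ _ _ _ _) near_b.
    move=> [[U V] /= [Ux Va] UV].
    have KV : K x `&` V° !=set0 by exists (a i); split => //; exact: nbhs_interior.
    have := lK x _ (@open_interior _ V) KV => near_K.
    near=> y.
    have [a' [Ka' /interior_subset Va']] : K y `&` V° !=set0 by near: y.
    exists a'; split => // b Lb; apply: (UV (y, a')) => //; split => //=.
    by near: y.
  move=> Lb.
  have e20 : 0 < e / 2 by rewrite divr_gt0.
  have /cvgrPdist_le /(_ _ e20)[[U V] /= [Ux [[V1 V2] /= [V1a V2b] V12]] UV] :=
    Hcvg x (a i) b.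
  exists (V2, U `*` V1) => /=.
    by split => //; exists (U, V1).
  move=> [b' [y a']] /= [V2b' [Uy V1a']].
  have h1 : `|H x (a i) b - H y a' b'| <= e / 2.
    by apply: (UV (y, (a', b'))); split => //; apply: (V12 (a', b')).
  have h2 : `|H x (a i) b - H x (a i) b'| <= e / 2.
    apply: (UV (x, (a i, b'))); split; first exact: nbhs_singleton.
    by apply: (V12 (a i, b')); split => //; exact: nbhs_singleton.
  by move: h1 h2; rewrite !ler_norml => /andP[? ?] /andP[? ?]; lra.
have step3 : \forall y \near x, forall i, exists a', K y a' /\
    forall b, L y b -> H x (a i) b - e <= H y a' b.
  exact: filter_forall.
near=> y.
have /choice[a' a'P] : forall i, exists a', K y a' /\
    forall b, L y b -> H x (a i) b - e <= H y a' b by near: y.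
apply: (le_val (K0 y) (L0 y) (HM y)); exists n, w, a'; split => //.
  by move=> i; case: (a'P i).
move=> b Lb.
have s1 : c' < \sum_i w i * H x (a i) b.
  by move: b Lb; near: y.
have s2 : \sum_i w i * H x (a i) b - e <= \sum_i w i * H y (a' i) b.
  rewrite lerBlDr -[e]mul1r -w1 mulr_suml -big_split/= ler_sum// => i _.
  by rewrite -mulrDr ler_wpM2l// -lerBlDr; apply: (a'P i).2.
by rewrite (lt_le_trans _ s2)// ltrBrDr /e addrC subrK.
Unshelve. all: by end_near. Qed.

End berge.

(** Lower semicontinuity of the value and of the value of the exchanged game, its opposite by
    [val_swap]. *)
Lemma val_continuous (R : realType) (E S T : ptopologicalType)
    (K : E -> set S) (L : E -> set T) (H : E -> S -> T -> R) (M : R) :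
  (forall x, compact (K x)) -> (forall x, compact (L x)) ->
  (forall x, K x !=set0) -> (forall x, L x !=set0) ->
  lsc K -> usc K -> lsc L -> usc L ->
  continuous (fun z : E * (S * T) => H z.1 z.2.1 z.2.2) ->
  (forall x a b, `|H x a b| <= M) ->
  continuous (fun x => val (K x) (L x) (H x)).
Proof.
move=> cK cL K0 L0 lK uK lL uL cH HM x.
have cHx y : continuous (fun z : S * T => H y z.1 z.2).
  move=> z; apply: (@continuous_comp _ _ _ (fun z : S * T => (y, z))
    (fun z : E * (S * T) => H z.1 z.2.1 z.2.2)); last exact: @cH.
  exact: continuous_pairr.
have cH' : continuous (fun z : E * (T * S) => swap_payoff (H z.1) z.2.1 z.2.2).
  move=> [y [b a]]; rewrite /swap_payoff/=; apply: cvgN.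
  apply: (@continuous_comp _ _ _ (fun z : E * (T * S) => (z.1, (z.2.2, z.2.1)))
    (fun z : E * (S * T) => H z.1 z.2.1 z.2.2)); last exact: @cH.
  apply: continuous_pair_fun; first exact: cvg_fst.
  apply: continuous_pair_fun.
    by apply: (@cvg_comp _ _ _ snd snd); [exact: cvg_snd|exact: cvg_snd].
  by apply: (@cvg_comp _ _ _ snd fst); [exact: cvg_snd|exact: cvg_fst].
apply/cvgrPdist_le => e e0.
have h1 := @val_lsc R E S T K L H M cL K0 L0 cH HM x (val (K x) (L x) (H x) - e) lK uL.
have h2 := @val_lsc R E T S L K (fun x => swap_payoff (H x)) M cK L0 K0 cH'
  (fun x => swap_payoff_le (HM x)) x (val (L x) (K x) (swap_payoff (H x)) - e) lL uK.
have {}h1 := h1 ltac:(by rewrite gtrBl); have {}h2 := h2 ltac:(by rewrite gtrBl).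
near=> y.
have v1 : val (K x) (L x) (H x) - e <= val (K y) (L y) (H y) by near: y.
have v2 : val (L x) (K x) (swap_payoff (H x)) - e <=
  val (L y) (K y) (swap_payoff (H y)) by near: y.
move: v2; rewrite !(val_swap (cK _) (cL _) (K0 _) (L0 _) (cHx _) (HM _)) => v2.
by rewrite ler_norml; apply/andP; split; lra.
Unshelve. all: by end_near. Qed.

(** * Successive maximization over weakly compact sets of probabilities *)

Section lexicographic.
Context (R : realType) d (S : borelSpaceType R d).
Implicit Types (P : probability S R) (mu : nat -> probability S R)
  (O : set (probability S R)) (G : probability S R -> R).

(** Applied to [f] and [- f], this places the integral against [P] between the lower and upper
    limits along [mu]. Maximization uses nothing more about the topology. *)
Definition weak_cluster mu P := forall f c, bcont f ->
  (\forall n \near \oo, c <= \int[mu n]_x f x) -> c <= \int[P]_x f x.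

Definition weak_compact O := forall mu, (forall n, O (mu n)) ->
  exists P, O P /\ weak_cluster mu P.

Definition weak_usc G := forall mu P c, weak_cluster mu P ->
  (\forall n \near \oo, c <= G (mu n)) -> c <= G P.

Definition is_max O G v := (exists P, O P /\ G P = v) /\ forall P, O P -> G P <= v.

Lemma weak_usc_int f : bcont f -> weak_usc (fun P => \int[P]_x f x).
Proof. by move=> bf mu P c; apply. Qed.

Lemma weak_compact_ge O G g : weak_compact O -> weak_usc G ->
  weak_compact [set P | O P /\ g <= G P].
Proof.
move=> cO uG mu Omu.
have [P [OP mP]] := cO mu (fun n => (Omu n).1).
exists P; split => //; split => //.
by apply: uG mP _; apply: nearW => n; exact: (Omu n).2.
Qed.

(* The maximum of F + k G over O, minus k max G, decreases to the maximum of F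
   over the maximizers of G. *)
Lemma penalty O G g f (m : nat -> R) : weak_compact O -> weak_usc G -> bcont f ->
  is_max O G g ->
  (forall k, is_max O (fun P => \int[P]_x f x + k%:R * G P) (m k)) ->
  exists v, is_max [set P | O P /\ g <= G P] (fun P => \int[P]_x f x) v /\
    m k - k%:R * g @[k --> \oo] --> v.
Proof.
move=> cO uG bf [[Q0 [OQ0 GQ0]] Gg] mmax.
have /choice[mu muP] k := (mmax k).1.
have [P [OP mP]] := cO mu (fun n => (muP n).1).
have [_ [M fM]] := bf.
have FM (Q : probability S R) : `|\int[Q]_x f x| <= M by apply: prob_int_norm => //; exact: bcont_bmeas.
pose a k := m k - k%:R * g.
have a_ge k Q : O Q -> g <= G Q -> \int[Q]_x f x <= a k.
  move=> OQ gQ; rewrite /a lerBrDr (le_trans _ ((mmax k).2 Q OQ))//.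
  by rewrite lerD2l ler_wpM2l.
have F_ge k : a k <= \int[mu k]_x f x.
  have [Ok mk] := muP k; rewrite /a -mk lerBlDr lerD2l ler_wpM2l//.
  exact: Gg.
(* Comparing the maximizer with [Q0], where [G] equals [g], costs at most [2 * M] in [f]; the weight
   [k.+1] therefore forces [G] to within [2 * M / k.+1] of its maximum. *)
have G_ge k : g - (2 * M) / k.+1%:R <= G (mu k.+1).
  have [Ok mk] := muP k.+1.
  rewrite lerBlDr -lerBlDl ler_pdivlMr ?ltr0n//.
  have := a_ge k.+1 Q0 OQ0; rewrite GQ0 lexx => /(_ isT).
  rewrite /a -mk => h.
  have := FM Q0; have := FM (mu k.+1); rewrite !ler_norml => /andP[_ h1] /andP[h2 _].
  rewrite mulrBl [g * _]mulrC [G _ * _]mulrC; lra.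
have GP : g <= G P.
  apply/ler_addgt0Pr => e e0; rewrite -lerBlDr; apply: (uG mu) => //.
  have M0 : 0 <= M by apply: le_trans (FM Q0).
  have M1 : 0 < 2 * M + 1 by rewrite ltr_wpDl// mulr_ge0.
  have [k _ kP] := near_infty_natSinv_lt (PosNum (divr_gt0 e0 M1)).
  exists k.+1 => // -[//|n] /= kn.
  apply: le_trans (G_ge n); rewrite lerD2l lerN2.
  have := kP n kn => /= /ltW; rewrite ler_pdivlMr// mulrC => /(le_trans _); apply.
  by rewrite ler_wpM2r ?invr_ge0// lerDl.
exists (\int[P]_x f x); split.
  split; first by exists P.
  move=> Q [OQ gQ]; apply: mP => //; apply: nearW => k.
  exact: le_trans (a_ge k Q OQ gQ) (F_ge k).
(* The maximizer for [k.+1] is a competitor for [k], so [m] increases by at most its value of [G],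
   itself at most [g]. *)
have a_ni : nonincreasing_seq a.
  apply/nonincreasing_seqP => k; rewrite /a.
  have [Ok mk] := muP k.+1.
  rewrite -mk; have := (mmax k).2 _ Ok.
  rewrite -natr1 !mulrDl !mul1r; have := Gg _ Ok; lra.
have lbP : lbound (range a) (\int[P]_x f x) by move=> _ [k _ <-]; exact: a_ge.
have lb : has_lbound (range a) by exists (\int[P]_x f x).
(* Each [a k] bounds the integral from above, as [P] maximizes [G]; conversely [a k] is at most the
   integral against [mu k], and this bound by the infimum passes to the cluster point. *)
have -> : \int[P]_x f x = inf (range a).
  apply/eqP; rewrite eq_le; apply/andP; split.
    by apply: lb_le_inf lbP; exists (a 0); exists 0.
  apply: mP => //; apply: nearW => k; apply: le_trans (F_ge k).
  by apply: (ge_inf lb); exists k.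
exact: nonincreasing_cvgn.
Qed.

End lexicographic.

(** * Families of games indexed by the state and the risk parameter *)

Section payoff.
Context (R : realType) dE dA dB (E : borelSpaceType R dE)
  (A : borelSpaceType R dA) (B : borelSpaceType R dB).

(* Continuity in the risk parameter is asked uniformly in the other arguments,
   so that continuity in the state and in the parameter may be studied
   separately. *)
Definition payoff (H : E -> R -> A -> B -> R) :=
  [/\ forall gamma, continuous (fun z : E * (A * B) => H z.1 gamma z.2.1 z.2.2),
      forall gamma, exists M : R, forall x a b, `|H x gamma a b| <= M &
      forall gamma e, 0 < e -> \forall gamma' \near gamma,
        forall x a b, `|H x gamma' a b - H x gamma a b| <= e].

Variables (K : E -> set A) (L : E -> set B).
Hypotheses (cK : forall x, compact (K x)) (cL : forall x, compact (L x)).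
Hypotheses (K0 : forall x, K x !=set0) (L0 : forall x, L x !=set0).
Hypotheses (lK : lsc K) (uK : usc K) (lL : lsc L) (uL : usc L).

Definition Val (H : E -> R -> A -> B -> R) (z : E * R) :=
  val (K z.1) (L z.1) (H z.1 z.2).

Lemma Val_near H gamma e : payoff H -> 0 < e ->
  \forall gamma' \near gamma, forall x, `|Val H (x, gamma') - Val H (x, gamma)| <= e.
Proof.
move=> [_ Hb He] e0; have := He gamma e e0; apply: filterS => gamma' h x.
have [M HM] := Hb gamma; have [M' HM'] := Hb gamma'.
have h1 := @val_le_val R A B (K x) (L x) (H x gamma') (H x gamma) M' M e
  (K0 x) (L0 x) (HM' x) (HM x).
have h2 := @val_le_val R A B (K x) (L x) (H x gamma) (H x gamma') M M' e
  (K0 x) (L0 x) (HM x) (HM' x).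
rewrite /Val/= ler_distl; apply/andP; split.
  rewrite lerBlDr; apply: h2 => a b _ _; have := h x a b.
  by rewrite ler_distl => /andP[]; lra.
apply: h1 => a b _ _; have := h x a b.
by rewrite ler_distl => /andP[]; lra.
Qed.

Lemma Val_continuous_state H gamma : payoff H -> continuous (fun x => Val H (x, gamma)).
Proof.
move=> [Hc Hb _]; have [M HM] := Hb gamma.
by apply: (@val_continuous R E A B K L (fun x => H x gamma) M) => // x; exact: Hc.
Qed.

Lemma Val_continuous H : payoff H -> continuous (Val H).
Proof.
move=> pH [x gamma]; apply/cvgrPdist_le => e e0.
have e20 : 0 < e / 2 by rewrite divr_gt0.
have c1 : Val H (y, gamma) @[y --> x] --> Val H (x, gamma).
  exact: Val_continuous_state.
have /cvgrPdist_le /(_ _ e20) n1 := c1.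
have n2 := Val_near gamma pH e20.
exists ([set y | `|Val H (x, gamma) - Val H (y, gamma)| <= e / 2],
  [set gamma' | forall y, `|Val H (y, gamma') - Val H (y, gamma)| <= e / 2]) => //=.
move=> [y gamma'] /= [h1 /(_ y) h2].
by move: h1 h2; rewrite !ler_norml => /andP[? ?] /andP[? ?]; apply/andP; split; lra.
Qed.

Lemma measurable_Val H : payoff H -> measurable_fun setT (Val H).
Proof. by move=> pH; apply: measurable_continuous_prod_real; exact: Val_continuous. Qed.

Lemma payoff_section H x gamma : payoff H ->
  continuous (fun z : A * B => H x gamma z.1 z.2).
Proof.
move=> [Hc _ _] z; apply: (@continuous_comp _ _ _ (fun z : A * B => (x, z))
  (fun z : E * (A * B) => H z.1 gamma z.2.1 z.2.2)); last exact: Hc.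
exact: continuous_pairr.
Qed.

Lemma payoff_bcont H x gamma b : payoff H -> bcont (fun a => H x gamma a b).
Proof.
move=> pH; have [_ Hb _] := pH; have [M HM] := Hb gamma.
split; last by exists M.
move=> a; apply: (@continuous_comp _ _ _ (fun a => (a, b))
  (fun z : A * B => H x gamma z.1 z.2)); last exact: payoff_section.
exact: continuous_pairl.
Qed.

Lemma payoff_affine H (c : R) (psi : A -> R) : payoff H -> bcont psi ->
  payoff (fun x gamma a b => psi a + c * H x gamma a b).
Proof.
move=> [Hc Hb He] [cpsi [N psiN]]; split.
- move=> gamma z; apply: cvgD.
    apply: (@continuous_comp _ _ _ (fun z : E * (A * B) => z.2.1) psi); last exact: cpsi.
    by apply: (@cvg_comp _ _ _ snd fst); [exact: cvg_snd|exact: cvg_fst].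
  by apply: cvgM; [exact: cvg_cst|exact: Hc].
- move=> gamma; have [M HM] := Hb gamma; exists (N + `|c| * M) => x a b.
  by rewrite (le_trans (ler_normD _ _))// lerD// normrM ler_wpM2l.
- move=> gamma e e0; have c0 : 0 < `|c| + 1 by rewrite ltr_wpDl.
  have := He gamma _ (divr_gt0 e0 c0); apply: filterS => gamma' h x a b.
  rewrite opprD addrACA subrr add0r -mulrBr normrM.
  have := h x a b; rewrite ler_pdivlMr// mulrC; apply: le_trans.
  by rewrite ler_wpM2r// lerDl.
Qed.

(** Were [c] above the value, a finite mixture of player 2 would hold every [a] of [K] below some
    [d < c]. Integrating over [P] gives at most [d], the hypothesis at least [c]; only a finite sum
    is exchanged with the integral. *)
Lemma le_Val_prob H z c (P : probability A R) : payoff H -> P (K z.1) = 1%E ->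
  (forall b, L z.1 b -> c <= \int[P]_a H z.1 z.2 a b) -> c <= Val H z.
Proof.
move=> pH PK hc; rewrite leNgt; apply/negP => Vc.
have [_ Hb _] := pH; have [M HM] := Hb z.2.
have mK := borel_compact_measurable (@cK z.1).
pose d := (Val H z + c) / 2.
have [Vd dc] : Val H z < d /\ d < c by rewrite /d; split; lra.
have [n [w [b [w0 w1 Lb Hd]]]] := upper_mix_val (@cK z.1) (@cL z.1) (K0 z.1) (L0 z.1)
  (payoff_section (x := z.1) (gamma := z.2) pH) (HM z.1) Vd.
have bH i : bmeas (fun a => H z.1 z.2 a (b i)).
  exact/bcont_bmeas/payoff_bcont.
have bsum (s : seq 'I_n) : bmeas (fun a => \sum_(i <- s) w i * H z.1 z.2 a (b i)) /\
   \int[P]_a (\sum_(i <- s) w i * H z.1 z.2 a (b i)) =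
   \sum_(i <- s) w i * \int[P]_a H z.1 z.2 a (b i).
  elim: s => [|i s [ih1 ih2]].
    have -> : (fun a => \sum_(i <- [::]) w i * H z.1 z.2 a (b i)) = cst 0.
      by apply/funext => a; rewrite big_nil.
    by split; [exact: bmeas_cst|rewrite big_nil prob_int_cst].
  have -> : (fun a => \sum_(i <- i :: s) w i * H z.1 z.2 a (b i)) = (fun a =>
      w i * H z.1 z.2 a (b i) + \sum_(i <- s) w i * H z.1 z.2 a (b i)).
    by apply/funext => a; rewrite big_cons.
  split; first by apply: bmeasD => //; exact: bmeasZ.
  rewrite prob_intD//; last exact: bmeasZ.
  by rewrite big_cons ih2 prob_intZ.
have [b1 b2] := bsum (index_enum _).
have : c <= \sum_i w i * \int[P]_a H z.1 z.2 a (b i).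
  rewrite -[c]mul1r -w1 mulr_suml ler_sum// => i _.
  by rewrite ler_wpM2l// hc.
rewrite -b2; apply/negP; rewrite -ltNge; apply: le_lt_trans dc.
apply: (prob_int_le_cst_on mK) => // a Ka.
have := Hd a Ka; rewrite ltrNl -sumrN => /ltW; apply: le_trans.
by apply: ler_sum => i _; rewrite /swap_payoff mulrN opprK.
Qed.

End payoff.

Lemma payoff_swap (R : realType) dE dA dB (E : borelSpaceType R dE)
    (A : borelSpaceType R dA) (B : borelSpaceType R dB)
    (H : E -> R -> A -> B -> R) : payoff H ->
  payoff (fun x gamma => swap_payoff (H x gamma)).
Proof.
move=> [Hc Hb He]; split.
- move=> gamma [y [b a]]; rewrite /swap_payoff/=; apply: cvgN.
  apply: (@continuous_comp _ _ _ (fun z : E * (B * A) => (z.1, (z.2.2, z.2.1)))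
    (fun z : E * (A * B) => H z.1 gamma z.2.1 z.2.2)); last exact: Hc.
  apply: continuous_pair_fun; first exact: cvg_fst.
  apply: continuous_pair_fun.
    by apply: (@cvg_comp _ _ _ snd snd); [exact: cvg_snd|exact: cvg_snd].
  by apply: (@cvg_comp _ _ _ snd fst); [exact: cvg_snd|exact: cvg_fst].
- move=> gamma; have [M HM] := Hb gamma; exists M => x b a.
  by rewrite /swap_payoff normrN.
- move=> gamma e e0; have := He gamma e e0; apply: filterS => gamma' h x b a.
  by rewrite /swap_payoff -opprD normrN.
Qed.

Lemma payoff_bcontr (R : realType) dE dA dB (E : borelSpaceType R dE)
    (A : borelSpaceType R dA) (B : borelSpaceType R dB)
    (H : E -> R -> A -> B -> R) x gamma a : payoff H -> bcont (H x gamma a).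
Proof.
move=> /payoff_swap /(payoff_bcont x gamma a) /bcontN.
congr bcont; apply/funext => b; exact: opprK.
Qed.

(** * Measurable selection of optimal mixed actions *)

Section selection.
Context (R : realType) dE dA dB (E : borelSpaceType R dE)
  (A : borelSpaceType R dA) (B : borelSpaceType R dB).
Variables (K : E -> set A) (L : E -> set B).
Hypotheses (cK : forall x, compact (K x)) (cL : forall x, compact (L x)).
Hypotheses (K0 : forall x, K x !=set0) (L0 : forall x, L x !=set0).
Hypotheses (lK : lsc K) (uK : usc K) (lL : lsc L) (uL : usc L).
Variable H : E -> R -> A -> B -> R.
Hypothesis pH : payoff H.

Let Oall (z : E * R) : set (probability A R) := [set P | P (K z.1) = 1%E].

Let guarantee (z : E * R) (P : probability A R) : R :=
  inf [set \int[P]_a H z.1 z.2 a b | b in L z.1].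

Let bH z b : bcont (fun a => H z.1 z.2 a b).
Proof. exact: payoff_bcont. Qed.

Let guarantee_le z (P : probability A R) b : L z.1 b -> guarantee z P <= \int[P]_a H z.1 z.2 a b.
Proof.
move=> Lb; have [_ Hb _] := pH; have [M HM] := Hb z.2.
apply: ge_inf; last by exists b.
exists (- M) => _ [b' _ <-].
have : `|\int[P]_a H z.1 z.2 a b'| <= M.
  by apply: prob_int_norm => //; exact: bcont_bmeas.
by rewrite ler_norml => /andP[].
Qed.

Let le_guarantee z (P : probability A R) c : (forall b, L z.1 b -> c <= \int[P]_a H z.1 z.2 a b) ->
  c <= guarantee z P.
Proof.
move=> h; apply: lb_le_inf; last by move=> _ [b Lb <-]; exact: h.
by have [b Lb] := L0 z.1; exists (\int[P]_a H z.1 z.2 a b); exists b.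
Qed.

Let weak_usc_guarantee z : weak_usc (guarantee z).
Proof.
move=> mu P c mP h; apply: le_guarantee => b Lb; apply: mP; first exact: bH.
by apply: filterS h => n /le_trans; apply; exact: guarantee_le.
Qed.

Let weak_compact_Oall z : weak_compact (Oall z).
Proof. by move=> mu Omu; have [P PP] := prob_cluster (@cK z.1) Omu; exists P. Qed.

Let penalized (psi : A -> R) (k : nat) : E -> R -> A -> B -> R :=
  fun x gamma a b => psi a + k%:R * H x gamma a b.

(** As [psi] does not depend on [b], it comes out of the infimum over player 2: the value of the
    penalized game is the maximum demanded by [penalty]. *)
Let is_max_Val z psi k : bcont psi ->
  is_max (Oall z) (fun P => \int[P]_a psi a + k%:R * guarantee z P)
    (Val K L (penalized psi k) z).
Proof.
move=> bpsi.
have pp : payoff (penalized psi k) by exact: payoff_affine.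
have intE (P : probability A R) b : \int[P]_a penalized psi k z.1 z.2 a b =
    \int[P]_a psi a + k%:R * \int[P]_a H z.1 z.2 a b.
  rewrite prob_intD; last 2 first.
  - exact: bcont_bmeas.
  - by apply: bmeasZ; exact: bcont_bmeas.
  by rewrite prob_intZ//; exact: bcont_bmeas.
have ub P : Oall z P ->
    \int[P]_a psi a + k%:R * guarantee z P <= Val K L (penalized psi k) z.
  move=> OP; apply: (le_Val_prob cK cL K0 L0 pp OP) => b Lb.
  by rewrite intE lerD2l ler_wpM2l// guarantee_le.
split => //.
have [_ Hb _] := pp; have [M HM] := Hb z.2.
have [P [PK Pb]] := prob_optimal (@cK z.1) (K0 z.1) (L0 z.1)
  (payoff_section (x := z.1) (gamma := z.2) pp) (HM z.1).
exists P; split => //; apply/eqP; rewrite eq_le ub//=.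
(* For [k = 0] the guarantee disappears and any [b] gives the bound; for positive [k], division by
   it brings the bound under the infimum. *)
rewrite -lerBlDl; case: k pp intE Pb {ub HM Hb} => [|k] pp intE Pb.
  have [b Lb] := L0 z.1; have := Pb b Lb; rewrite intE !mul0r addr0.
  by rewrite subr_le0.
rewrite mulrC -ler_pdivrMr ?ltr0n//; apply: le_guarantee => b Lb.
by rewrite ler_pdivrMr ?ltr0n// mulrC lerBlDl -intE; exact: Pb.
Qed.

Let is_max_Val0 z : is_max (Oall z) (guarantee z) (Val K L H z).
Proof.
have [_ Hb _] := pH; have [M HM] := Hb z.2.
have ub P : Oall z P -> guarantee z P <= Val K L H z.
  move=> OP; apply: (le_Val_prob cK cL K0 L0 pH OP) => b Lb.
  exact: guarantee_le.
split => //.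
have [P [PK Pb]] := prob_optimal (@cK z.1) (K0 z.1) (L0 z.1)
  (payoff_section (x := z.1) (gamma := z.2) pH) (HM z.1).
by exists P; split => //; apply/eqP; rewrite eq_le ub//=; exact: le_guarantee.
Qed.

Variable g : nat -> A -> R.
Hypothesis bg : forall n, bcont (g n).

(** [s j psi z] is the maximum of the integral of [psi] over [O j z]. Writing it as a limit makes
    its measurability in [z] an induction that never mentions the set [O j z]. *)
Let s := fix s (j : nat) (psi : A -> R) (z : E * R) : R :=
  if j is j'.+1 then
    limn (fun k => s j' (fun a => psi a + k%:R * g j' a) z - k%:R * s j' (g j') z)
  else limn (fun k => Val K L (penalized psi k) z - k%:R * Val K L H z).

(** The maximizers of the guarantee, then of the integrals of [g 0], ..., [g j.-1] in turn; at level
    0, of the guarantee alone. *)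
Let O := fix O (j : nat) (z : E * R) : set (probability A R) :=
  if j is j'.+1 then [set P | O j' z P /\ s j' (g j') z <= \int[P]_a g j' a]
  else [set P | Oall z P /\ Val K L H z <= guarantee z P].

(** Each level is [penalty] over the preceding set, with [G] the guarantee at the bottom and the
    integral of [g j] above. The induction is on all [psi] together because the step uses
    [psi + k g j]. *)
Let sO j : forall psi, bcont psi ->
  measurable_fun setT (s j psi) /\
  forall z, weak_compact (O j z) /\
    is_max (O j z) (fun P => \int[P]_a psi a) (s j psi z).
Proof.
elim: j => [|j ih] psi bpsi.
  have pen z := penalty (@weak_compact_Oall z) (@weak_usc_guarantee z) bpsi
    (is_max_Val0 z) (fun k => is_max_Val z k bpsi).
  have sE z : is_max (O 0 z) (fun P => \int[P]_a psi a) (s 0 psi z) /\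
      Val K L (penalized psi k) z - k%:R * Val K L H z @[k --> \oo] --> s 0 psi z.
    have [v [vm vl]] := pen z.
    by have -> : s 0 psi z = v by exact/cvg_lim.
  split; last first.
    move=> z; split; last exact: (sE z).1.
    apply: weak_compact_ge; first exact: weak_compact_Oall.
    exact: weak_usc_guarantee.
  apply: (measurable_fun_cvg (h := fun k z =>
      Val K L (penalized psi k) z - k%:R * Val K L H z)).
    move=> k; apply: measurable_funB.
      by apply: measurable_Val => //; exact: payoff_affine.
    by apply: measurable_funM => //; exact: measurable_Val.
  by move=> z _; exact: (sE z).2.
have bk k : bcont (fun a => psi a + k%:R * g j a).
  by apply: bcontD => //; exact: bcontZ.
have cO z : weak_compact (O j z) by have [_ /(_ z)[]] := ih _ bpsi.
have maxk z k : is_max (O j z) (fun P => \int[P]_a psi a + k%:R * \int[P]_a g j a)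
    (s j (fun a => psi a + k%:R * g j a) z).
  have [_ /(_ z)[_ hk]] := ih _ (bk k).
  rewrite (_ : (fun P => _) =
    (fun P : probability A R => \int[P]_a (psi a + k%:R * g j a)))//.
  apply/funext => P; rewrite prob_intD; last 2 first.
  - exact: bcont_bmeas.
  - by apply: bmeasZ; exact: bcont_bmeas.
  by rewrite prob_intZ//; exact: bcont_bmeas.
have maxg z : is_max (O j z) (fun P => \int[P]_a g j a) (s j (g j) z).
  by have [_ /(_ z)[]] := ih _ (bg j).
have pen z := penalty (cO z) (weak_usc_int (bg j)) bpsi (maxg z) (maxk z).
have sE z : is_max (O j.+1 z) (fun P => \int[P]_a psi a) (s j.+1 psi z) /\
    s j (fun a => psi a + k%:R * g j a) z - k%:R * s j (g j) z @[k --> \oo]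
      --> s j.+1 psi z.
  have [v [vm vl]] := pen z.
  by have -> : s j.+1 psi z = v by exact/cvg_lim.
split; last first.
  move=> z; split; last exact: (sE z).1.
  by apply: weak_compact_ge => //; exact: weak_usc_int.
apply: (measurable_fun_cvg (h := fun k z =>
    s j (fun a => psi a + k%:R * g j a) z - k%:R * s j (g j) z)).
  move=> k; apply: measurable_funB; first by have [] := ih _ (bk k).
  by apply: measurable_funM => //; have [] := ih _ (bg j).
by move=> z _; exact: (sE z).2.
Qed.

Let O_mono z i j P : (i <= j)%N -> O j z P -> O i z P.
Proof.
move=> ij; rewrite -(subnK ij); elim: (j - i)%N => [//|n ih] [+ _].
exact: ih.
Qed.

(** The sets [O j z] decrease and are nonempty. A cluster point of a sequence with its n-th term in
    [O n z] inherits each constraint, which holds from some index on. *)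
Let lexi_optimal z : exists P, forall j, O j z P.
Proof.
have /choice[mu muP] j : exists P, O j z P.
  by have [_ /(_ z)[_ [[P [OP _]] _]]] := sO j (bg j); exists P.
have [_ /(_ z)[cO0 _]] := sO 0 (bg 0).
have [P [P0 mP]] := cO0 mu (fun n => O_mono (leq0n n) (muP n)).
exists P; elim=> [//|j ih]; split => //; apply: mP => //.
by exists j.+1 => // n jn; have [] := O_mono jn (muP n).
Qed.

(** Although [mu] is obtained by choice, lying in [O n z] and in [O n.+1 z] forces the integral of
    [g n] to equal [s n (g n) z], which is measurable. *)
Lemma optimal_selection_family : exists mu : E * R -> probability A R,
  (forall n, measurable_fun setT (fun z => \int[mu z]_a g n a)) /\
  forall z, mu z (K z.1) = 1%E /\
    forall b, L z.1 b -> Val K L H z <= \int[mu z]_a H z.1 z.2 a b.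
Proof.
have /choice[mu muP] := lexi_optimal.
exists mu; split => [n|z].
  have [ms sm] := sO n (bg n).
  rewrite (_ : (fun z => _) = s n (g n))//; apply/funext => z.
  apply/eqP; rewrite eq_le; apply/andP; split.
    by have [_ [_ h]] := sm z; exact: h (muP z n).
  by have [] := muP z n.+1.
have [Oz Vz] := muP z 0; split => // b Lb.
by rewrite (le_trans Vz)// guarantee_le.
Qed.

End selection.

Lemma optimal_selection (R : realType) dE dA dB (E : borelSpaceType R dE)
    (A : borelSpaceType R dA) (B : borelSpaceType R dB)
    (K : E -> set A) (L : E -> set B) (H : E -> R -> A -> B -> R) :
  (forall x, compact (K x)) -> (forall x, compact (L x)) ->
  (forall x, K x !=set0) -> (forall x, L x !=set0) ->
  lsc K -> usc K -> lsc L -> usc L -> payoff H ->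
  exists mu : E * R -> probability A R,
    measurable_fun setT (mu : E * R -> borel_prob A) /\
    forall z, mu z (K z.1) = 1%E /\
      forall b, L z.1 b -> Val K L H z <= \int[mu z]_a H z.1 z.2 a b.
Proof.
move=> cK cL K0 L0 lK uK lL uL pH.
have [g [bg gP]] := @measurable_borel_prob_family R dA A.
have [mu [mmu muP]] := optimal_selection_family cK cL K0 L0 lK uK lL uL pH bg.
by exists mu; split => //; exact: gP.
Qed.

(** * Integration against mixtures, images and products of measures *)

Section integral_mixture.
Context d d' (X : measurableType d) (Y : measurableType d') (R : realType).
Variables (rho : {measure set X -> \bar R}) (k : X -> {measure set Y -> \bar R})
  (m : {measure set Y -> \bar R}).
Hypothesis mk : forall U, measurable U -> measurable_fun setT (k ^~ U).
Hypothesis mE : forall U, measurable U -> m U = (\int[rho]_x k x U)%E.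
Local Open Scope ereal_scope.
Import HBNNSimple.

Let integral_mixture_nnsfun (h : {nnsfun Y >-> R}) :
  \int[m]_y (h y)%:E = \int[rho]_x \int[k x]_y (h y)%:E.
Proof.
under [RHS]eq_integral do rewrite integralT_nnsfun sintegralE.
rewrite integralT_nnsfun sintegralE ge0_integral_fsum//; last 2 first.
- move=> r; apply: emeasurable_funM; first exact: measurable_cst.
  exact: mk.
- by move=> r x _; apply: (mulemu_ge0 (fun r => h @^-1` [set r])); exact: preimage_nnfun0.
apply: eq_fsbigr => r _; rewrite mE//.
have [r0|r0] := leP 0%R r; first by rewrite ge0_integralZl//; exact: mk.
rewrite preimage_nnfun0// integral0_eq ?mule0; last by move=> x _; rewrite measure0.
by rewrite integral0_eq// => x _; rewrite measure0 mule0.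
Qed.

(** Simple functions and monotone convergence. It serves composed kernels, stage laws, image
    measures and [mixed_tilted] alike. *)
Lemma integral_mixture (f : Y -> \bar R) : measurable_fun setT f ->
  (forall y, 0 <= f y) -> \int[m]_y f y = \int[rho]_x \int[k x]_y f y.
Proof.
move=> mf f0; pose h := nnsfun_approx measurableT mf.
have hf y : (h n y)%:E @[n --> \oo] --> f y by exact: cvg_nnsfun_approx.
have hE y : f y = limn (fun n => (h n y)%:E) by apply/esym/cvg_lim => //; exact: hf.
have mh n : measurable_fun setT (EFin \o h n) by exact/measurable_EFinP.
have h0 n y : 0 <= (h n y)%:E by rewrite lee_fin.
have ndh y : {homo (fun n => (h n y)%:E) : n n' / (n <= n')%N >-> n <= n'}.
  by move=> n n' nn'; rewrite lee_fin; exact/lefP/nd_nnsfun_approx.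
under eq_integral do rewrite hE.
rewrite monotone_convergence//.
under eq_fun do rewrite integral_mixture_nnsfun.
rewrite -monotone_convergence//.
- apply: eq_integral => x _; under [RHS]eq_integral do rewrite hE.
  by rewrite monotone_convergence.
- by move=> n; exact: (measurable_fun_integral_kernel mk (h0 n) (mh n)).
- by move=> n x _; exact: integral_ge0.
- move=> x _ n n' nn'; apply: ge0_le_integral => //; do ?exact: mh.
  by move=> y _; exact: ndh.
Qed.

End integral_mixture.

(** The image measure is the mixture of the Dirac measures at [phi x]. *)
Lemma integral_image (R : realType) d d' (X : measurableType d)
    (Y : measurableType d') (mu : {measure set X -> \bar R})
    (m : {measure set Y -> \bar R}) (phi : X -> Y) (f : Y -> \bar R) :
  measurable_fun setT phi ->
  (forall U, measurable U -> m U = mu (phi @^-1` U)) ->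
  measurable_fun setT f -> (forall y, (0 <= f y)%E) ->
  (\int[m]_y f y = \int[mu]_x f (phi x))%E.
Proof.
move=> mphi mE mf f0.
have mU U : measurable U -> measurable (phi @^-1` U).
  by move=> mU; rewrite -[X in measurable X]setTI; exact: mphi.
rewrite (@integral_mixture _ _ _ _ R mu (fun x => \d_(phi x))) //.
- by apply: eq_integral => x _; rewrite integral_dirac// diracT mul1e.
- move=> U mU'; rewrite (_ : (fun x => _) = EFin \o \1_(phi @^-1` U)).
    by apply/measurable_EFinP; apply: measurable_indic; exact: mU.
  by apply/funext => x; rewrite /= diracE indicE.
- move=> U mU'; transitivity (\int[mu]_x (\1_(phi @^-1` U) x)%:E)%E.
    by rewrite integral_indic ?setIT ?mE//; exact: mU.
  by apply: eq_integral => x _; rewrite /= diracE indicE.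
Qed.

Section product_bounds.
Context (R : realType) d1 d2 (A : measurableType d1) (B : measurableType d2).
Variables (P : probability A R) (Q : probability B R) (h : A * B -> R) (M : R).
Hypotheses (mh : measurable_fun setT h) (h0 : forall z, 0 <= h z)
  (hM : forall z, h z <= M).

Let mhE : measurable_fun setT (EFin \o h).
Proof. exact/measurable_EFinP. Qed.

Let h0E z : (0 <= (EFin \o h) z)%E.
Proof. by rewrite lee_fin. Qed.

Let bmeasl b : bmeas (fun a => h (a, b)).
Proof.
split; first by apply: measurableT_comp mh _; exact: pair2_measurable.
by exists M => a; rewrite ger0_norm.
Qed.

Let bmeasr a : bmeas (fun b => h (a, b)).
Proof.
split; first by apply: measurableT_comp mh _; exact: pair1_measurable.
by exists M => b; rewrite ger0_norm.
Qed.

Let bound (F : R) : 0 <= F <= M -> `|F| <= M.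
Proof. by move=> /andP[? ?]; rewrite ger0_norm. Qed.

Let bmeas_intl : bmeas (fun b => \int[P]_a h (a, b)).
Proof.
split; last first.
  exists M => b; apply: prob_int_norm => //.
  by move=> a; rewrite ger0_norm.
apply/measurable_EFinP; rewrite (_ : _ \o _ = fubini_G P (EFin \o h)).
  exact: measurable_fun_fubini_tonelli_G.
by apply/funext => b; rewrite /= prob_int_EFin.
Qed.

Let bmeas_intr : bmeas (fun a => \int[Q]_b h (a, b)).
Proof.
split; last first.
  exists M => b; apply: prob_int_norm => //.
  by move=> a; rewrite ger0_norm.
apply/measurable_EFinP; rewrite (_ : _ \o _ = fubini_F Q (EFin \o h)).
  exact: measurable_fun_fubini_tonelli_F.
by apply/funext => b; rewrite /= prob_int_EFin.
Qed.

(** Tonelli in the order that leaves outermost the action over which the bound is assumed;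
    [product_le] uses the other order. *)
Lemma product_ge (L : set B) c : measurable L -> Q L = 1%E ->
  (forall b, L b -> c <= \int[P]_a h (a, b)) ->
  (c%:E <= \int[P \x Q]_z (h z)%:E)%E.
Proof.
move=> mL QL ch; rewrite (fubini_tonelli2 (m1 := P) (m2 := Q) (EFin \o h) mhE h0E).
rewrite (_ : (\int[Q]_y _)%E = (\int[Q]_b \int[P]_a h (a, b))%:E).
  by rewrite lee_fin; exact: (prob_int_ge_on mL QL).
by rewrite prob_int_EFin//; apply: eq_integral => b _; rewrite prob_int_EFin.
Qed.

Lemma product_le (K : set A) c : measurable K -> P K = 1%E ->
  (forall a, K a -> \int[Q]_b h (a, b) <= c) ->
  (\int[P \x Q]_z (h z)%:E <= c%:E)%E.
Proof.
move=> mK PK ch; rewrite (fubini_tonelli1 (m1 := P) (m2 := Q) (EFin \o h) mhE h0E).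
rewrite (_ : (\int[P]_x _)%E = (\int[P]_a \int[Q]_b h (a, b))%:E).
  by rewrite lee_fin; exact: (prob_int_le_cst_on mK PK).
by rewrite prob_int_EFin//; apply: eq_integral => b _; rewrite prob_int_EFin.
Qed.

End product_bounds.

Section one_stage.
Context (R : realType) dE dA dB (E : borelSpaceType R dE)
  (A : borelSpaceType R dA) (B : borelSpaceType R dB) (G : game E A B).

Lemma integral_tilted x gamma ab (f : E -> \bar R) : measurable_fun setT f ->
  (forall y, (0 <= f y)%E) ->
  (\int[tilted G x gamma ab]_y f y =
    (expR (gamma * reward G (x, ab)))%:E * \int[transition G (x, ab)]_y f y)%E.
Proof. by move=> mf f0; rewrite ge0_integral_mscale. Qed.

Lemma measurable_tilted x gamma U : measurable U ->
  measurable_fun [set: A * B] (tilted G x gamma ^~ U).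
Proof.
move=> mU; apply: emeasurable_funM.
  apply/measurable_EFinP => /=; apply: measurableT_comp => //.
  apply: measurable_funM => //.
  by apply: measurableT_comp; [exact: measurable_reward|exact: pair1_measurable].
apply: (measurableT_comp (measurable_kernel (transition G) U mU)).
exact: pair1_measurable.
Qed.

Lemma integral_mixed_tilted x gamma (mu : probability A R) (nu : probability B R)
    (f : E -> \bar R) : measurable_fun setT f -> (forall y, (0 <= f y)%E) ->
  (\int[mixed_tilted G x gamma mu nu]_y f y =
   \int[mu \x nu]_ab ((expR (gamma * reward G (x, ab)))%:E *
     \int[transition G (x, ab)]_y f y))%E.
Proof.
move=> mf f0.
rewrite (@integral_mixture _ _ _ _ R (mu \x nu)%E (tilted G x gamma))//.
- by apply: eq_integral => ab _; rewrite integral_tilted.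
- by move=> U mU; exact: measurable_tilted.
- move=> U mU; rewrite [RHS](fubini_tonelli2 (m1 := mu) (m2 := nu))//.
  exact: measurable_tilted.
Qed.

Lemma integral_stage_law (f : decision_rule (DA G)) (g : decision_rule (DB G)) x
    (h : A * B -> R) (phi : E -> \bar R) :
  measurable_fun setT h -> (forall ab, 0 <= h ab) ->
  measurable_fun setT phi -> (forall y, (0 <= phi y)%E) ->
  (\int[stage_law f g x]_w ((h w.1)%:E * phi w.2) =
   \int[f x \x g x]_ab ((h ab)%:E * \int[transition G (x, ab)]_y phi y))%E.
Proof.
move=> mh h0 mphi phi0.
have mpair ab : measurable_fun setT (pair ab : E -> (A * B) * E).
  exact: pair1_measurable.
(* [k ab] is the law of the pair made of [ab] and the next state; the stage law is the mixture of
   these by the joint actions. *)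
have /choice[k kE] ab : exists m : {measure set ((A * B) * E) -> \bar R},
    forall U, m U = transition G (x, ab) (pair ab @^-1` U).
  unshelve eexists (pushforward (transition G (x, ab)) (pair ab)
    : {measure set ((A * B) * E) -> \bar R}) => //.
have mf : measurable_fun setT
    (fun w : (A * B) * E => ((h w.1)%:E * phi w.2)%E).
  apply: emeasurable_funM.
    by apply/measurable_EFinP; exact: measurableT_comp.
  exact: measurableT_comp.
have f0 (w : (A * B) * E) : (0 <= (h w.1)%:E * phi w.2)%E.
  by rewrite mule_ge0// lee_fin.
rewrite (@integral_mixture _ _ _ _ R (joint_actions f g x) k)//.
- apply: eq_integral => ab _.
  rewrite (@integral_image R _ _ _ _ (transition G (x, ab)) (k ab) (pair ab))//=.
  by rewrite ge0_integralZl//= lee_fin.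
- move=> U mU.
  pose V : set ((E * (A * B)) * E) := (fun t => (t.1.2, t.2)) @^-1` U.
  have mV : measurable V.
    have mt : measurable_fun setT
        (fun t : (E * (A * B)) * E => (t.1.2, t.2)).
      apply/measurable_fun_pairP; split; last exact: measurable_snd.
      exact: (measurableT_comp measurable_snd measurable_fst).
    by have := mt measurableT U mU; rewrite setTI.
  rewrite (_ : k ^~ U = (fun z => transition G z (xsection V z)) \o pair x).
    apply: measurableT_comp; last exact: pair1_measurable.
    by apply: measurable_fun_xsection_finite_kernel; rewrite inE.
  by apply/funext => ab; rewrite kE/= xsectionE.
- move=> U mU; rewrite /stage_law/= /kproduct; apply: eq_integral => ab _.
  by rewrite kernel.intker_indicE// kE xsectionE.
Qed.

End one_stage.

Section kernel_probability.
Context (R : realType) d d' (X : measurableType d) (Y : measurableType d')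
  (k : R.-pker X ~> Y) (x : X).

(** The measure [k x] with the structure of a probability, to which the lemmas on bounded integrands
    apply. *)
Definition kernel_prob : set Y -> \bar R := k x.

HB.instance Definition _ := Measure.copy kernel_prob (k x).

HB.instance Definition _ :=
  Measure_isProbability.Build _ _ _ kernel_prob (@prob_kernel _ _ _ _ _ k x).

End kernel_probability.

(** * Regularity of the stage payoff *)

Section risk_class.
Context (R : realType) dE dA dB (E : borelSpaceType R dE)
  (A : borelSpaceType R dA) (B : borelSpaceType R dB) (G : game E A B).
Variable beta : R.

(* A class of functions stable under the game operator, on which continuity in
   the risk parameter is uniform in the state: no integral of a
   function varying with the measure then has to be studied. *)
Definition risk_class (v : E -> R -> R) :=
  [/\ forall x gamma, 0 <= v x gamma, forall gamma, continuous (v ^~ gamma),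
      forall M, exists C, forall x gamma, `|gamma| <= M -> v x gamma <= C &
      forall gamma e, 0 < e -> \forall gamma' \near gamma,
        forall x, `|v x gamma' - v x gamma| <= e].

Definition stage_payoff (v : E -> R -> R) x gamma a b : R :=
  expR (gamma * reward G (x, (a, b))) *
  \int[transition G (x, (a, b))]_y v y (beta * gamma).

Hypothesis hbeta : 0 < beta <= 1.
Hypothesis A3 : continuous (reward G).
Hypothesis A4 : forall v : E -> R, continuous v -> bounded_fun v ->
  continuous (fun z => \int[transition G z]_y v y).

Lemma risk_class_bcont v gamma : risk_class v -> bcont (v ^~ gamma).
Proof.
move=> [v0 cv bv _]; split; first exact: cv.
have [C vC] := bv `|gamma|; exists C => x.
by rewrite ger0_norm// vC.
Qed.

Lemma kernel_intE z (f : E -> R) :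
  \int[transition G z]_y f y = \int[kernel_prob (transition G) z]_y f y.
Proof. by []. Qed.

Lemma stage_int_bounds v gamma C z : risk_class v ->
  (forall x, v x gamma <= C) -> 0 <= \int[transition G z]_y v y gamma <= C.
Proof.
move=> cv vC; rewrite kernel_intE; have bv := bcont_bmeas (risk_class_bcont gamma cv).
have [v0 _ _ _] := cv.
apply/andP; split; first by apply: Rintegral_ge0 => y _; exact: v0.
by apply: (prob_int_le_cst_on measurableT) => //; exact: probability_setT.
Qed.

Lemma stage_int_lip v gamma gamma' e z : risk_class v ->
  (forall x, `|v x gamma' - v x gamma| <= e) ->
  `|\int[transition G z]_y v y gamma' - \int[transition G z]_y v y gamma| <= e.
Proof.
move=> cv h; rewrite !kernel_intE.
have bv g := risk_class_bcont g cv.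
have bmv g := bcont_bmeas (bv g).
rewrite -RintegralB//; last 2 first.
- exact: (bmeas_integrable _ (bmv gamma')).
- exact: (bmeas_integrable _ (bmv gamma)).
apply: prob_int_norm => //.
by apply: bcont_bmeas; apply: bcontB.
Qed.

Lemma reward_sup_ge0 : 0 <= reward_sup G.
Proof.
by have /andP[/le_trans] := reward_bounds G (point, (point, point)); apply.
Qed.

Lemma exp_reward_le M gamma z : `|gamma| <= M ->
  expR (gamma * reward G z) <= expR (M * reward_sup G).
Proof.
move=> gM; have /andP[r0 r1] := reward_bounds G z.
rewrite ler_expR (le_trans (ler_norm _))// normrM (ger0_norm r0).
by rewrite ler_pM.
Qed.

Lemma exp_reward_near (gamma e : R) : 0 < e -> \forall gamma' \near gamma, forall z,
  `|expR (gamma' * reward G z) - expR (gamma * reward G z)| <= e.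
Proof.
move=> e0; set D := expR (`|gamma| * reward_sup G).
have D0 : 0 < D by exact: expR_gt0.
have c : expR (`|gamma' - gamma| * reward_sup G) @[gamma' --> gamma] --> (1 : R).
  have -> : (1 : R) = expR (`|gamma - gamma| * reward_sup G).
    by rewrite subrr normr0 mul0r expR0.
  apply: continuous_comp; last exact: continuous_expR.
  apply: cvgM; last exact: cvg_cst.
  by apply: cvg_norm; apply: cvgB; [exact: cvg_id|exact: cvg_cst].
have /cvgrPdist_le /(_ _ (divr_gt0 e0 D0)) := c.
apply: filterS => gamma' h z.
have /andP[r0 r1] := reward_bounds G z.
have -> : expR (gamma' * reward G z) - expR (gamma * reward G z) =
    expR (gamma * reward G z) * (expR ((gamma' - gamma) * reward G z) - 1).
  by rewrite mulrBr mulr1 -expRD -mulrDl addrCA subrr addr0.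
rewrite normrM (gtr0_norm (expR_gt0 _)).
(* If |t| <= T then |e^t - 1| <= e^T - 1: from above by monotonicity, from below because 1 - e^t <=
   -t <= T <= e^T - 1. Here T is free of [z]. *)
have h1 : `|expR ((gamma' - gamma) * reward G z) - 1| <= e / D.
  apply: le_trans h; rewrite distrC [leRHS]distrC [leRHS]ger0_norm; last first.
    by rewrite subr_ge0 -[leLHS]expR0 ler_expR mulr_ge0// reward_sup_ge0.
  have t1 : `|(gamma' - gamma) * reward G z| <= `|gamma' - gamma| * reward_sup G.
    by rewrite normrM (ger0_norm r0) ler_wpM2l.
  have t2 : expR ((gamma' - gamma) * reward G z) <=
      expR (`|gamma' - gamma| * reward_sup G).
    by rewrite ler_expR (le_trans (ler_norm _)).
  have t3 := expR_ge1Dx ((gamma' - gamma) * reward G z).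
  have t4 := expR_ge1Dx (`|gamma' - gamma| * reward_sup G).
  move: t1; rewrite !ler_norml => /andP[t5 t6].
  by apply/andP; split; lra.
rewrite (@le_trans _ _ (D * (e / D)))//; last by rewrite mulrCA divff ?mulr1// gt_eqF.
by rewrite ler_pM ?expR_ge0// exp_reward_le.
Qed.

Lemma stage_payoff_ge0 v x gamma a b : risk_class v ->
  0 <= stage_payoff v x gamma a b.
Proof.
move=> [v0 _ _ _]; rewrite mulr_ge0 ?expR_ge0//.
by apply: Rintegral_ge0 => y _; exact: v0.
Qed.

Lemma stage_payoff_le v M : risk_class v -> exists C, forall x gamma a b,
  `|gamma| <= M -> stage_payoff v x gamma a b <= C.
Proof.
move=> cv; have [_ _ bv _] := cv; have [C vC] := bv M.
have /andP[b0 b1] := hbeta.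
exists (expR (M * reward_sup G) * C) => x gamma a b gM.
have bg : `|beta * gamma| <= M.
  by rewrite normrM (gtr0_norm b0) (le_trans _ gM)// ler_piMl.
have /andP[i0 i1] := stage_int_bounds (x, (a, b)) cv (fun x => vC x _ bg).
by rewrite ler_pM ?expR_ge0// exp_reward_le.
Qed.

Lemma stage_payoff_payoff v : risk_class v -> payoff (stage_payoff v).
Proof.
move=> cv; have [v0 cvc bv ev] := cv; have /andP[b0 b1] := hbeta; split.
- move=> gamma.
  have -> : (fun z : E * (A * B) => stage_payoff v z.1 gamma z.2.1 z.2.2) =
      (fun z => expR (gamma * reward G z) *
        \int[transition G z]_y v y (beta * gamma)).
    by apply/funext => -[x [a b]].
  move=> z; apply: cvgM.
    apply: continuous_comp; last exact: continuous_expR.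
    by apply: cvgM; [exact: cvg_cst|exact: A3].
  apply: A4; first exact: cvc.
  exact: (bcfun_bounded (bcfun_of (risk_class_bcont (beta * gamma) cv))).
- move=> gamma; have [C HC] := stage_payoff_le `|gamma| cv; exists C => x a b.
  by rewrite ger0_norm ?stage_payoff_ge0// HC.
- move=> gamma e e0.
  have [C vC] := bv (`|gamma| + 1).
  set D := expR (`|gamma| * reward_sup G).
  have D0 : 0 < D by exact: expR_gt0.
  have C0 : 0 <= C.
    by apply: le_trans (v0 point 0) _; apply: vC; rewrite normr0 addr_ge0.
  have C1 : 0 < C + 1 by rewrite ltr_wpDl.
  (* Each factor of the product receives half of [e]: the variation of the exponential is multiplied
     by an integral at most [C], that of the integral by an exponential at most [D]. [C] may vanish,
     hence [C + 1]; it bounds [v] up to [|gamma| + 1], which covers [beta * gamma'] for [gamma']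
     within 1 of [gamma]. *)
  have e1 : 0 < e / 2 / (C + 1) by rewrite !divr_gt0.
  have e2 : 0 < e / 2 / D by rewrite !divr_gt0.
  have n1 := exp_reward_near gamma e1.
  have n2 : \forall gamma' \near gamma,
      forall y, `|v y (beta * gamma') - v y (beta * gamma)| <= e / 2 / D.
    have c : beta * gamma' @[gamma' --> gamma] --> beta * gamma.
      by apply: cvgM; [exact: cvg_cst|exact: cvg_id].
    exact: (c _ (ev (beta * gamma) _ e2)).
  have n3 : \forall gamma' \near gamma, `|gamma - gamma'| <= 1.
    have : gamma' @[gamma' --> gamma] --> gamma by exact: cvg_id.
    by move=> /cvgrPdist_le; apply.
  near=> gamma' => x a b.
  have hz : forall z, `|expR (gamma' * reward G z) - expR (gamma * reward G z)| <=
      e / 2 / (C + 1) by near: gamma'.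
  set z := (x, (a, b)); rewrite /stage_payoff -/z.
  set r := reward G z.
  set I' := \int[transition G z]_y v y (beta * gamma').
  set I := \int[transition G z]_y v y (beta * gamma).
  have hI : `|I' - I| <= e / 2 / D.
    by apply: stage_int_lip => //; near: gamma'.
  have hr : `|expR (gamma' * r) - expR (gamma * r)| <= e / 2 / (C + 1).
    exact: hz.
  have bg : `|beta * gamma'| <= `|gamma| + 1.
    rewrite normrM (gtr0_norm b0) (@le_trans _ _ `|gamma'|) ?ler_piMl//.
    rewrite -[gamma'](subrK gamma) addrC (le_trans (ler_normD _ _))// lerD2l distrC.
    by near: gamma'.
  have /andP[i0 i1] : 0 <= I' <= C := stage_int_bounds z cv (fun y => vC y _ bg).
  have -> : expR (gamma' * r) * I' - expR (gamma * r) * I =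
      (expR (gamma' * r) - expR (gamma * r)) * I' + expR (gamma * r) * (I' - I).
    by ring.
  rewrite (le_trans (ler_normD _ _))// [e]splitr lerD// normrM.
    rewrite (ger0_norm i0) (@le_trans _ _ (e / 2 / (C + 1) * (C + 1)))//.
      by rewrite ler_pM// (le_trans i1)// lerDl.
    by rewrite divfK// gt_eqF.
  rewrite (gtr0_norm (expR_gt0 _)) (@le_trans _ _ (D * (e / 2 / D)))//.
    by rewrite ler_pM ?expR_ge0// exp_reward_le.
  by rewrite mulrCA divff ?mulr1// gt_eqF.
Unshelve. all: by end_near. Qed.

End risk_class.

(** * The value functions and the one-stage operator *)

Section value_functions.
Context (R : realType) dE dA dB (E : borelSpaceType R dE)
  (A : borelSpaceType R dA) (B : borelSpaceType R dB) (G : game E A B).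
Variable beta : R.
Hypothesis hbeta : 0 < beta <= 1.
Hypothesis A1_player1 : forall x : E, compact (actions (DA G) x).
Hypothesis A1_player2 : forall x : E, compact (actions (DB G) x).
Hypothesis A2_player1 : continuous_correspondence (actions (DA G)).
Hypothesis A2_player2 : continuous_correspondence (actions (DB G)).
Hypothesis A3 : continuous (reward G).
Hypothesis A4 : forall v : E -> R, continuous v -> bounded_fun v ->
  continuous (fun z => \int[transition G z]_y v y).

Notation K := (actions (DA G)).
Notation L := (actions (DB G)).

Lemma correspondence_usc dS (S : borelSpaceType R dS) (C : E -> set S) :
  Defs.upper_semicontinuous C -> usc C.
Proof.
move=> uC x U oU CU.
have cF := uC _ (open_closedC oU).
have : open (~` [set x | C x `&` ~` U !=set0]) by exact: closed_openC.
move=> oF; have : nbhs x (~` [set x | C x `&` ~` U !=set0]).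
  apply: open_nbhs_nbhs; split => // -[s [Cs]]; apply.
  exact: CU.
apply: filterS => y /= nCy s Cs; apply: contrapT => Us; apply: nCy.
by exists s.
Qed.

Lemma correspondence_lsc dS (S : borelSpaceType R dS) (C : E -> set S) :
  Defs.lower_semicontinuous C -> lsc C.
Proof.
move=> lC x U oU CU; exact: (open_nbhs_nbhs (conj (lC U oU) CU)).
Qed.

Lemma actions_A_neq0 x : K x !=set0.
Proof. by have [h _ hD] := graph_DA G; exists (h x); exact: hD. Qed.

Lemma actions_B_neq0 x : L x !=set0.
Proof. by have [h _ hD] := graph_DB G; exists (h x); exact: hD. Qed.

Let uK : usc K. Proof. by apply: correspondence_usc; case: A2_player1. Qed.
Let lK : lsc K. Proof. by apply: correspondence_lsc; case: A2_player1. Qed.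
Let uL : usc L. Proof. by apply: correspondence_usc; case: A2_player2. Qed.
Let lL : lsc L. Proof. by apply: correspondence_lsc; case: A2_player2. Qed.
Let mK x : measurable (K x).
Proof. exact: borel_compact_measurable. Qed.
Let mL x : measurable (L x).
Proof. exact: borel_compact_measurable. Qed.

Definition next_value (v : E -> R -> R) x gamma :=
  Val K L (stage_payoff G beta v) (x, gamma).

Let payoff_of v : risk_class v -> payoff (stage_payoff G beta v).
Proof. exact: stage_payoff_payoff. Qed.

Lemma value_selection1 v : risk_class v ->
  exists mu : E * R -> probability A R,
    measurable_fun setT (mu : E * R -> borel_prob A) /\
    forall z, prob_on (K z.1) (mu z) /\ forall b, L z.1 b ->
      next_value v z.1 z.2 <= \int[mu z]_a stage_payoff G beta v z.1 z.2 a b.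
Proof.
move=> cv.
have [mu [mmu muP]] := optimal_selection A1_player1 A1_player2 actions_A_neq0
  actions_B_neq0 lK uK lL uL (payoff_of cv).
by exists mu; split => // -[x gamma]; exact: muP.
Qed.

(** The selection for player 1 in the exchanged game, with the signs restored by [val_swap]. *)
Lemma value_selection2 v : risk_class v ->
  exists nu : E * R -> probability B R,
    measurable_fun setT (nu : E * R -> borel_prob B) /\
    forall z, prob_on (L z.1) (nu z) /\ forall a, K z.1 a ->
      \int[nu z]_b stage_payoff G beta v z.1 z.2 a b <= next_value v z.1 z.2.
Proof.
move=> cv; have pH := payoff_of cv; have [Hc Hb He] := pH.
pose H' x gamma := swap_payoff (stage_payoff G beta v x gamma).
have pH' : payoff H' by exact: payoff_swap.
have [nu [mnu nuP]] := optimal_selection A1_player2 A1_player1 actions_B_neq0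
  actions_A_neq0 lL uL lK uK pH'.
exists nu; split => // -[x gamma]; have [nuL nub] := nuP (x, gamma).
split => // a Ka; have := nub a Ka.
have [M HM] := Hb gamma.
rewrite /Val/= (val_swap (@A1_player1 x) (@A1_player2 x) (actions_A_neq0 x)
  (actions_B_neq0 x) (payoff_section (x := x) (gamma := gamma) pH) (HM x)).
have bH : bmeas (fun b => stage_payoff G beta v x gamma a b).
  by apply: bcont_bmeas; exact: payoff_bcontr.
rewrite (_ : \int[nu (x, gamma)]_b H' x gamma b a =
    - \int[nu (x, gamma)]_b stage_payoff G beta v x gamma a b).
  by rewrite lerN2.
rewrite -[RHS]mulN1r -prob_intZ//; apply: eq_Rintegral => b _.
by rewrite mulN1r.
Qed.

Lemma next_value_bounds v x gamma C : risk_class v ->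
  (forall a b, stage_payoff G beta v x gamma a b <= C) ->
  0 <= next_value v x gamma <= C.
Proof.
move=> cv HC; have pH := payoff_of cv.
have [mu [_ /(_ (x, gamma))[/= muK mub]]] := value_selection1 cv.
have bH b : bmeas (fun a => stage_payoff G beta v x gamma a b).
  by apply: bcont_bmeas; exact: payoff_bcont.
apply/andP; split.
  apply: (le_Val_prob (z := (x, gamma)) A1_player1 A1_player2 actions_A_neq0
    actions_B_neq0 pH muK).
  by move=> b Lb; apply: Rintegral_ge0 => a _; exact: stage_payoff_ge0.
have [b Lb] := actions_B_neq0 x; rewrite (le_trans (mub b Lb))//.
by apply: (prob_int_le_cst_on measurableT) => //; exact: probability_setT.
Qed.

Lemma risk_class_next_value v : risk_class v -> risk_class (next_value v).
Proof.
move=> cv; have pH := payoff_of cv; split.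
- move=> x gamma; have [C HC] := stage_payoff_le G hbeta `|gamma| cv.
  by have /andP[] := next_value_bounds cv (fun a b => HC x gamma a b (lexx _)).
- move=> gamma; exact: (@Val_continuous_state _ _ _ _ _ _ _ K L A1_player1
    A1_player2 actions_A_neq0 actions_B_neq0 lK uK lL uL _ gamma pH).
- move=> M; have [C HC] := stage_payoff_le G hbeta M cv; exists C => x gamma gM.
  by have /andP[] := next_value_bounds cv (fun a b => HC x gamma a b gM).
- move=> gamma e e0; exact: (Val_near actions_A_neq0 actions_B_neq0 gamma pH e0).
Qed.

Fixpoint value_fun (n : nat) : E -> R -> R :=
  if n is n'.+1 then next_value (value_fun n') else fun _ _ => 1.

Lemma risk_class_value_fun n : risk_class (value_fun n).
Proof.
elim: n => [|n ih] /=; last exact: risk_class_next_value.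
split => //.
- by move=> gamma x; exact: cvg_cst.
- by move=> M; exists 1.
- by move=> gamma e e0; near=> gamma' => x; rewrite subrr normr0 ltW.
Unshelve. all: by end_near. Qed.

Lemma value_fun_continuous n :
  continuous (fun z : E * R => value_fun n z.1 z.2).
Proof.
case: n => [|n]; first by move=> z; exact: cvg_cst.
rewrite (_ : (fun z => _) = Val K L (stage_payoff G beta (value_fun n))).
  exact: (@Val_continuous _ _ _ _ _ _ _ K L A1_player1 A1_player2
    actions_A_neq0 actions_B_neq0 lK uK lL uL _
    (payoff_of (risk_class_value_fun n))).
by apply/funext => -[x gamma].
Qed.

Lemma LopE v x gamma (mu : probability A R) (nu : probability B R) : risk_class v ->
  (Lop G beta (fun y g => (v y g)%:E) x gamma mu nu =
   \int[mu \x nu]_ab (stage_payoff G beta v x gamma ab.1 ab.2)%:E)%E.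
Proof.
move=> cv; have bv := risk_class_bcont (beta * gamma) cv.
have [v0 _ _ _] := cv.
have [mv _] := bcont_bmeas bv.
rewrite /Lop integral_mixed_tilted//; last 2 first.
- exact/measurable_EFinP.
- by move=> y; rewrite lee_fin.
apply: eq_integral => -[a b] _; rewrite /stage_payoff EFinM; congr (_ * _)%E.
rewrite kernel_intE prob_int_EFin//; exact: bcont_bmeas.
Qed.

Lemma stage_payoff_prod v x gamma : risk_class v ->
  let h := fun ab : A * B => stage_payoff G beta v x gamma ab.1 ab.2 in
  [/\ measurable_fun setT h, forall z, 0 <= h z & exists M, forall z, h z <= M].
Proof.
move=> cv h; split.
- apply: measurable_continuous_prod; apply: payoff_section; exact: payoff_of.
- by move=> z; exact: stage_payoff_ge0.
- have [C HC] := stage_payoff_le G hbeta `|gamma| cv; exists C => z.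
  exact: HC.
Qed.

(** A guarantee against pure actions is one against every mixed action carried by [L x]. *)
Lemma Lop_ge v x gamma (mu : probability A R) (nu : probability B R) c :
  risk_class v -> prob_on (L x) nu ->
  (forall b, L x b -> c <= \int[mu]_a stage_payoff G beta v x gamma a b) ->
  (c%:E <= Lop G beta (fun y g => (v y g)%:E) x gamma mu nu)%E.
Proof.
move=> cv nuL hc; rewrite LopE//.
have [mh h0 [M hM]] := stage_payoff_prod x gamma cv.
exact: (product_ge mh h0 hM (mL x) nuL hc).
Qed.

Lemma Lop_le v x gamma (mu : probability A R) (nu : probability B R) c :
  risk_class v -> prob_on (K x) mu ->
  (forall a, K x a -> \int[nu]_b stage_payoff G beta v x gamma a b <= c) ->
  (Lop G beta (fun y g => (v y g)%:E) x gamma mu nu <= c%:E)%E.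
Proof.
move=> cv muK hc; rewrite LopE//.
have [mh h0 [M hM]] := stage_payoff_prod x gamma cv.
exact: (product_le mh h0 hM (mK x) muK hc).
Qed.

End value_functions.

(** * Comparison of policies with value functions, stage by stage *)

Section dynamic_programming.
Context (R : realType) dE dA dB (E : borelSpaceType R dE)
  (A : borelSpaceType R dA) (B : borelSpaceType R dB) (G : game E A B).
Variables (beta gamma : R) (pi : policy (DA G)) (sigma : policy (DB G)) (x : E).
Local Open Scope ereal_scope.

Definition path_weight n (p : n.-tuple (E * (A * B)) * E) : R :=
  expR (gamma * \sum_(k < n) beta ^+ k * reward G (tnth p.1 k)).

Lemma measurable_path_weight n :
  measurable_fun setT (@path_weight n).
Proof.
apply: measurableT_comp => //; apply: measurable_funM => //.
apply: measurable_sum => k; apply: measurable_funM; first exact: measurable_cst.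
apply: measurableT_comp; first exact: measurable_reward.
exact: (measurableT_comp (measurable_tnth k) measurable_fst).
Qed.

Lemma path_weight_extend n (p : n.-tuple (E * (A * B)) * E) w :
  path_weight (extend_path p w) =
  (path_weight p * expR (gamma * beta ^+ n * reward G (p.2, w.1)))%R.
Proof.
rewrite /path_weight -expRD; congr expR.
rewrite big_ord_recr/= mulrDr mulrA; congr (_ + _)%R.
  congr (_ * _)%R; apply: eq_bigr => k _; congr (_ * reward G _)%R.
  by rewrite !(tnth_nth (p.2, w.1))/= nth_rcons size_tuple ltn_ord.
by rewrite (tnth_nth (p.2, w.1))/= nth_rcons size_tuple ltnn eqxx.
Qed.

(** The payoff of the first [n] stages with continuation [phi]. It interpolates between the value
    function, at [n = 0], and the payoff of the policies, at [n = N]. *)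
Definition weighted_value n (phi : E -> \bar R) : \bar R :=
  \int[path_law pi sigma n x]_p ((path_weight p)%:E * phi p.2).

Definition stage_value n (phi : E -> \bar R) y : \bar R :=
  \int[stage_law (pi n) (sigma n) y]_w
    ((expR (gamma * beta ^+ n * reward G (y, w.1)))%:E * phi w.2).

Lemma measurable_weighted n (phi : E -> \bar R) : measurable_fun setT phi ->
  measurable_fun setT (fun p : n.-tuple (E * (A * B)) * E =>
    (path_weight p)%:E * phi p.2).
Proof.
move=> mphi; apply: emeasurable_funM.
  by apply/measurable_EFinP; exact: (@measurable_path_weight n).
exact: measurableT_comp measurable_snd.
Qed.

Lemma weighted_ge0 n (phi : E -> \bar R) (p : n.-tuple (E * (A * B)) * E) :
  (forall y, 0 <= phi y) -> 0 <= (path_weight p)%:E * phi p.2.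
Proof. by move=> phi0; rewrite mule_ge0 ?lee_fin ?expR_ge0. Qed.

Lemma stage_value_ge0 n (phi : E -> \bar R) y :
  (forall z, 0 <= phi z) -> 0 <= stage_value n phi y.
Proof.
by move=> phi0; apply: integral_ge0 => w _; rewrite mule_ge0 ?lee_fin ?expR_ge0.
Qed.

Let measurable_stage_integrand n (phi : E -> \bar R) : measurable_fun setT phi ->
  measurable_fun setT (fun z : E * ((A * B) * E) =>
    (expR (gamma * beta ^+ n * reward G (z.1, z.2.1)))%:E * phi z.2.2).
Proof.
move=> mphi; apply: emeasurable_funM.
  apply/measurable_EFinP; apply: measurableT_comp => //.
  apply: measurable_funM => //.
  apply: measurableT_comp; first exact: measurable_reward.
  apply/measurable_fun_pairP; split; first exact: measurable_fst.
  exact: (measurableT_comp measurable_fst measurable_snd).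
apply: measurableT_comp => //.
exact: (measurableT_comp measurable_snd measurable_snd).
Qed.

Lemma measurable_stage_value n (phi : E -> \bar R) : measurable_fun setT phi ->
  (forall y, 0 <= phi y) -> measurable_fun setT (stage_value n phi).
Proof.
move=> mphi phi0; apply: (measurable_fun_integral_sfinite_kernel
  (fun z : E * ((A * B) * E) =>
    (expR (gamma * beta ^+ n * reward G (z.1, z.2.1)))%:E * phi z.2.2)
  (stage_law (pi n) (sigma n))).
  by move=> z; rewrite mule_ge0 ?lee_fin ?expR_ge0.
exact: measurable_stage_integrand.
Qed.

Lemma weighted_value0 (phi : E -> \bar R) : measurable_fun setT phi ->
  weighted_value 0 phi = phi x.
Proof.
move=> mphi; rewrite /weighted_value /= integral_dirac//; last first.
  exact: measurable_weighted.
by rewrite diracT mul1e /path_weight big_ord0 mulr0 expR0 mul1e.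
Qed.

(** The exponential turns the sum of rewards into a product, so the weight of the past is a constant
    for the law of the last stage and comes out of its integral. *)
Lemma weighted_valueS n (phi : E -> \bar R) : measurable_fun setT phi ->
  (forall y, 0 <= phi y) ->
  weighted_value n.+1 phi = weighted_value n (stage_value n phi).
Proof.
move=> mphi phi0; rewrite /weighted_value.
rewrite (@integral_mixture _ _ _ _ R (path_law pi sigma n x)
  (step (pi n) (sigma n) (n := n))); first last.
- by move=> p; exact: weighted_ge0.
- exact: measurable_weighted.
- by [].
- by move=> U mU; exact: measurable_kernel.
apply: eq_integral => p _.
have mext : measurable_fun setT (extend_path p).
  exact: measurableT_comp (@measurable_extend_path _ _ _ _ E A B n)
    (pair1_measurable p).
rewrite (@integral_image R _ _ _ _ (stage_law (pi n) (sigma n) p.2) _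
  (extend_path p))//; first last.
- by move=> q; exact: weighted_ge0.
- exact: measurable_weighted.
under eq_integral do rewrite path_weight_extend EFinM -muleA.
rewrite ge0_integralZl//; last 3 first.
- exact: measurableT_comp (measurable_stage_integrand n mphi)
    (pair1_measurable p.2).
- by move=> w _; rewrite mule_ge0 ?lee_fin ?expR_ge0.
- by rewrite lee_fin expR_ge0.
Qed.

Lemma weighted_value_le n (phi psi : E -> \bar R) : measurable_fun setT phi ->
  measurable_fun setT psi -> (forall y, 0 <= phi y) ->
  (forall y, phi y <= psi y) -> weighted_value n phi <= weighted_value n psi.
Proof.
move=> mphi mpsi phi0 h; apply: ge0_le_integral => //.
- by move=> p _; exact: weighted_ge0.
- exact: measurable_weighted.
- exact: measurable_weighted.
- by move=> p _; rewrite lee_wpmul2l ?lee_fin ?expR_ge0.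
Qed.

(** One more stage multiplies the risk parameter by [beta], the shift built into [Lop]. *)
Lemma stage_valueE n (v : E -> R -> \bar R) y :
  measurable_fun setT (v ^~ (gamma * beta ^+ n.+1)%R) ->
  (forall y, 0 <= v y (gamma * beta ^+ n.+1)%R) ->
  stage_value n (v ^~ (gamma * beta ^+ n.+1)%R) y =
  Lop G beta v y (gamma * beta ^+ n)%R (pi n y) (sigma n y).
Proof.
move=> mv v0; rewrite /Lop (_ : (beta * _ = gamma * beta ^+ n.+1)%R); last first.
  by rewrite exprS; ring.
rewrite integral_mixed_tilted// /stage_value.
apply: (integral_stage_law (pi n) (sigma n) y
  (h := fun ab => expR (gamma * beta ^+ n * reward G (y, ab)))) => //.
  apply: measurableT_comp => //; apply: measurable_funM => //.
  by apply: measurableT_comp; [exact: measurable_reward|exact: pair1_measurable].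
Qed.

Variables (v : nat -> E -> R -> \bar R) (N : nat).
Hypotheses (mv : forall n g, measurable_fun setT (v n ^~ g))
  (v_ge0 : forall n y g, 0 <= v n y g) (v0 : forall y g, v 0 y g = 1).

Let weighted_value_end :
  weighted_value N (v (N - N) ^~ (gamma * beta ^+ N)%R) =
  policy_value beta N pi sigma x gamma.
Proof.
by rewrite subnn; apply: eq_integral => p _; rewrite v0 mule1.
Qed.

Let weighted_value_start :
  weighted_value 0 (v (N - 0) ^~ (gamma * beta ^+ 0)%R) = v N x gamma.
Proof. by rewrite weighted_value0// expr0 mulr1 subn0. Qed.

Lemma le_policy_value :
  (forall k y, (k < N)%N -> v (N - k) y (gamma * beta ^+ k)%R <=
    Lop G beta (v (N - k.+1)) y (gamma * beta ^+ k)%R (pi k y) (sigma k y)) ->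
  v N x gamma <= policy_value beta N pi sigma x gamma.
Proof.
move=> vL; rewrite -weighted_value_start -weighted_value_end.
suff : forall k, (k <= N)%N ->
    weighted_value 0 (v (N - 0) ^~ (gamma * beta ^+ 0)%R) <=
    weighted_value k (v (N - k) ^~ (gamma * beta ^+ k)%R) by apply.
elim=> [//|k ih] kN; apply: (le_trans (ih (ltnW kN))).
rewrite [leRHS]weighted_valueS//; apply: weighted_value_le => //.
- exact: measurable_stage_value.
- by move=> y; rewrite stage_valueE// vL.
Qed.

Lemma policy_value_le :
  (forall k y, (k < N)%N ->
    Lop G beta (v (N - k.+1)) y (gamma * beta ^+ k)%R (pi k y) (sigma k y) <=
    v (N - k) y (gamma * beta ^+ k)%R) ->
  policy_value beta N pi sigma x gamma <= v N x gamma.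
Proof.
move=> vL; rewrite -weighted_value_start -weighted_value_end.
suff : forall k, (k <= N)%N ->
    weighted_value k (v (N - k) ^~ (gamma * beta ^+ k)%R) <=
    weighted_value 0 (v (N - 0) ^~ (gamma * beta ^+ 0)%R) by apply.
elim=> [//|k ih] kN; apply: le_trans (ih (ltnW kN)).
rewrite weighted_valueS//; apply: weighted_value_le => //.
- exact: measurable_stage_value.
- by move=> y; exact: stage_value_ge0.
- by move=> y; rewrite stage_valueE// vL.
Qed.

End dynamic_programming.

(** * Saddle points and decision rules read off from a selection *)

Section minimax_values.
Context (R : realType) (X Y : Type) (M : set X) (N : set Y) (h : X -> Y -> \bar R).
Local Open Scope ereal_scope.

(** The two guarantees squeeze both values. It is used for mixed actions in one stage and for
    policies in the whole game. *)
Lemma minimax_values m n c : M m -> N n ->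
  (forall n', N n' -> c <= h m n') -> (forall m', M m' -> h m' n <= c) ->
  [/\ ereal_inf [set ereal_sup [set h m' n' | m' in M] | n' in N] = c,
      ereal_sup [set ereal_inf [set h m' n' | n' in N] | m' in M] = c &
      saddle_point M N h m n].
Proof.
move=> Mm Nn cm cn; have hc : h m n = c by apply/eqP; rewrite eq_le cn ?cm.
split.
- apply/eqP; rewrite eq_le; apply/andP; split.
    apply: (@le_trans _ _ (ereal_sup [set h m' n | m' in M])).
      by apply: ereal_inf_lbound; exists n.
    by apply: ge_ereal_sup => _ [m' Mm' <-]; exact: cn.
  apply: le_ereal_inf_tmp => _ [n' Nn' <-].
  by apply: (le_trans (cm _ Nn')); apply: ereal_sup_ubound; exists m.
- apply/eqP; rewrite eq_le; apply/andP; split.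
    apply: ge_ereal_sup => _ [m' Mm' <-].
    by apply: (le_trans _ (cn _ Mm')); apply: ereal_inf_lbound; exists n.
  apply: (@le_trans _ _ (ereal_inf [set h m n' | n' in N])).
    by apply: le_ereal_inf_tmp => _ [n' Nn' <-]; exact: cm.
  by apply: ereal_sup_ubound; exists m.
- by split=> // m' n' Mm' Nn'; rewrite hc cn ?cm.
Qed.

(** The payoff at a saddle point does not depend on the saddle point, which is what lets an
    arbitrary selection be compared with the value functions. *)
Lemma saddle_point_value m n : saddle_point M N h m n ->
  h m n = ereal_inf [set ereal_sup [set h m' n' | m' in M] | n' in N].
Proof.
move=> [Mm Nn hmn].
have [-> _ _] // := @minimax_values m n (h m n) Mm Nn
  (fun n' Nn' => (hmn m n' Mm Nn').2) (fun m' Mm' => (hmn m' n Mm' Nn).1).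
Qed.

End minimax_values.

Lemma selection_rule (R : realType) dE dS (E : borelSpaceType R dE)
    (S : borelSpaceType R dS) (D : set (E * S)) (Z : set (E * R)) gamma
    (mu : E * R -> probability S R) :
  measurable Z -> measurable_fun Z (mu : E * R -> borel_prob S) ->
  (forall x, Z (x, gamma)) ->
  (forall z, Z z -> prob_on (actions D z.1) (mu z)) ->
  exists f : decision_rule D, forall x, f x = mu (x, gamma).
Proof.
move=> mZ mmu Zx muD.
have mf : measurable_fun setT ((fun x => mu (x, gamma)) : E -> borel_prob S).
  apply: (measurable_comp mZ _ mmu (pair2_measurable gamma)).
  by move=> _ [x _ <-]; exact: Zx.
by exists (DecisionRule mf (fun x => muD _ (Zx x))).
Qed.

Lemma measurable_risk_domain (R : realType) dE (E : borelSpaceType R dE)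
    (gbar : R) : measurable (risk_domain gbar : set (E * R)).
Proof.
rewrite (_ : risk_domain gbar = setT `*` `]0, gbar]%classic); last first.
  by apply/seteqP; split => [[x g]|[x g] []]; rewrite /risk_domain/= in_itv/=.
by apply: measurableX.
Qed.

(** * The value of the game and optimal policies *)

Section game.
Context (R : realType) dE dA dB (E : borelSpaceType R dE)
  (A : borelSpaceType R dA) (B : borelSpaceType R dB) (G : game E A B).
Variable beta : R.
Hypothesis hbeta : 0 < beta <= 1.
Hypothesis A1_player1 : forall x : E, compact (actions (DA G) x).
Hypothesis A1_player2 : forall x : E, compact (actions (DB G) x).
Hypothesis A2_player1 : continuous_correspondence (actions (DA G)).
Hypothesis A2_player2 : continuous_correspondence (actions (DB G)).
Hypothesis A3 : continuous (reward G).
Hypothesis A4 : forall v : E -> R, continuous v -> bounded_fun v ->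
  continuous (fun z => \int[transition G z]_y v y).

Definition ext_value_fun (n : nat) (y : E) (g : R) : \bar R :=
  (value_fun G beta n y g)%:E.

Local Notation u := ext_value_fun.

Let risk_class_u n : risk_class (value_fun G beta n).
Proof. exact: risk_class_value_fun. Qed.

Let measurable_u n g : measurable_fun setT (u n ^~ g).
Proof.
apply/measurable_EFinP; apply: measurable_fun_continuous_borel.
by have [_ + _ _] := risk_class_u n; apply.
Qed.

Let u_ge0 n y g : (0 <= u n y g)%E.
Proof. by rewrite lee_fin; have [+ _ _ _] := risk_class_u n; apply. Qed.

Lemma stage_saddle_selection n : exists mu nu,
  [/\ measurable_fun setT (mu : E * R -> borel_prob A),
      measurable_fun setT (nu : E * R -> borel_prob B) &
      forall z, [/\ prob_on (actions (DA G) z.1) (mu z),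
        prob_on (actions (DB G) z.1) (nu z),
        forall nu', prob_on (actions (DB G) z.1) nu' ->
          (u n.+1 z.1 z.2 <= Lop G beta (u n) z.1 z.2 (mu z) nu')%E &
        forall mu', prob_on (actions (DA G) z.1) mu' ->
          (Lop G beta (u n) z.1 z.2 mu' (nu z) <= u n.+1 z.1 z.2)%E]].
Proof.
have [mu [mmu muP]] := value_selection1 hbeta A1_player1 A1_player2 A2_player1
  A2_player2 A3 A4 (risk_class_u n).
have [nu [mnu nuP]] := value_selection2 hbeta A1_player1 A1_player2 A2_player1
  A2_player2 A3 A4 (risk_class_u n).
exists mu, nu; split => // z.
have [muK mub] := muP z; have [nuL nub] := nuP z; split => //.
- by move=> nu' nu'L; exact: Lop_ge.
- by move=> mu' mu'K; exact: Lop_le.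
Qed.

Lemma stage_values n z :
  [/\ Top G beta (u n) z.1 z.2 = u n.+1 z.1 z.2,
    ereal_sup [set ereal_inf [set Lop G beta (u n) z.1 z.2 mu nu
      | nu in prob_on (actions (DB G) z.1)]
      | mu in prob_on (actions (DA G) z.1)] = u n.+1 z.1 z.2 &
    exists mu nu, saddle_point (prob_on (actions (DA G) z.1))
      (prob_on (actions (DB G) z.1)) (Lop G beta (u n) z.1 z.2) mu nu].
Proof.
have [mu [nu [_ _ /(_ z)[muK nuL hmu hnu]]]] := stage_saddle_selection n.
have [h1 h2 h3] := minimax_values muK nuL hmu hnu.
by split => //; exists (mu z), (nu z).
Qed.

(** The given selection need not be the constructed one, but its payoff is the value of the stage,
    hence [u n.+1]; the saddle inequalities then become guarantees. *)
Lemma saddle_selection_guarantee gbar n mu nu z :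
  saddle_selection G beta gbar (u n) mu nu -> risk_domain gbar z ->
  [/\ prob_on (actions (DA G) z.1) (mu z), prob_on (actions (DB G) z.1) (nu z),
    forall nu', prob_on (actions (DB G) z.1) nu' ->
      (u n.+1 z.1 z.2 <= Lop G beta (u n) z.1 z.2 (mu z) nu')%E &
    forall mu', prob_on (actions (DA G) z.1) mu' ->
      (Lop G beta (u n) z.1 z.2 mu' (nu z) <= u n.+1 z.1 z.2)%E].
Proof.
move=> [_ _ /(_ z) sad] /sad{}sad; have [muK nuL h] := sad.
have := saddle_point_value sad; have [+ _ _] := stage_values n z.
rewrite /Top => -> <-; split => //.
- by move=> nu' /(h _ _ muK)[].
- by move=> mu' /h /(_ nuL)[].
Qed.

Lemma stage_policies N gamma :
  (exists pi : policy (DA G), forall k, (k < N)%N -> forall x nu,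
    prob_on (actions (DB G) x) nu ->
    (u (N - k) x (gamma * beta ^+ k) <=
     Lop G beta (u (N - k.+1)) x (gamma * beta ^+ k) (pi k x) nu)%E) /\
  (exists sigma : policy (DB G), forall k, (k < N)%N -> forall x mu,
    prob_on (actions (DA G) x) mu ->
    (Lop G beta (u (N - k.+1)) x (gamma * beta ^+ k) mu (sigma k x) <=
     u (N - k) x (gamma * beta ^+ k))%E).
Proof.
have /choice[mu /choice[nu mnuP]] := stage_saddle_selection.
split.
(* At stage [k] the continuation has [N - k.+1] stages, the index at which [stage_saddle_selection]
   is used. Truncated subtraction also defines the rules from stage [N] on. *)
- have /choice[pi piE] k : exists f : decision_rule (DA G), forall x,
      f x = mu (N - k.+1)%N (x, gamma * beta ^+ k).
    have [mmu _ muP] := mnuP (N - k.+1)%N.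
    apply: selection_rule measurableT mmu _ _ => // z _.
    by have [] := muP z.
  exists pi => k kN x nu' nuL; rewrite piE.
  have [_ _ /(_ (x, gamma * beta ^+ k))[_ _ h _]] := mnuP (N - k.+1)%N.
  by rewrite -(subnSK kN); exact: h.
- have /choice[sigma sigmaE] k : exists f : decision_rule (DB G), forall x,
      f x = nu (N - k.+1)%N (x, gamma * beta ^+ k).
    have [_ mnu nuP] := mnuP (N - k.+1)%N.
    apply: selection_rule measurableT mnu _ _ => // z _.
    by have [] := nuP z.
  exists sigma => k kN x mu' muK; rewrite sigmaE.
  have [_ _ /(_ (x, gamma * beta ^+ k))[_ _ _ h]] := mnuP (N - k.+1)%N.
  by rewrite -(subnSK kN); exact: h.
Qed.

Lemma policy_guarantee1 N gamma (pi : policy (DA G)) :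
  (forall k, (k < N)%N -> forall x nu, prob_on (actions (DB G) x) nu ->
    (u (N - k) x (gamma * beta ^+ k) <=
     Lop G beta (u (N - k.+1)) x (gamma * beta ^+ k) (pi k x) nu)%E) ->
  forall (sigma : policy (DB G)) x,
    (u N x gamma <= policy_value beta N pi sigma x gamma)%E.
Proof.
move=> h sigma x; apply: le_policy_value => // k y kN.
by apply: h => //; exact: rule_admissible.
Qed.

Lemma policy_guarantee2 N gamma (sigma : policy (DB G)) :
  (forall k, (k < N)%N -> forall x mu, prob_on (actions (DA G) x) mu ->
    (Lop G beta (u (N - k.+1)) x (gamma * beta ^+ k) mu (sigma k x) <=
     u (N - k) x (gamma * beta ^+ k))%E) ->
  forall (pi : policy (DA G)) x,
    (policy_value beta N pi sigma x gamma <= u N x gamma)%E.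
Proof.
move=> h pi x; apply: policy_value_le => // k y kN.
by apply: h => //; exact: rule_admissible.
Qed.

(** Each policy of [stage_policies] secures [u N] against all opponents, so [minimax_values] applies
    with policies as strategies. *)
Lemma upper_lower_value N x gamma :
  upper_value G beta N x gamma = u N x gamma /\
  lower_value G beta N x gamma = u N x gamma.
Proof.
have [[pi hpi] [sigma hsigma]] := stage_policies N gamma.
have [//|//|sigma' _|pi' _|? ? _] := @minimax_values R _ _ setT setT
  (fun pi sigma => policy_value beta N pi sigma x gamma) pi sigma (u N x gamma).
- exact: policy_guarantee1.
- exact: policy_guarantee2.
- by split.
Qed.

Lemma game_valueE n : game_value G beta n = u n.
Proof.
case: n => [|n]; apply/funext => x; apply/funext => gamma //=.
by have [] := upper_lower_value n.+1 x gamma.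
Qed.

End game.
Theorem theorem3p2 (R : realType) (dE dA dB : measure_display)
    (E : borelSpaceType R dE) (A : borelSpaceType R dA)
    (B : borelSpaceType R dB) (G : game E A B)
    (beta gbar : R) (N : nat)
    (hbeta : 0 < beta <= 1) (hgbar : 0 < gbar)
    (A1_player1 : forall x : E, compact (actions (DA G) x))
    (A1_player2 : forall x : E, compact (actions (DB G) x))
    (A2_player1 : continuous_correspondence (actions (DA G)))
    (A2_player2 : continuous_correspondence (actions (DB G)))
    (A3 : continuous (reward G))
    (A4 : forall v : E -> R, continuous v -> bounded_fun v ->
      continuous (fun z => \int[transition G z]_y v y)) :
  (forall n, (1 <= n <= N)%N ->
    bounded_continuous gbar (game_value G beta n) /\
    forall (x : E) (gamma : R), 0 < gamma <= gbar ->
      game_value G beta n x gamma = Top G beta (game_value G beta n.-1) x gamma /\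
      game_value G beta n x gamma =
        ereal_sup [set ereal_inf [set
          (\int[mixed_tilted G x gamma mu nu]_y
             game_value G beta n.-1 y (beta * gamma)%R)%E
          | nu in prob_on (actions (DB G) x)]
          | mu in prob_on (actions (DA G) x)]) /\
  (forall n, (1 <= n <= N)%N ->
    exists (mu : E * R -> probability A R) (nu : E * R -> probability B R),
      saddle_selection G beta gbar (game_value G beta n.-1) mu nu) /\
  has_value G beta gbar N /\
  (forall (mu : nat -> E * R -> probability A R)
          (nu : nat -> E * R -> probability B R),
    (forall n, (1 <= n <= N)%N ->
      saddle_selection G beta gbar (game_value G beta n.-1) (mu n) (nu n)) ->
    forall gamma : R, 0 < gamma <= gbar ->
      (exists pi : policy (DA G), reads_off beta N gamma mu pi) /\
      (exists sigma : policy (DB G), reads_off beta N gamma nu sigma) /\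
      (forall pi : policy (DA G), reads_off beta N gamma mu pi ->
        optimal1 beta N gamma pi) /\
      (forall sigma : policy (DB G), reads_off beta N gamma nu sigma ->
        optimal2 beta N gamma sigma)).
Proof.
have gE n := game_valueE hbeta A1_player1 A1_player2 A2_player1 A2_player2 A3 A4 n.
have ulE n x gamma := upper_lower_value hbeta A1_player1 A1_player2 A2_player1
  A2_player2 A3 A4 n x gamma.
have /andP[b0 b1] := hbeta.
split; last split; last split.
- move=> [//|n] nN; rewrite !gE/=; split.
    exists (fun z => value_fun G beta n.+1 z.1 z.2); split => //.
      by apply: continuous_subspaceT; exact: value_fun_continuous.
    have [v0 _ bv _] : risk_class (value_fun G beta n.+1).
      exact: risk_class_value_fun.
    have [C vC] := bv gbar.
    exists C; split; first exact: num_real.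
    move=> M CM z /andP[z0 zg] /=.
    by rewrite ger0_norm ?v0// (le_trans _ (ltW CM))// vC// gtr0_norm.
  move=> x gamma _.
  have [h1 h2 _] := stage_values hbeta A1_player1 A1_player2 A2_player1
    A2_player2 A3 A4 n (x, gamma).
  by split; [rewrite -h1|rewrite -h2].
- move=> [//|n] nN; rewrite gE/=.
  have [mu [nu [mmu mnu h]]] := stage_saddle_selection hbeta A1_player1
    A1_player2 A2_player1 A2_player2 A3 A4 n.
  exists mu, nu; split; [exact: (measurable_funTS mmu)|exact: (measurable_funTS mnu)|].
  move=> z _; have [muK nuL hmu hnu] := h z.
  by have [] := minimax_values muK nuL hmu hnu.
- by move=> [x gamma] _ /=; have [-> ->] := ulE N x gamma.
- move=> mu nu munu gamma /andP[g0 gg].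
  (* As [beta] is positive and at most 1, the discounted parameters stay in (0, gbar], where the
     selection is a saddle point. *)
  have dom k (x : E) : risk_domain gbar (x, gamma * beta ^+ k).
    rewrite /risk_domain/= mulr_gt0 ?exprn_gt0//= (le_trans _ gg)//.
    by rewrite ler_piMr ?(ltW g0)// exprn_ile1// ltW.
  have sel k : (k < N)%N -> saddle_selection G beta gbar
      (ext_value_fun G beta (N - k.+1)) (mu (N - k)%N) (nu (N - k)%N).
    move=> kN; rewrite subnS -gE; apply: munu.
    by rewrite subn_gt0 kN leq_subr.
  have guar k z (kN : (k < N)%N) := saddle_selection_guarantee hbeta A1_player1
    A1_player2 A2_player1 A2_player2 A3 A4 (z := z) (sel k kN).
  (* [reads_off] leaves the rules from stage [N] on free; these policies fill them in. *)
  have [[pi0 _] [sigma0 _]] := stage_policies hbeta A1_player1 A1_player2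
    A2_player1 A2_player2 A3 A4 N gamma.
  split; last split; last split.
  + have /choice[pi piE] k : exists f : decision_rule (DA G), (k < N)%N ->
        forall x, f x = mu (N - k)%N (x, gamma * beta ^+ k).
      have [kN|_] := ltnP k N; last by exists (pi0 k).
      have [mmu _ _] := sel k kN.
      have [f fE] : exists f : decision_rule (DA G),
          forall x, f x = mu (N - k)%N (x, gamma * beta ^+ k).
        apply: (selection_rule (measurable_risk_domain _) mmu (dom k)) => z.
        by move=> /(guar k z kN)[].
      by exists f.
    by exists pi => k kN x; exact: piE.
  + have /choice[sigma sigmaE] k : exists f : decision_rule (DB G), (k < N)%N ->
        forall x, f x = nu (N - k)%N (x, gamma * beta ^+ k).
      have [kN|_] := ltnP k N; last by exists (sigma0 k).
      have [_ mnu _] := sel k kN.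
      have [f fE] : exists f : decision_rule (DB G),
          forall x, f x = nu (N - k)%N (x, gamma * beta ^+ k).
        apply: (selection_rule (measurable_risk_domain _) mnu (dom k)) => z.
        by move=> /(guar k z kN)[].
      by exists f.
    by exists sigma => k kN x; exact: sigmaE.
  + move=> pi piE sigma x; have [_ ->] := ulE N x gamma.
    apply: policy_guarantee1 => // k kN y nu' nuL; rewrite piE//.
    have [_ _ h _] := guar k _ kN (dom k y).
    by rewrite -(subnSK kN) in h *; exact: h.
  + move=> sigma sigmaE pi x; have [-> _] := ulE N x gamma.
    apply: policy_guarantee2 => // k kN y mu' muK; rewrite sigmaE//.
    have [_ _ _ h] := guar k _ kN (dom k y).
    by rewrite -(subnSK kN) in h *; exact: h.
Qed.
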